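(* Let $X = P(3,\mathbb{R})_1$ be the symmetric space of positive definite symmetric real $(3\times 3)$-matrices of determinant $1$, with $SL(3,\mathbb{R})$ acting by isometries via $g(p) = g\,p\,{}^t\!g$. With the notation of the context, the following hold for $g \in SL(3,\mathbb{R})$. (1) If $g=\begin{pmatrix}1&0&0\\0&1&1\\0&0&1\end{pmatrix}$, then $g$ is parabolic and $X_g(\infty)$ is the union of all edges incident to $c_2$ (i.e. of $c_2$ and all edges sharing a vertex with $c_2$). $X_g(\infty)$ is not compact in $(X(\infty),Td)$ and has uncountably many edges. $|g|=0$. (2) If $g=\begin{pmatrix}1/a^2&0&0\\0&a&1\\0&0&a\end{pmatrix}$ with $a \in \mathbb{R}$, $a \ne 0,1$, then $g$ is parabolic, $X_g(\infty)=c_1\cup c_2\cup c_3$, and $|g|=2\sqrt6\,\log|a|$. (3) If $g=\begin{pmatrix}1&1&0\\0&1&1\\0&0&1\end{pmatrix}$, then $g$ is parabolic, $X_g(\infty)=c_1$, and $|g|=0$. (4) If $g=\begin{pmatrix}a&b&0\\-b&a&0\\0&0&1/(a^2+b^2)\end{pmatrix}$ with $a,b\in\mathbb{R}$, $a^2+b^2\neq0$ and $b\neq 0$, then $g$ is semi-simple, and (a) $X_g(\infty)=\{v_2,v_5\}$; (b) if $a^2+b^2=1$, then $g$ is elliptic and $\operatorname{Fix}(g)=\gamma_0$; (c) if $a^2+b^2\ne1$, then $g$ is hyperbolic, $|g|=\sqrt6\,\log(a^2+b^2)$, and $\operatorname{Min}(g)=\gamma_0$. (5) If $g=\operatorname{diag}(a,b,c)$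 with $a,b,c\in\mathbb{R}$ pairwise distinct and $abc=1$, then $g$ is hyperbolic, $|g|=2\sqrt{(\log|a|)^2+(\log|b|)^2+(\log|c|)^2}$, and (a) $X_g(\infty)=A_0$; (b) $\operatorname{Min}(g)=F_0$. (6) If $g=\operatorname{diag}(a,a,1/a^2)$ with $a\in\mathbb{R}$, $a\ne 0,1$, then $g$ is hyperbolic, $|g|=2\sqrt6\,\log|a|$, and (a) $X_g(\infty)=P(\gamma_0)(\infty)$; (b) $\operatorname{Min}(g)=P(\gamma_0)$. (7) If $g=e$ is the identity matrix, then $g$ acts as the identity map, so it is elliptic, with $\operatorname{Fix}(g)=X$ and $X_g(\infty)=X(\infty)$.
   Context: $P(3,\mathbb{R})$ is the manifold of positive definite symmetric real $(3\times3)$-matrices, with tangent spaces identified with the space of symmetric matrices and Riemannian metric $(u,v)_p=\operatorname{tr}(p^{-1}up^{-1}v)$. $X=P(3,\mathbb{R})_1$ is the totally geodesic submanifold of matrices of determinant $1$ with the induced metric; it is a proper $\mathrm{CAT}(0)$-space, identified with $SL(3,\mathbb{R})/SO(3)$. $e$ is the identity matrix, $T_eX$ is the space of symmetric matrices of trace $0$. Isometries: for an isometry $g$ of $X$, $d_g(p)=d(p,g(p))$, $|g|=\inf_{p\in X}d_g(p)$, $\operatorname{Min}(g)$ is the set of points where $d_g$ attains $|g|$, $\operatorname{Fix}(g)$ is the fixed point set in $X$. $g$ is elliptic if it has a fixed point in $X$; hyperbolic if there is a geodesic line on which it acts by a non-trivial translation; parabolic if neither; semi-simple if elliptic or hyperbolic.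 $X(\infty)$ is the ideal boundary (asymptotic classes of rays), on which isometries act, and $X_g(\infty)$ is the set of fixed points of $g$ in $X(\infty)$. With $\angle(x,y)=\sup_{p\in X}\angle_p(x,y)$ (angle at $p$ between the rays from $p$ to $x$ and to $y$), the Tits metric $Td$ is the interior (length) metric on $X(\infty)$ induced from $\angle$. Notation: $\mathfrak{a}_0=\{\operatorname{diag}(u_1,u_2,u_3): u_1+u_2+u_3=0\}\subset T_eX$, $F_0=\{\exp(u): u\in\mathfrak{a}_0\}$ (a flat plane in $X$), $A_0=F_0(\infty)\subset X(\infty)$ (the set of points at infinity of $F_0$). For $x\in A_0$, $u(x)=\operatorname{diag}(u_1(x),u_2(x),u_3(x))\in\mathfrak{a}_0$ is the unit vector such that $t\mapsto\exp(tu(x))$, $t\ge0$, is the ray from $e$ to $x$. $A_0=c_1\cup\dots\cup c_6$ with $c_1=\{u_1\ge u_2\ge u_3\}$, $c_2=\{u_2\ge u_1\ge u_3\}$, $c_3=\{u_2\ge u_3\ge u_1\}$, $c_4=\{u_3\ge u_2\ge u_1\}$, $c_5=\{u_3\ge u_1\ge u_2\}$, $c_6=\{u_1\ge u_3\ge u_2\}$ (subsets of $A_0$, with $u_i=u_i(x)$), and $v_i=c_{i-1}\cap c_i$ for $i=1,\dots,6$ with $c_0=c_6$. $(X(\infty),Td)$ is a one-dimensional spherical building (a graph): its edges (Weyl chambers at infinity) are the translates $h\cdot c_1$, $h\in SL(3,\mathbb{R})$ (each of length $\pi/3$; they include $c_1,\dots,c_6$), and its vertices are the endpoints of edges; $c_i$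 has endpoints $v_i,v_{i+1}$ ($v_7=v_1$). $\gamma_0(t)=\exp(tw_2)$, $t\in\mathbb{R}$, where $w_2=\frac{1}{\sqrt6}\operatorname{diag}(1,1,-2)$; $\gamma_0$ also denotes its image $\{\operatorname{diag}(s,s,1/s^2): s>0\}$, and $\gamma_0(\infty)=v_2$, $\gamma_0(-\infty)=v_5$. $P(\gamma_0)$ is the union of all geodesic lines in $X$ parallel to $\gamma_0$, a convex subset of $X$, and $P(\gamma_0)(\infty)\subset X(\infty)$ is its set of points at infinity.
   Formalization: In (2), (4c), (6) the value of |g| is taken with an absolute value, |log|a|| resp. |log(a²+b²)|, since the printed value is negative for |a|<1 resp. a²+b²<1; in (6) g is hyperbolic only for a≠-1, and for a=-1 it is elliptic (it fixes e). *)

(* Defs.v *)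
From HB Require Import structures.
From mathcomp Require Import all_boot all_order all_algebra.
From mathcomp Require Import all_classical all_reals all_analysis.
Set Implicit Arguments.
Unset Strict Implicit.
Unset Printing Implicit Defensive.
Import Order.TTheory GRing.Theory Num.Theory numFieldNormedType.Exports.
Local Open Scope classical_set_scope.
Local Open Scope ring_scope.

(** * Metric spaces, their isometries and their boundary at infinity

    A metric space is given by a subset [X] of a type [T] and a function [d],
    only the values of which on [X] matter. *)

Definition displacement (R : realType) (T : Type) (X : set T) (d : T -> T -> R)
    (g : T -> T) : R :=
  inf [set d p (g p) | p in X].

Definition min_set (R : realType) (T : Type) (X : set T) (d : T -> T -> R)
    (g : T -> T) : set T :=
  [set p | X p /\ d p (g p) = displacement X d g].

Definition fix_set (T : Type) (X : set T) (g : T -> T) : set T :=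
  [set p | X p /\ g p = p].

Definition geodesic_line (R : realType) (T : Type) (X : set T)
    (d : T -> T -> R) (c : R -> T) : Prop :=
  (forall t, X (c t)) /\ (forall s t, d (c s) (c t) = `|s - t|).

Definition parallel (R : realType) (T : Type) (d : T -> T -> R)
    (c c' : R -> T) : Prop :=
  exists K, forall t, d (c t) (c' t) <= K.

Definition parallel_set (R : realType) (T : Type) (X : set T)
    (d : T -> T -> R) (c : R -> T) : set T :=
  \bigcup_(c' in [set c' | geodesic_line X d c' /\ parallel d c' c]) range c'.

Definition elliptic (T : Type) (X : set T) (g : T -> T) : Prop :=
  fix_set X g !=set0.

Definition hyperbolic (R : realType) (T : Type) (X : set T) (d : T -> T -> R)
    (g : T -> T) : Prop :=
  exists c, geodesic_line X d c /\
    exists2 l : R, l != 0 & forall t, g (c t) = c (t + l).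

Definition parabolic (R : realType) (T : Type) (X : set T) (d : T -> T -> R)
    (g : T -> T) : Prop :=
  ~ elliptic X g /\ ~ hyperbolic X d g.

Definition semi_simple (R : realType) (T : Type) (X : set T)
    (d : T -> T -> R) (g : T -> T) : Prop :=
  elliptic X g \/ hyperbolic X d g.

(** Rays are functions on the whole line of which only the restriction to
    [0 <= t] matters. *)
Definition geodesic_ray (R : realType) (T : Type) (X : set T)
    (d : T -> T -> R) (c : R -> T) : Prop :=
  (forall t, 0 <= t -> X (c t)) /\
  (forall s t, 0 <= s -> 0 <= t -> d (c s) (c t) = `|s - t|).

Definition asymptotic (R : realType) (T : Type) (d : T -> T -> R)
    (c c' : R -> T) : Prop :=
  exists K, forall t, 0 <= t -> d (c t) (c' t) <= K.

Definition ray_class (R : realType) (T : Type) (X : set T) (d : T -> T -> R)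
    (c : R -> T) : set (R -> T) :=
  [set c' | geodesic_ray X d c' /\ asymptotic d c c'].

(** A point at infinity is an asymptotic class of rays.  For a subset [S] of
    [X], [ends X d S] is the set S(oo) of the classes of the rays contained in
    [S]; in particular [ends X d X] is the ideal boundary X(oo). *)
Definition ends (R : realType) (T : Type) (X : set T) (d : T -> T -> R)
    (S : set T) : set (set (R -> T)) :=
  [set ray_class X d c | c in
    [set c | geodesic_ray X d c /\ forall t, 0 <= t -> S (c t)]].

(** The union is over rays that all have the same image class when [g] is an
    isometry, so this is the class of [g \o c] for any [c] in [x]. *)
Definition ideal_map (R : realType) (T : Type) (X : set T) (d : T -> T -> R)
    (g : T -> T) (x : set (R -> T)) : set (R -> T) :=
  \bigcup_(c in x) ray_class X d (g \o c).

Definition fixed_ends (R : realType) (T : Type) (X : set T) (d : T -> T -> R)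
    (g : T -> T) : set (set (R -> T)) :=
  [set x | ends X d X x /\ ideal_map X d g x = x].

(** ** Angles and the Tits metric *)

(** The angle at [c 0], between the vertices [c s] and [c' t], of the Euclidean
    triangle with the same side lengths. *)
Definition comparison_angle (R : realType) (T : Type) (d : T -> T -> R)
    (c c' : R -> T) (s t : R) : R :=
  acos ((s ^+ 2 + t ^+ 2 - d (c s) (c' t) ^+ 2) / (2 * s * t)).

(** The Alexandrov angle of two rays with the same origin: the upper limit of
    the comparison angles as [s] and [t] tend to 0 from the right. *)
Definition ray_angle (R : realType) (T : Type) (d : T -> T -> R)
    (c c' : R -> T) : R :=
  inf [set sup [set comparison_angle d c c' st.1 st.2 | st in
                 [set st : R * R | 0 < st.1 < e /\ 0 < st.2 < e]]
      | e in [set e : R | 0 < e]].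

Definition ideal_angle (R : realType) (T : Type) (d : T -> T -> R)
    (x y : set (R -> T)) : R :=
  sup [set ray_angle d cc.1 cc.2 | cc in
        [set cc : (R -> T) * (R -> T) |
          [/\ x cc.1, y cc.2 & cc.1 0 = cc.2 0]]].

Definition ideal_path (R : realType) (T : Type) (X : set T) (d : T -> T -> R)
    (x y : set (R -> T)) (c : R -> set (R -> T)) : Prop :=
  [/\ forall t, 0 <= t <= 1 -> ends X d X (c t),
      forall t, 0 <= t <= 1 -> forall e, 0 < e -> exists2 r, 0 < r &
        forall s, 0 <= s <= 1 -> `|s - t| < r ->
          ideal_angle d (c s) (c t) < e,
      c 0 = x & c 1 = y].

Definition ideal_length (R : realType) (T : Type) (d : T -> T -> R)
    (c : R -> set (R -> T)) : \bar R :=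
  ereal_sup [set (\sum_(i < size s) ideal_angle d (c (nth 1 (0 :: s) i))
                                                 (c (nth 1 (0 :: s) i.+1)))%:E
            | s in itv_partition 0 1].

Definition tits (R : realType) (T : Type) (X : set T) (d : T -> T -> R)
    (x y : set (R -> T)) : \bar R :=
  ereal_inf [set ideal_length d c | c in ideal_path X d x y].

(** The type of points at infinity with the topology of the Tits metric.  The
    carrier has elements outside [ends X d X]; no Tits path ends there, so the
    Tits balls around them are empty and they do not affect the topology
    induced on [ends X d X]. *)
Definition tits_space (R : realType) (T : Type) (X : set T)
    (d : T -> T -> R) : Type :=
  set (R -> T).

Definition tits_open (R : realType) (T : Type) (X : set T) (d : T -> T -> R)
    (U : set (tits_space X d)) : Prop :=
  forall x, U x -> exists2 e : R, 0 < e &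
    forall y, (tits X d x y < e%:E)%E -> U y.

HB.instance Definition _ (R : realType) (T : Type) (X : set T)
  (d : T -> T -> R) := gen_eqMixin (tits_space X d).
HB.instance Definition _ (R : realType) (T : Type) (X : set T)
  (d : T -> T -> R) := gen_choiceMixin (tits_space X d).

Lemma tits_openT (R : realType) (T : Type) (X : set T) (d : T -> T -> R) :
  tits_open [set: tits_space X d].
Proof. by move=> x _; exists 1. Qed.

Lemma tits_openI (R : realType) (T : Type) (X : set T) (d : T -> T -> R)
    (U V : set (tits_space X d)) :
  tits_open U -> tits_open V -> tits_open (U `&` V).
Proof.
move=> oU oV x [/oU[e e0 eU] /oV[r r0 rV]].
exists (Num.min e r); first by rewrite lt_min e0 r0.
by move=> y; rewrite EFin_min lt_min => /andP[/eU ? /rV ?].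
Qed.

Lemma tits_open_bigU (R : realType) (T : Type) (X : set T) (d : T -> T -> R)
    (I : Type) (U : I -> set (tits_space X d)) :
  (forall i, tits_open (U i)) -> tits_open (\bigcup_i U i).
Proof.
move=> oU x [i _ /oU[e e0 eU]]; exists e => // y /eU Uy; by exists i.
Qed.

HB.instance Definition _ (R : realType) (T : Type) (X : set T)
  (d : T -> T -> R) :=
  @isOpenTopological.Build (tits_space X d) (@tits_open R T X d)
    (@tits_openT R T X d) (@tits_openI R T X d) (@tits_open_bigU R T X d).

(** * The symmetric space of SL(3,R) *)

Definition mx3 (R : realType) (rows : seq (seq R)) : 'M[R]_3 :=
  \matrix_(i, j) nth 0 (nth [::] rows i) j.

Definition diag3 (R : realType) (a b c : R) : 'M[R]_3 :=
  mx3 [:: [:: a; 0; 0]; [:: 0; b; 0]; [:: 0; 0; c]].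

Definition expmx (R : realType) (u : 'M[R]_3) : 'M[R]_3 :=
  limn (series (fun n => n`!%:R^-1 *: u ^+ n)).

(** P(3,R)_1. *)
Definition P3 (R : realType) : set 'M[R]_3 :=
  [set p | [/\ p^T = p,
               forall x : 'cV[R]_3, x != 0 -> 0 < (x^T *m p *m x) 0 0 &
               \det p = 1]].
Arguments P3 R : clear implicits.

Definition riem (R : realType) (p u v : 'M[R]_3) : R :=
  \tr (invmx p *m u *m invmx p *m v).

(** The curves of class C^1 from [p] to [q] in P(3,R)_1, parametrized by
    [0, 1]. *)
Definition C1_curve (R : realType) (p q : 'M[R]_3) (c : R -> 'M[R]_3) : Prop :=
  [/\ forall t, derivable c t 1, continuous (derive1 c),
      forall t, 0 <= t <= 1 -> P3 R (c t), c 0 = p & c 1 = q].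

Definition curve_length (R : realType) (c : R -> 'M[R]_3) : R :=
  \int[lebesgue_measure]_(t in `[0, 1])
    Num.sqrt (riem (c t) (derive1 c t) (derive1 c t)).

Definition dist (R : realType) (p q : 'M[R]_3) : R :=
  inf [set curve_length c | c in C1_curve p q].
Arguments dist R p q : clear implicits.

Definition sl_act (R : realType) (g p : 'M[R]_3) : 'M[R]_3 := g *m p *m g^T.

(** X(oo) and, for [g] in SL(3,R), X_g(oo). *)
Definition ideal_boundary (R : realType) :
    set (tits_space (P3 R) (dist R)) :=
  ends (P3 R) (dist R) (P3 R).
Arguments ideal_boundary R : clear implicits.

Definition ideal_fix (R : realType) (g : 'M[R]_3) :
    set (tits_space (P3 R) (dist R)) :=
  fixed_ends (P3 R) (dist R) (sl_act g).

(** ** The standard flat and the spherical building at infinity *)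

Definition a0 (R : realType) : set 'M[R]_3 :=
  [set u | exists u1 u2 u3, u1 + u2 + u3 = 0 /\ u = diag3 u1 u2 u3].
Arguments a0 R : clear implicits.

Definition F0 (R : realType) : set 'M[R]_3 := [set expmx u | u in a0 R].
Arguments F0 R : clear implicits.

Definition A0 (R : realType) : set (tits_space (P3 R) (dist R)) :=
  ends (P3 R) (dist R) (F0 R).
Arguments A0 R : clear implicits.

(** [direction x u]: [u] is the vector u(x), i.e. the unit vector of [a0] such
    that [expmx (t *: u)] is the ray from the identity matrix to [x]. *)
Definition direction (R : realType) (x : tits_space (P3 R) (dist R))
    (u : 'M[R]_3) : Prop :=
  [/\ a0 R u, riem 1%:M u u = 1 & x (fun t => expmx (t *: u))].

Definition chamber_of (R : realType) (P : R -> R -> R -> Prop) :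
    set (tits_space (P3 R) (dist R)) :=
  [set x | A0 R x /\ exists u1 u2 u3,
             direction x (diag3 u1 u2 u3) /\ P u1 u2 u3].

(** [chamber R i] is c_i for [1 <= i <= 6], and c_0 = c_6. *)
Definition chamber (R : realType) (i : nat) :
    set (tits_space (P3 R) (dist R)) :=
  match i with
  | 1%N => chamber_of (fun u1 u2 u3 => u1 >= u2 /\ u2 >= u3)
  | 2%N => chamber_of (fun u1 u2 u3 => u2 >= u1 /\ u1 >= u3)
  | 3%N => chamber_of (fun u1 u2 u3 => u2 >= u3 /\ u3 >= u1)
  | 4%N => chamber_of (fun u1 u2 u3 => u3 >= u2 /\ u2 >= u1)
  | 5%N => chamber_of (fun u1 u2 u3 => u3 >= u1 /\ u1 >= u2)
  | _   => chamber_of (fun u1 u2 u3 => u1 >= u3 /\ u3 >= u2)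
  end.
Arguments chamber R i : clear implicits.

(** The intersection of c_(i-1) and c_i, as a set; its only element is the
    point v_i. *)
Definition vtx (R : realType) (i : nat) : set (tits_space (P3 R) (dist R)) :=
  chamber R i.-1 `&` chamber R i.
Arguments vtx R i : clear implicits.

Definition edge (R : realType) (E : set (tits_space (P3 R) (dist R))) :
    Prop :=
  exists2 h : 'M[R]_3, \det h = 1 &
    E = ideal_map (P3 R) (dist R) (sl_act h) @` chamber R 1.

(** The endpoints of the edge h c_1 are h v_1 and h v_2. *)
Definition vertex (R : realType) (x : tits_space (P3 R) (dist R)) : Prop :=
  exists2 h : 'M[R]_3, \det h = 1 &
    (ideal_map (P3 R) (dist R) (sl_act h) @` (vtx R 1 `|` vtx R 2)) x.

Definition incident_edges (R : realType)
    (E : set (tits_space (P3 R) (dist R))) :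
    set (set (tits_space (P3 R) (dist R))) :=
  [set E' | edge E' /\ exists2 x, vertex x & E x /\ E' x].

Definition w2 (R : realType) : 'M[R]_3 := (Num.sqrt 6)^-1 *: diag3 1 1 (- 2).
Arguments w2 R : clear implicits.

Definition gamma0 (R : realType) (t : R) : 'M[R]_3 := expmx (t *: w2 R).
Arguments gamma0 R t : clear implicits.

(* Main.v *)
Require Import Defs.
From HB Require Import structures.
From mathcomp Require Import all_boot all_order all_algebra.
From mathcomp Require Import all_classical all_reals all_analysis.
From mathcomp Require Import ring lra.
Import Order.TTheory GRing.Theory Num.Theory numFieldNormedType.Exports.
Set Implicit Arguments.
Unset Strict Implicit.
Unset Printing Implicit Defensive.
Local Open Scope classical_set_scope.
Local Open Scope ring_scope.

(** The proof reduces the geometry of X to linear algebra with matrices of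
    size 3.

    An upper unitriangular matrix [n] with [p = n exp(u) n^T] determines the
    projection [iwasawa p = u] of X onto the diagonal flat. It does not
    increase lengths ([dlog_le], [norm2_iwasawa_le_length]) and is the identity
    on the flat, where the straight lines realize the Euclidean distance; so
    flats are isometrically embedded ([dist_flat]). By the spectral theorem two
    points lie in a translate of the diagonal flat ([common_flat]). Hence the
    triangle inequality, and uniqueness of geodesics ([flat_segment]): equality
    in the triangle inequality passes to the projections for different orders
    of the coordinates, and these force a matrix to be diagonal. In particular
    every geodesic ray is of the form [h exp(t D) h^T] ([geodesic_rayP]).

    The distance of two points is controlled from both sides by the trace of
    [p^-1 q]. For two rays this trace is
    [\sum_(i, j) b_ij^2 exp(t (D'_j - D_i))] with [b = h^-1 h'], so the rays are
    asymptotic if and only if [b_ij != 0] implies [D'_j <= D_i]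
    ([asymptoticP]). For sorted directions this says that a point at infinity
    is a direction together with the line and the plane of a flag that the
    direction singles out. So [g] fixes it if and only if the line and the plane
    are invariant under [g] ([ideal_fix_flag]), and the sets of fixed points at
    infinity come from the eigenvectors of [g] and of its transpose.

    A triangular [g] translates the projection by the logarithms of the squares
    of its diagonal entries, which bounds its displacement from below;
    conjugation by diagonal matrices shows that the bound is sharp
    ([displacement_upper]). If [g] has an axis through [p], or fixes [p], then
    [g p = Q p] for a transvection [Q] along the axis that commutes with [g]
    ([commuting_translation]). This linear condition contradicts a Jordan block
    of [g], which proves parabolicity ([parabolic_of_jordan_block]), and in the
    semi-simple cases it determines the set where the displacement is minimal.

    The Tits distance is at least the angle, and the angle is at least the
    Euclidean angle in a common apartment, which exists by the Bruhat
    decomposition ([common_apartment]). The angle between a given point and the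
    midpoint of an edge therefore takes finitely many values, so that the
    midpoints of the infinitely many edges in [X_g(oo)] have no cluster point
    ([midpoint_separated], [noncompact_ideal_fix]). *)

(** * Matrices of size 3, entry by entry *)

Notation i0 := (@Ordinal 3 0 isT).
Notation i1 := (@Ordinal 3 1 isT).
Notation i2 := (@Ordinal 3 2 isT).

Lemma ord3P (i : 'I_3) : [\/ i = i0, i = i1 | i = i2].
Proof.
case: i => -[|[|[|//]]] h; [apply: Or31|apply: Or32|apply: Or33]; exact: val_inj.
Qed.

Ltac ord3 i := case: (ord3P i) => ?; subst i.

Lemma sum3 (V : nmodType) (F : 'I_3 -> V) : \sum_i F i = F i0 + F i1 + F i2.
Proof.
rewrite !big_ord_recl big_ord0 addr0 addrA.
by congr (F _ + F _ + F _); exact: val_inj.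
Qed.

Lemma mulmx_entry (R : pzSemiRingType) m n (A : 'M[R]_(m, 3)) (B : 'M[R]_(3, n))
    i j : (A *m B) i j = A i i0 * B i0 j + A i i1 * B i1 j + A i i2 * B i2 j.
Proof. by rewrite mxE sum3. Qed.

Lemma det3 (R : comNzRingType) (A : 'M[R]_3) :
  \det A = A i0 i0 * (A i1 i1 * A i2 i2 - A i1 i2 * A i2 i1)
         - A i0 i1 * (A i1 i0 * A i2 i2 - A i1 i2 * A i2 i0)
         + A i0 i2 * (A i1 i0 * A i2 i1 - A i1 i1 * A i2 i0).
Proof.
rewrite (expand_det_row _ i0) sum3 /cofactor.
rewrite !(expand_det_row _ (0 : 'I_2)) !big_ord_recl !big_ord0 /cofactor !det_mx11.
rewrite !mxE /=.
pose B k l := A (inord k) (inord l).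
have AE (i j : 'I_3) : A i j = B i j by rewrite /B !inord_val.
rewrite !AE /= /bump /=; ring.
Qed.

Definition adj3 (R : pzRingType) (A : 'M[R]_3) : 'M[R]_3 :=
  \matrix_(i, j) nth 0 (nth [::] [::
    [:: A i1 i1 * A i2 i2 - A i1 i2 * A i2 i1;
        A i0 i2 * A i2 i1 - A i0 i1 * A i2 i2;
        A i0 i1 * A i1 i2 - A i0 i2 * A i1 i1];
    [:: A i1 i2 * A i2 i0 - A i1 i0 * A i2 i2;
        A i0 i0 * A i2 i2 - A i0 i2 * A i2 i0;
        A i0 i2 * A i1 i0 - A i0 i0 * A i1 i2];
    [:: A i1 i0 * A i2 i1 - A i1 i1 * A i2 i0;
        A i0 i1 * A i2 i0 - A i0 i0 * A i2 i1;
        A i0 i0 * A i1 i1 - A i0 i1 * A i1 i0]] i) j.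

Lemma mul_adj3 (R : comNzRingType) (A : 'M[R]_3) : A *m adj3 A = (\det A)%:M.
Proof.
apply/matrixP => i j; rewrite mxE sum3 det3.
by ord3 i; ord3 j; rewrite !mxE /= ?mulr1n ?mulr0n; ring.
Qed.

Lemma invmx_left (R : comUnitRingType) n (A B : 'M[R]_n) :
  A *m B = 1%:M -> invmx A = B.
Proof.
move=> AB; have [uA _] := mulmx1_unit AB.
by rewrite -[RHS](mulKmx uA) AB mulmx1.
Qed.

Lemma invmx3 (R : comUnitRingType) (A : 'M[R]_3) :
  \det A = 1 -> invmx A = adj3 A.
Proof. by move=> d; apply: invmx_left; rewrite mul_adj3 d. Qed.

Lemma unitmx_det1 (R : comUnitRingType) n (A : 'M[R]_n) :
  \det A = 1 -> A \in unitmx.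
Proof. by move=> d; rewrite unitmxE d unitr1. Qed.

Lemma det_inv1 (R : comUnitRingType) n (A : 'M[R]_n) :
  \det A = 1 -> \det (invmx A) = 1.
Proof. by move=> d; rewrite det_inv d invr1. Qed.

(** * Points of the symmetric space *)

Lemma sl_actM (R : realType) (g h p : 'M[R]_3) :
  sl_act (g *m h) p = sl_act g (sl_act h p).
Proof. by rewrite /sl_act trmx_mul !mulmxA. Qed.

Lemma sl_act1 (R : realType) (p : 'M[R]_3) : sl_act 1%:M p = p.
Proof. by rewrite /sl_act trmx1 mulmx1 mul1mx. Qed.

Lemma sl_actK (R : realType) (g p : 'M[R]_3) :
  \det g = 1 -> sl_act (invmx g) (sl_act g p) = p.
Proof. by move=> dg; rewrite -sl_actM mulVmx ?unitmx_det1// sl_act1. Qed.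

Lemma P3_act (R : realType) (g p : 'M[R]_3) :
  \det g = 1 -> P3 R p -> P3 R (sl_act g p).
Proof.
move=> dg [ps pp pd]; split.
- by rewrite /sl_act !trmx_mul trmxK ps mulmxA.
- move=> x x0.
  have := pp (g^T *m x); rewrite trmx_mul trmxK /sl_act !mulmxA; apply.
  apply: contra x0 => /eqP h; apply/eqP.
  have ug : g^T \in unitmx by rewrite unitmx_tr unitmx_det1.
  by rewrite -[x](mulKmx ug) h mulmx0.
- by rewrite /sl_act !det_mulmx det_tr dg pd !mulr1.
Qed.

Lemma P3_1 (R : realType) : P3 R 1%:M.
Proof.
split; [exact: trmx1| |exact: det1].
move=> x x0; rewrite mulmx1 mxE sum3 !mxE -!expr2.
have := sqr_ge0 (x i0 0); have := sqr_ge0 (x i1 0); have := sqr_ge0 (x i2 0).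
move=> h2 h1 h0; rewrite lt_neqAle !addr_ge0// andbT.
apply: contra x0 => /eqP/esym/eqP.
rewrite paddr_eq0 ?addr_ge0// => /andP[]; rewrite paddr_eq0// => /andP[].
rewrite !sqrf_eq0 => /eqP e0 /eqP e1 /eqP e2.
by apply/eqP/colP => i; ord3 i; rewrite mxE.
Qed.

Lemma P3_gram (R : realType) (g : 'M[R]_3) : \det g = 1 -> P3 R (g *m g^T).
Proof.
by move=> dg; have := P3_act dg (P3_1 R); rewrite /sl_act mulmx1.
Qed.

Definition upper (R : realType) (g : 'M[R]_3) :=
  [/\ g i1 i0 = 0, g i2 i0 = 0 & g i2 i1 = 0].

Lemma P3_sym (R : realType) (p : 'M[R]_3) i j : P3 R p -> p i j = p j i.
Proof. by case=> ps _ _; rewrite -[in LHS]ps mxE. Qed.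

Definition minor2 (R : realType) (p : 'M[R]_3) : R :=
  p i1 i1 * p i2 i2 - p i1 i2 * p i2 i1.

Lemma P3_diag_gt0 (R : realType) (p : 'M[R]_3) i : P3 R p -> 0 < p i i.
Proof.
case=> _ /(_ (\col_j (j == i)%:R)) + _.
have -> : ((\col_j (j == i)%:R)^T *m p *m (\col_j (j == i)%:R)) 0 0 = p i i.
  rewrite mxE (bigD1 i)//= [X in _ + X]big1 ?addr0; last first.
    by move=> j ji; rewrite [X in _ * X]mxE (negbTE ji) mulr0.
  rewrite [X in _ * X]mxE eqxx mulr1 mxE (bigD1 i)//= !mxE eqxx mul1r.
  by rewrite big1 ?addr0// => j ji; rewrite !mxE (negbTE ji) mul0r.
apply; apply/eqP => /colP/(_ i); rewrite !mxE eqxx => /eqP.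
by rewrite oner_eq0.
Qed.

Lemma P3_22_gt0 (R : realType) (p : 'M[R]_3) : P3 R p -> 0 < p i2 i2.
Proof. exact: P3_diag_gt0. Qed.

Lemma P3_minor2_gt0 (R : realType) (p : 'M[R]_3) : P3 R p -> 0 < minor2 p.
Proof.
move=> Pp; have p0 := P3_22_gt0 Pp; have s := P3_sym i1 i2 Pp.
case: (Pp) => _ /(_ (\col_i nth 0 [:: 0; p i2 i2; - p i1 i2] i)) h _.
have {}h : 0 < p i2 i2 * minor2 p.
  have -> : p i2 i2 * minor2 p =
    ((\col_i nth 0 [:: 0; p i2 i2; - p i1 i2] i)^T *m p *m
     (\col_i nth 0 [:: 0; p i2 i2; - p i1 i2] i)) 0 0.
    by rewrite !(mxE, sum3) /= /minor2 -s; ring.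
  apply: h; apply/eqP => /colP/(_ i1); rewrite !mxE /= => /eqP.
  by rewrite gt_eqF.
by rewrite pmulr_rgt0 in h.
Qed.

(** Elimination from the bottom right corner writes [p] as [n n^T] with [n] upper
    triangular. It respects the splitting of the space into the first two axes
    and the third. *)
Lemma P3_cholesky (R : realType) (p : 'M[R]_3) : P3 R p ->
  exists n, [/\ upper n, \det n = 1, p = n *m n^T,
    [/\ 0 < n i0 i0, 0 < n i1 i1 & 0 < n i2 i2] &
    p i0 i2 = 0 -> p i1 i2 = 0 -> n i0 i2 = 0 /\ n i1 i2 = 0].
Proof.
move=> Pp; have p2 := P3_22_gt0 Pp; have m0 := P3_minor2_gt0 Pp.
have s01 := P3_sym i1 i0 Pp; have s02 := P3_sym i2 i0 Pp.
have s12 := P3_sym i2 i1 Pp.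
pose s := Num.sqrt (p i2 i2); pose t := Num.sqrt (minor2 p).
have s0 : 0 < s by rewrite sqrtr_gt0.
have t0 : 0 < t by rewrite sqrtr_gt0.
have s2 : s ^+ 2 = p i2 i2 by rewrite sqr_sqrtr// ltW.
have t2 : t ^+ 2 = minor2 p by rewrite sqr_sqrtr// ltW.
have sN : s != 0 by rewrite gt_eqF.
have tN : t != 0 by rewrite gt_eqF.
have pd : \det p = 1 by case: Pp.
exists (mx3 [:: [:: t^-1; (p i0 i1 - p i0 i2 * p i1 i2 / s ^+ 2) * s / t;
                    p i0 i2 / s];
                [:: 0; t / s; p i1 i2 / s]; [:: 0; 0; s]]).
split.
- by split; rewrite mxE.
- by rewrite det3 !mxE /=; field; rewrite sN tN.
- move: pd; rewrite det3 s01 s02 s12 => pd.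
  move: t2; rewrite /minor2 s12 -s2 => t2.
  have e11 : p i1 i1 = (t ^+ 2 + p i1 i2 ^+ 2) / s ^+ 2.
    by rewrite t2; field.
  have e00 : p i0 i0 = (1 + p i0 i1 * (p i0 i1 * s ^+ 2 - p i1 i2 * p i0 i2)
     - p i0 i2 * (p i0 i1 * p i1 i2 - p i1 i1 * p i0 i2)) / t ^+ 2.
    by rewrite t2 s2 -pd; field; rewrite -s2 -expr2 -t2 expf_neq0.
  apply/matrixP => i j; ord3 i; ord3 j; rewrite !(mxE, sum3) /=
    ?(s01, s02, s12) ?e00 ?e11 -?s2; field; by rewrite ?sN ?tN.
- by split; rewrite mxE /= ?invr_gt0// divr_gt0.
- by rewrite !mxE /= => -> ->; rewrite !mul0r.
Qed.

Lemma det_upper (R : realType) (n : 'M[R]_3) :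
  upper n -> \det n = n i0 i0 * n i1 i1 * n i2 i2.
Proof. by move=> [h1 h2 h3]; rewrite det3 h1 h2 h3; ring. Qed.

(** * The horospherical projection and the lower bound for the distance *)

Definition dot (R : realType) (u v : 'rV[R]_3) : R := \sum_i u 0 i * v 0 i.
Definition rv (R : realType) (a b c : R) : 'rV[R]_3 :=
  \row_j nth 0 [:: a; b; c] j.

Lemma dot_ge0 (R : realType) (u : 'rV[R]_3) : 0 <= dot u u.
Proof. by rewrite /dot sumr_ge0// => i _; rewrite -expr2 sqr_ge0. Qed.

Definition norm2 (R : realType) (u : 'rV[R]_3) := Num.sqrt (dot u u).

Lemma norm2_ge0 (R : realType) (u : 'rV[R]_3) : 0 <= norm2 u.
Proof. exact: sqrtr_ge0. Qed.

Lemma sqr_norm2 (R : realType) (u : 'rV[R]_3) : norm2 u ^+ 2 = dot u u.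
Proof. by rewrite sqr_sqrtr// dot_ge0. Qed.

Lemma cauchy_schwarz (R : realType) (u v : 'rV[R]_3) :
  dot u v ^+ 2 <= dot u u * dot v v.
Proof.
rewrite -subr_ge0 /dot !sum3.
have -> : (u 0 i0 * u 0 i0 + u 0 i1 * u 0 i1 + u 0 i2 * u 0 i2) *
  (v 0 i0 * v 0 i0 + v 0 i1 * v 0 i1 + v 0 i2 * v 0 i2) -
  (u 0 i0 * v 0 i0 + u 0 i1 * v 0 i1 + u 0 i2 * v 0 i2) ^+ 2 =
  (u 0 i0 * v 0 i1 - u 0 i1 * v 0 i0) ^+ 2 +
  (u 0 i1 * v 0 i2 - u 0 i2 * v 0 i1) ^+ 2 +
  (u 0 i0 * v 0 i2 - u 0 i2 * v 0 i0) ^+ 2 by ring.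
by rewrite !addr_ge0// sqr_ge0.
Qed.

(** If [p = n exp(u) n^T] with [n] upper unitriangular, this is [u]: the lower
    right principal minors of [p] are those of [exp u]. Geometrically it is the
    projection of the space onto the diagonal flat along the horospheres of a
    Weyl chamber at infinity. *)
Definition iwasawa (R : realType) (p : 'M[R]_3) : 'rV[R]_3 :=
  rv (- ln (minor2 p)) (ln (minor2 p) - ln (p i2 i2)) (ln (p i2 i2)).

Lemma iwasawa_act (R : realType) (n p : 'M[R]_3) :
  upper n -> \det n = 1 -> P3 R p ->
  iwasawa (sl_act n p) = iwasawa p + \row_i ln (n i i ^+ 2).
Proof.
move=> un dn Pp; have := det_upper un; rewrite dn => e.
have [h10 h20 h21] := un.
have p2 := P3_22_gt0 Pp; have m0 := P3_minor2_gt0 Pp.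
have e2 : (sl_act n p) i2 i2 = n i2 i2 ^+ 2 * p i2 i2.
  by rewrite /sl_act !(mxE, sum3) h20 h21; ring.
have em : minor2 (sl_act n p) = n i1 i1 ^+ 2 * n i2 i2 ^+ 2 * minor2 p.
  rewrite /minor2 /sl_act !(mxE, sum3) h10 h20 h21; ring.
have n1 : n i1 i1 != 0.
  by apply/eqP => h; move/eqP: e; rewrite h mulr0 mul0r oner_eq0.
have n2 : n i2 i2 != 0.
  by apply/eqP => h; move/eqP: e; rewrite h mulr0 oner_eq0.
have q1 : 0 < n i1 i1 ^+ 2 by rewrite exprn_even_gt0.
have q2 : 0 < n i2 i2 ^+ 2 by rewrite exprn_even_gt0.
have e0 : n i0 i0 ^+ 2 = (n i1 i1 ^+ 2 * n i2 i2 ^+ 2)^-1.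
  have -> : n i0 i0 = (n i1 i1 * n i2 i2)^-1.
    apply/(@mulIf _ (n i1 i1 * n i2 i2)); first by rewrite mulf_neq0.
    by rewrite mulVf ?mulf_neq0// mulrA -e.
  by rewrite exprVn exprMn.
have q12 := mulr_gt0 q1 q2.
rewrite /iwasawa e2 em; apply/rowP => i; ord3 i; rewrite !mxE /= ?e0;
  move: q1 q2 q12 (minor2 p) m0; move: (n i1 i1 ^+ 2) (n i2 i2 ^+ 2) => a b a0 b0.
- move=> ab0 m m0; rewrite lnV ?posrE// !lnM ?posrE//; ring.
- move=> ab0 m m0; rewrite !lnM ?posrE//; ring.
- move=> ab0 m m0; rewrite !lnM ?posrE//; ring.
Qed.

Lemma riem_act (R : realType) (g p v w : 'M[R]_3) : \det g = 1 -> P3 R p ->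
  riem (sl_act g p) (sl_act g v) (sl_act g w) = riem p v w.
Proof.
move=> dg [_ _ dp]; have ug := unitmx_det1 dg; have up := unitmx_det1 dp.
have ugt : g^T \in unitmx by rewrite unitmx_tr.
have -> : riem (sl_act g p) (sl_act g v) (sl_act g w) =
    \tr (invmx (g^T) *m (invmx p *m v *m invmx p *m w) *m g^T).
  rewrite /riem; congr (\tr _).
  have -> : invmx (sl_act g p) = invmx g^T *m invmx p *m invmx g.
    apply: invmx_left; rewrite /sl_act !mulmxA.
    by rewrite mulmxK// mulmxK// mulmxV.
  by rewrite /sl_act !mulmxA !(mulmxKV ug) !(mulmxK ugt).
by rewrite mxtrace_mulC !mulmxA mulmxV// mul1mx.
Qed.

Definition dminor2 (R : realType) (p w : 'M[R]_3) : R :=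
  w i1 i1 * p i2 i2 + p i1 i1 * w i2 i2 -
  (w i1 i2 * p i2 i1 + p i1 i2 * w i2 i1).

(** The derivative of the determinant at [p] in the direction [w]. *)
Definition ddet (R : realType) (p w : 'M[R]_3) : R :=
  \tr (adj3 p *m w).

(** The derivative of [iwasawa] at [p] in the direction [w], except that the
    determinant of [p] is not taken to be constant in the first coordinate, so
    that [w] need not be tangent to the hypersurface of determinant 1. *)
Definition dlog (R : realType) (p w : 'M[R]_3) : 'rV[R]_3 :=
  rv (ddet p w / \det p - dminor2 p w / minor2 p)
     (dminor2 p w / minor2 p - w i2 i2 / p i2 i2) (w i2 i2 / p i2 i2).

(** Writing [p = n n^T] with [n] triangular, the entries of [dlog p w] are the
    diagonal entries of [n^-1 w n^-T], and the Riemannian norm of [w] at [p] is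
    the norm of that whole symmetric matrix. *)
Lemma dlog_le (R : realType) (p w : 'M[R]_3) : P3 R p -> w^T = w ->
  dot (dlog p w) (dlog p w) <= riem p w w.
Proof.
move=> Pp ws; have [n [un dn pE [n0 n1 n2] _]] := P3_cholesky Pp.
have u := unitmx_det1 dn; have du := det_upper un; have [h10 h20 h21] := un.
have [y yE] : exists y, y = sl_act (invmx n) w by eexists.
have wE : w = sl_act n y by rewrite yE -sl_actM mulmxV// sl_act1.
have ys : y^T = y by rewrite yE /sl_act !trmx_mul trmxK ws mulmxA.
have e1 : p = sl_act n 1%:M by rewrite /sl_act mulmx1.
have -> : riem p w w = riem 1%:M y y by rewrite e1 wE riem_act//; exact: P3_1.
have sy i j : y i j = y j i by rewrite -[in LHS]ys mxE.
have -> : riem 1%:M y y = \sum_i \sum_j y i j ^+ 2.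
  rewrite /riem invmx1 mul1mx mulmx1; apply: eq_bigr => i _; rewrite mxE.
  by apply: eq_bigr => j _; rewrite expr2 [in LHS](sy j).
have dE : dlog p w = \row_i y i i.
  have s12 := sy i2 i1.
  have dp : \det p = 1 by case: Pp.
  have e00 : n i0 i0 = (n i1 i1 * n i2 i2)^-1.
    apply/(@mulIf _ (n i1 i1 * n i2 i2)); first by rewrite mulf_neq0 ?gt_eqF.
    by rewrite mulVf ?mulf_neq0 ?gt_eqF// mulrA -du.
  have z2 : w i2 i2 / p i2 i2 = y i2 i2.
    rewrite wE pE /sl_act !(mxE, sum3) h20 h21; field; by rewrite gt_eqF.
  have z1 : dminor2 p w / minor2 p = y i1 i1 + y i2 i2.
    rewrite /dminor2 /minor2 wE pE /sl_act !(mxE, sum3) h10 h20 h21 s12.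
    field; rewrite (_ : _ - _ = (n i1 i1 * n i2 i2) ^+ 2); last by ring.
    by rewrite expf_neq0// mulf_neq0 ?gt_eqF.
  have z0 : ddet p w = y i0 i0 + y i1 i1 + y i2 i2.
    have -> : ddet p w = \tr y.
      rewrite /ddet -invmx3// wE e1 /sl_act mulmx1.
      have -> : invmx (n *m n^T) = invmx n^T *m invmx n.
        apply: invmx_left; rewrite mulmxA mulmxK ?unitmx_tr//.
        by rewrite mulmxV.
      rewrite !mulmxA mulmxKV// mxtrace_mulC !mulmxA mulmxV ?unitmx_tr//.
      by rewrite mul1mx.
    by rewrite /mxtrace sum3.
  by apply/rowP => i; ord3 i; rewrite !mxE /= ?z2 ?z1 ?z0 ?dp; field.
rewrite dE /dot ler_sum// => i _; rewrite mxE (bigD1 i)//= expr2 lerDl.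
by rewrite sumr_ge0// => j _; rewrite sqr_ge0.
Qed.

(** ** Calculus of matrix curves *)

Section pointwise.
Variable R : realType.
Implicit Types (f g : R -> R) (A B c : R -> 'M[R]_3) (t : R).

Lemma is_derive_mul f g t a b : is_derive t 1 f a -> is_derive t 1 g b ->
  is_derive t 1 (fun s => f s * g s) (a * g t + f t * b).
Proof.
by move=> fa gb; apply: is_derive_eq; rewrite addrC /GRing.scale /= (mulrC (g t)).
Qed.

Lemma is_derive_sub f g t a b : is_derive t 1 f a -> is_derive t 1 g b ->
  is_derive t 1 (fun s => f s - g s) (a - b).
Proof. by move=> fa gb; apply: is_derive_eq. Qed.

Lemma is_derive_add f g t a b : is_derive t 1 f a -> is_derive t 1 g b ->
  is_derive t 1 (fun s => f s + g s) (a + b).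
Proof. by move=> fa gb; apply: is_derive_eq. Qed.

Lemma is_derive_ln f t a : 0 < f t -> is_derive t 1 f a ->
  is_derive t 1 (fun s => ln (f s)) (a / f t).
Proof.
move=> f0 fa; have := is_derive1_comp (is_derive1_ln f0) fa.
by rewrite mulrC.
Qed.

Lemma eq_continuous_at f g t : f =1 g -> continuous_at t g -> continuous_at t f.
Proof. by move=> /funext ->. Qed.

Lemma cts_mulmx A B t :
  (forall i j, continuous_at t (fun s => A s i j)) ->
  (forall i j, continuous_at t (fun s => B s i j)) ->
  forall i j, continuous_at t (fun s => (A s *m B s) i j).
Proof.
move=> cA cB i j; apply: eq_continuous_at.
  by move=> s; rewrite mxE sum3; reflexivity.
by apply: cvgD; [apply: cvgD|]; apply: cvgM; (apply: cA || apply: cB).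
Qed.

Lemma cts_adj3 A t : (forall i j, continuous_at t (fun s => A s i j)) ->
  forall i j, continuous_at t (fun s => (adj3 (A s)) i j).
Proof.
move=> cA i j; ord3 i; ord3 j; (apply: eq_continuous_at;
  first by move=> s; rewrite mxE /=; reflexivity);
by apply: cvgB; apply: cvgM; apply: cA.
Qed.

Lemma cts_trace A t : (forall i j, continuous_at t (fun s => A s i j)) ->
  continuous_at t (fun s => \tr (A s)).
Proof.
move=> cA; apply: eq_continuous_at.
  by move=> s; rewrite /mxtrace sum3; reflexivity.
by apply: cvgD; [apply: cvgD|]; apply: cA.
Qed.

Lemma is_derive_minor2 c (w : 'M[R]_3) t :
  (forall i j, is_derive t 1 (fun s => c s i j) (w i j)) ->
  is_derive t 1 (fun s => minor2 (c s)) (dminor2 (c t) w).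
Proof.
by move=> cw; apply: is_derive_sub; apply: is_derive_mul; apply: cw.
Qed.

Lemma is_derive_det c (w : 'M[R]_3) t :
  (forall i j, is_derive t 1 (fun s => c s i j) (w i j)) ->
  is_derive t 1 (fun s => \det (c s)) (ddet (c t) w).
Proof.
move=> cw; have /funext -> := fun s => det3 (c s).
have minor i j k l m n p q := is_derive_sub
  (is_derive_mul (cw i j) (cw k l)) (is_derive_mul (cw m n) (cw p q)).
apply: (is_derive_eq (is_derive_add (is_derive_sub
  (is_derive_mul (cw i0 i0) (minor i1 i1 i2 i2 i1 i2 i2 i1))
  (is_derive_mul (cw i0 i1) (minor i1 i0 i2 i2 i1 i2 i2 i0)))
  (is_derive_mul (cw i0 i2) (minor i1 i0 i2 i1 i1 i1 i2 i0)))).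
rewrite /ddet /mxtrace !(sum3, mxE) /=; ring.
Qed.

(** A pointwise bound on the derivative bounds the increment, by the fundamental
    theorem of calculus. The bound is required in the open interval only, since
    symmetry of a velocity is known where the curve can be differentiated
    inside the space. *)
Lemma le_FTC (F f s : R -> R) :
  {in `[0, 1], forall t, is_derive t 1 F (f t)} ->
  {in `[0, 1], forall t, continuous_at t f} ->
  {in `[0, 1], forall t, continuous_at t s} ->
  {in `]0, 1[, forall t, f t <= s t} ->
  F 1 - F 0 <= \int[lebesgue_measure]_(t in `[0, 1]) s t.
Proof.
move=> dF cf cs fs.
have wc (h : R -> R) : {in `[0, 1], forall t, continuous_at t h} ->
    {within `[0, 1], continuous h}.
  by move=> ch; apply: continuous_in_subspaceT => t /[1!inE]; exact: ch.
have int (h : R -> R) : {in `[0, 1], forall t, continuous_at t h} ->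
    lebesgue_measure.-integrable `[0, 1] (EFin \o h).
  move=> ch; apply: continuous_compact_integrable.
    exact: segment_compact.
  exact: wc.
have op (h : R -> R) : {in `[0, 1], forall t, continuous_at t h} ->
    lebesgue_measure.-integrable `]0, 1[ (EFin \o h) /\
    \int[lebesgue_measure]_(t in `]0, 1[) h t =
    \int[lebesgue_measure]_(t in `[0, 1]) h t.
  move=> ch; have sub b : [set` Interval (BRight (0 : R)) (BSide b 1)] `<=`
      `[0, 1]%classic.
    move=> t /=; case: b; rewrite !in_itv /= => /andP[a b];
    by rewrite (ltW a) ?(ltW b).
  have i (b : bool) : lebesgue_measure.-integrable
      [set` Interval (BRight (0 : R)) (BSide b 1)] (EFin \o h).
    by apply: (@integrableS _ _ _ (@lebesgue_measure R) _ _ (EFin \o h)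
      (measurable_itv _) (measurable_itv _) (sub b)); exact: int.
  split; first exact: (i true).
  by rewrite Rintegral_itv_bndo_bndc ?Rintegral_itv_obnd_cbnd//; exact: (i _).
have cF t : t \in `[0, 1] -> F s @[s --> t] --> F t.
  move=> /dF [dFt _]; apply: differentiable_continuous.
  exact/derivable1_diffP.
have FTC := @continuous_FTC2 R f F 0 1 ltr01 (wc _ cf).
have {FTC} : \int[lebesgue_measure]_(t in `[0, 1]) f t = F 1 - F 0.
  rewrite /Rintegral FTC//=.
  - split.
    + by move=> t t01; case: (dF t) => //; exact: subset_itv_oo_cc.
    + by apply: cvg_at_right_filter; apply: cF; rewrite in_itv /= lexx ler01.
    + by apply: cvg_at_left_filter; apply: cF; rewrite in_itv /= lexx ler01.
  - move=> t t01; rewrite derive1E; case: (dF t) => //.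
    exact: subset_itv_oo_cc.
move=> <-.
have [if1 <-] := op _ cf; have [is1 <-] := op _ cs.
by apply: le_Rintegral => //= t t01; apply: fs.
Qed.

End pointwise.

Lemma riemE (R : realType) (p w : 'M[R]_3) : P3 R p ->
  riem p w w = \tr (adj3 p *m w *m adj3 p *m w).
Proof. by case=> _ _ dp; rewrite /riem invmx3. Qed.

Lemma is_derive_entry (R : realType) (c : R -> 'M[R]_3) t :
  derivable c t 1 ->
  forall i j, is_derive t 1 (fun s => c s i j) (derive1 c t i j).
Proof.
move=> dc i j; apply: DeriveDef; first by move/derivable_mxP : dc; exact.
by rewrite derive1E derive_mx// mxE.
Qed.

Lemma derivable_cts (R : realType) (f : R -> R) t :
  derivable f t 1 -> continuous_at t f.
Proof.
by move=> /derivable1_diffP/differentiable_continuous.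
Qed.

(** The horospherical projection does not increase lengths, so the length of a
    curve is at least the distance of the projections of its endpoints. *)
Lemma norm2_iwasawa_le_length (R : realType) (p q : 'M[R]_3) (c : R -> 'M[R]_3) :
  C1_curve p q c -> norm2 (iwasawa q - iwasawa p) <= curve_length c.
Proof.
move=> [dc cc' cP c0 c1].
set xi := iwasawa q - iwasawa p; set N := norm2 xi.
have N0 : 0 <= N by exact: norm2_ge0.
have ce t := is_derive_entry (dc t).
have ctsc t i j : continuous_at t (fun s => c s i j).
  by apply: derivable_cts; case: (ce t i j).
have ctsc' t i j : continuous_at t (fun s => derive1 c s i j).
  exact: (continuous_comp (cc' t) (@coord_continuous _ _ _ i j _)).
pose speed t := Num.sqrt (\tr (adj3 (c t) *m derive1 c t *m adj3 (c t)
  *m derive1 c t)).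
have cspeed t : continuous_at t speed.
  have h1 := cts_adj3 (@ctsc t); have h2 := cts_mulmx h1 (@ctsc' t).
  have h := cts_trace (cts_mulmx (cts_mulmx h2 h1) (@ctsc' t)).
  exact: (continuous_comp h (@sqrt_continuous R _)).
have speedE : {in `[0, 1], forall t, speed t =
    Num.sqrt (riem (c t) (derive1 c t) (derive1 c t))}.
  by move=> t /[1!in_itv] /= t01; rewrite riemE//; exact: cP.
(* The scalar product of [xi] with the projection of [c t]: the logarithm of
   the determinant vanishes for [t] in the unit interval. *)
pose F t := xi 0 i0 * (ln (\det (c t)) - ln (minor2 (c t))) +
  xi 0 i1 * (ln (minor2 (c t)) - ln (c t i2 i2)) + xi 0 i2 * ln (c t i2 i2).
pose f t := dot xi (dlog (c t) (derive1 c t)).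
have pos t : t \in `[0, 1] ->
    [/\ \det (c t) = 1, 0 < minor2 (c t) & 0 < c t i2 i2].
  move=> /[1!in_itv] /= /cP h; have [_ _ d] := h.
  by rewrite P3_22_gt0// P3_minor2_gt0.
have dF : {in `[0, 1], forall t : R, is_derive t 1 F (f t)}.
  move=> t /pos[d m0 p0].
  have d0 : 0 < \det (c t) by rewrite d.
  have D := is_derive_ln (f := fun s => \det (c s)) d0 (is_derive_det (ce t)).
  have M := is_derive_ln (f := fun s => minor2 (c s)) m0 (is_derive_minor2 (ce t)).
  have P := is_derive_ln (f := fun s => c s i2 i2) p0 (ce t i2 i2).
  have cst (x : R) : is_derive t 1 (fun=> x) 0 by exact: is_derive_cst.
  apply: (is_derive_eq (is_derive_add (is_derive_add
    (is_derive_mul (cst (xi 0 i0)) (is_derive_sub D M))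
    (is_derive_mul (cst (xi 0 i1)) (is_derive_sub M P)))
    (is_derive_mul (cst (xi 0 i2)) P))).
  by rewrite /f /dot sum3 ![dlog _ _ _ _]mxE /=; ring.
have cf : {in `[0, 1], forall t, continuous_at t f}.
  move=> t /pos[d m0 p0].
  have cdet := derivable_cts (@ex_derive _ _ _ _ _ _ _ (is_derive_det (ce t))).
  have cmin := derivable_cts (@ex_derive _ _ _ _ _ _ _ (is_derive_minor2 (ce t))).
  have cddet : continuous_at t (fun s => ddet (c s) (derive1 c s)).
    by apply: cts_trace; apply: cts_mulmx => //; exact: cts_adj3.
  have cdmin : continuous_at t (fun s => dminor2 (c s) (derive1 c s)).
    by apply: cvgB; apply: cvgD; apply: cvgM; (exact: ctsc || exact: ctsc').
  have quo (g h : R -> R) : h t != 0 -> continuous_at t g ->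
      continuous_at t h -> continuous_at t (fun s => g s / h s).
    by move=> h0 cg ch; apply: cvgM => //; exact: cvgV.
  have m0' : minor2 (c t) != 0 by rewrite gt_eqF.
  have p0' : c t i2 i2 != 0 by rewrite gt_eqF.
  have d0' : \det (c t) != 0 by rewrite d oner_eq0.
  have q0 := quo _ _ d0' cddet cdet.
  have q1 := quo _ _ m0' cdmin cmin.
  have q2 := quo _ _ p0' (ctsc' t i2 i2) (ctsc t i2 i2).
  apply: (@eq_continuous_at _ _ (fun s =>
    xi 0 i0 * (ddet (c s) (derive1 c s) / \det (c s) -
       dminor2 (c s) (derive1 c s) / minor2 (c s)) +
    xi 0 i1 * (dminor2 (c s) (derive1 c s) / minor2 (c s) -
       derive1 c s i2 i2 / c s i2 i2) +
    xi 0 i2 * (derive1 c s i2 i2 / c s i2 i2))).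
    by move=> s; rewrite /f /dot sum3 ![dlog _ _ _ _]mxE.
  have cst (x : R) : continuous_at t (fun=> x) by exact: cvg_cst.
  exact: (cvgD (cvgD (cvgM (cst _) (cvgB q0 q1)) (cvgM (cst _) (cvgB q1 q2)))
    (cvgM (cst _) q2)).
have fs : {in `]0, 1[, forall t, f t <= N * speed t}.
  move=> t t01; have t01' := subset_itv_oo_cc t01.
  have Pt : P3 R (c t) by apply: cP; move: t01'; rewrite in_itv.
  rewrite speedE// -[N]/(norm2 xi) -sqrtrM ?dot_ge0//.
  apply: le_trans (ler_norm _) _; rewrite -sqrtr_sqr ler_wsqrtr//.
  apply: le_trans (cauchy_schwarz _ _) _; rewrite ler_wpM2l ?dot_ge0//.
  apply: dlog_le => //; apply/matrixP => i j; rewrite mxE.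
  rewrite !derive1E !derive_mx// !mxE; apply: near_eq_derive.
  near=> s; apply: P3_sym; apply: cP.
  have : s \in `]0, 1[ by near: s; exact: near_in_itvoo.
  by rewrite in_itv /= => /andP[/ltW -> /ltW ->].
have := le_FTC dF cf (s := fun t => N * speed t) _ fs.
have -> : F 1 - F 0 = N ^+ 2.
  have [d0 _ _] : [/\ \det (c 0) = 1, 0 < minor2 (c 0) & 0 < c 0 i2 i2].
    by apply: pos; rewrite in_itv /= lexx ler01.
  have [d1 _ _] : [/\ \det (c 1) = 1, 0 < minor2 (c 1) & 0 < c 1 i2 i2].
    by apply: pos; rewrite in_itv /= lexx ler01.
  rewrite /N sqr_norm2 /F d0 d1 ln1 c0 c1 /dot sum3 /xi !mxE /=; ring.
have -> : \int[lebesgue_measure]_(t in `[0, 1]) (N * speed t) =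
    N * curve_length c.
  rewrite RintegralZl; [|exact: measurable_itv|]; last first.
    apply: continuous_compact_integrable; first exact: segment_compact.
    by apply: continuous_subspaceT => t; exact: cspeed.
  by congr (N * _); apply: eq_Rintegral => t /[1!inE] /speedE.
have L0 : 0 <= curve_length c by apply: Rintegral_ge0 => t _; exact: sqrtr_ge0.
move=> h; have {h} : N ^+ 2 <= N * curve_length c.
  apply: h => t _; apply: cvgM; last exact: cspeed.
  exact: cvg_cst.
have [-> //|NN] := eqVneq N 0.
by rewrite expr2 ler_pM2l// lt_neqAle eq_sym NN.
Unshelve. all: by end_near. Qed.

(** * The distance *)

Section matrix_curves.
Variable R : realType.
Implicit Types (A B c : R -> 'M[R]_3) (t : R).

Lemma is_derive_mx c (w : 'M[R]_3) t :
  (forall i j, is_derive t 1 (fun s => c s i j) (w i j)) ->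
  derivable c t 1 /\ derive1 c t = w.
Proof.
move=> cw; have dc : derivable c t 1.
  by apply/derivable_mxP => i j; exact: (@ex_derive _ _ _ _ _ _ _ (cw i j)).
split=> //; apply/matrixP => i j; rewrite derive1E derive_mx// mxE.
exact: (@derive_val _ _ _ _ _ _ _ (cw i j)).
Qed.

Lemma cvg_mx (T : Type) (F : set_system T) (FF : Filter F)
    (c : T -> 'M[R]_3) (l : 'M[R]_3) :
  (forall i j, (fun s => c s i j) @ F --> l i j) -> c @ F --> l.
Proof.
move=> cc; apply/cvgrPdist_le => /= e e0.
have h i j : \forall s \near F, `|l i j - c s i j| <= e.
  by have /cvgrPdist_le := cc i j; exact.
have H : \forall s \near F, forall ij : 'I_3 * 'I_3,
    `|l ij.1 ij.2 - c s ij.1 ij.2| <= e.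
  exact: (@filter_forall _ _ (fun (ij : 'I_3 * 'I_3) s =>
    `|l ij.1 ij.2 - c s ij.1 ij.2| <= e) F _ (fun ij => h ij.1 ij.2)).
near=> s.
have hs : forall ij : 'I_3 * 'I_3, `|l ij.1 ij.2 - c s ij.1 ij.2| <= e.
  by near: s; exact: H.
rewrite /Num.Def.normr/= mx_normrE (bigmax_le _ (ltW e0))//= => ij _.
by rewrite !mxE; exact: hs.
Unshelve. all: by end_near. Qed.

Lemma continuous_mx c t :
  (forall i j, continuous_at t (fun s => c s i j)) -> continuous_at t c.
Proof. exact: cvg_mx. Qed.

Lemma sl_act_entry (g p : 'M[R]_3) i j : sl_act g p i j =
  g i i0 * g j i0 * p i0 i0 + g i i0 * g j i1 * p i0 i1 +
  g i i0 * g j i2 * p i0 i2 +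
  (g i i1 * g j i0 * p i1 i0 + g i i1 * g j i1 * p i1 i1 +
   g i i1 * g j i2 * p i1 i2) +
  (g i i2 * g j i0 * p i2 i0 + g i i2 * g j i1 * p i2 i1 +
   g i i2 * g j i2 * p i2 i2).
Proof. by rewrite /sl_act !(mxE, sum3); ring. Qed.

Lemma continuous_sl_act_entry (g : 'M[R]_3) c t i j :
  (forall i j, continuous_at t (fun s => c s i j)) ->
  continuous_at t (fun s => sl_act g (c s) i j).
Proof.
move=> cc; have /funext -> := fun s => sl_act_entry g (c s) i j.
have m k l : continuous_at t (fun s => g i k * g j l * c s k l).
  by apply: cvgM; [exact: cvg_cst|exact: cc].
by apply: cvgD; [apply: cvgD|]; apply: cvgD; (exact: m || apply: cvgD; exact: m).
Qed.

Lemma is_derive_sl_act (g w : 'M[R]_3) c t :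
  (forall i j, is_derive t 1 (fun s => c s i j) (w i j)) ->
  forall i j, is_derive t 1 (fun s => sl_act g (c s) i j) (sl_act g w i j).
Proof.
move=> cw i j; have /funext -> := fun s => sl_act_entry g (c s) i j.
have cst (x : R) : is_derive t 1 (fun=> x) 0 by exact: is_derive_cst.
have m k l := is_derive_mul (cst (g i k * g j l)) (cw k l).
apply: (is_derive_eq (is_derive_add (is_derive_add
  (is_derive_add (is_derive_add (m i0 i0) (m i0 i1)) (m i0 i2))
  (is_derive_add (is_derive_add (m i1 i0) (m i1 i1)) (m i1 i2)))
  (is_derive_add (is_derive_add (m i2 i0) (m i2 i1)) (m i2 i2)))).
by rewrite sl_act_entry !mul0r !add0r.
Qed.

Lemma C1_curve_act (g p q : 'M[R]_3) c : \det g = 1 ->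
  C1_curve p q c -> C1_curve (sl_act g p) (sl_act g q) (sl_act g \o c).
Proof.
move=> dg [dc cc' cP c0 c1].
have dgc t := is_derive_mx (is_derive_sl_act g (is_derive_entry (dc t))).
split.
- by move=> t; exact: (dgc t).1.
- rewrite (_ : derive1 _ = sl_act g \o derive1 c); last first.
    by apply/funext => t; exact: (dgc t).2.
  move=> t; apply: continuous_mx => i j; apply: continuous_sl_act_entry => k l.
  exact: (continuous_comp (cc' t) (@coord_continuous _ _ _ k l _)).
- by move=> t /cP; exact: P3_act.
- by rewrite /= c0.
- by rewrite /= c1.
Qed.

Lemma curve_length_act (g p q : 'M[R]_3) c : \det g = 1 ->
  C1_curve p q c -> curve_length (sl_act g \o c) = curve_length c.
Proof.
move=> dg [dc _ cP _ _]; apply: eq_Rintegral => t /[1!inE] t01.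
have [_ ->] := is_derive_mx (is_derive_sl_act g (is_derive_entry (dc t))).
by rewrite riem_act//; apply: cP; move: t01; rewrite /= in_itv.
Qed.

End matrix_curves.

(** Composition with [g] maps the curves from [p] to [q] onto those from [g p]
    to [g q] and preserves their lengths. *)
Lemma dist_act (R : realType) (g p q : 'M[R]_3) : \det g = 1 ->
  dist R (sl_act g p) (sl_act g q) = dist R p q.
Proof.
move=> dg; congr inf; rewrite eqEsubset; split=> _ [c cpq <-]; last first.
  by exists (sl_act g \o c); [exact: C1_curve_act|exact: curve_length_act cpq].
have dg' := det_inv1 dg.
exists (sl_act (invmx g) \o c); last exact: curve_length_act cpq.
by rewrite -(sl_actK p dg) -(sl_actK q dg); exact: C1_curve_act.
Qed.

Lemma dist_ge_iwasawa (R : realType) (p q : 'M[R]_3) c : C1_curve p q c ->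
  norm2 (iwasawa q - iwasawa p) <= dist R p q.
Proof.
move=> cpq; apply: lb_le_inf; first by exists (curve_length c), c.
by move=> _ [c' c'pq <-]; exact: norm2_iwasawa_le_length.
Qed.

(** ** Flats *)

Definition tr0 (R : realType) (u : 'rV[R]_3) := \sum_i u 0 i = 0.

Definition flat (R : realType) (u : 'rV[R]_3) : 'M[R]_3 :=
  diag_mx (map_mx expR u).

Lemma flat_entry (R : realType) (u : 'rV[R]_3) i j :
  flat u i j = expR (u 0 i) *+ (i == j).
Proof. by rewrite !mxE; case: eqP => // ->. Qed.

Lemma flat0 (R : realType) : flat (0 : 'rV[R]_3) = 1%:M.
Proof. by apply/matrixP => i j; rewrite flat_entry !mxE expR0. Qed.

Lemma flatD (R : realType) (u v : 'rV[R]_3) : flat (u + v) = flat u *m flat v.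
Proof.
rewrite /flat mulmx_diag; congr diag_mx; apply/rowP => i.
by rewrite !mxE expRD.
Qed.

Lemma flat_tr (R : realType) (u : 'rV[R]_3) : (flat u)^T = flat u.
Proof. exact: tr_diag_mx. Qed.

Lemma det_flat (R : realType) (u : 'rV[R]_3) : tr0 u -> \det (flat u) = 1.
Proof.
rewrite /tr0 /flat det_diag => u0; under eq_bigr => i _ do rewrite mxE.
by rewrite -(big_morph _ (@expRD R) (@expR0 R)) u0 expR0.
Qed.

Lemma sl_act_flat (R : realType) (u v : 'rV[R]_3) :
  sl_act (flat u) (flat v) = flat (u + u + v).
Proof. by rewrite /sl_act flat_tr -!flatD addrAC. Qed.

Lemma flat_sqrt (R : realType) (u : 'rV[R]_3) :
  flat u = flat (2^-1 *: u) *m (flat (2^-1 *: u))^T.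
Proof. by rewrite flat_tr -flatD -scalerDl (_ : _ + _ = 1) ?scale1r//; field. Qed.

Lemma tr0Z (R : realType) (a : R) (u : 'rV[R]_3) : tr0 u -> tr0 (a *: u).
Proof.
rewrite /tr0 => u0; rewrite (eq_bigr (fun i => a * u 0 i)).
  by rewrite -mulr_sumr u0 mulr0.
by move=> i _; rewrite mxE.
Qed.

Lemma tr0D (R : realType) (u v : 'rV[R]_3) : tr0 u -> tr0 v -> tr0 (u + v).
Proof.
rewrite /tr0 => u0 v0; rewrite (eq_bigr (fun i => u 0 i + v 0 i)).
  by rewrite big_split /= u0 v0 addr0.
by move=> i _; rewrite mxE.
Qed.

Lemma tr0N (R : realType) (u : 'rV[R]_3) : tr0 u -> tr0 (- u).
Proof. by move=> u0; rewrite -scaleN1r; exact: tr0Z. Qed.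

Lemma tr0_0 (R : realType) : tr0 (0 : 'rV[R]_3).
Proof. by rewrite /tr0 big1// => i _; rewrite mxE. Qed.

Lemma P3_flat (R : realType) (u : 'rV[R]_3) : tr0 u -> P3 R (flat u).
Proof.
by move=> u0; rewrite flat_sqrt; apply: P3_gram; rewrite det_flat//; exact: tr0Z.
Qed.

Lemma iwasawa_flat (R : realType) (u : 'rV[R]_3) : tr0 u -> iwasawa (flat u) = u.
Proof.
rewrite /tr0 sum3 => u0.
have m : minor2 (flat u) = expR (- u 0 i0).
  rewrite /minor2 !flat_entry /= !mulr1n !mulr0n mulr0 subr0 -expRD.
  by congr expR; apply/eqP; rewrite -subr_eq0 opprK addrC addrA u0.
rewrite /iwasawa m flat_entry eqxx mulr1n !expRK.
apply/rowP => i; ord3 i; rewrite !mxE /= ?opprK//.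
by move: u0; lra.
Qed.

(** The straight line of the flat has constant speed [norm2 (v - u)]. *)
Lemma line_C1 (R : realType) (u v : 'rV[R]_3) : tr0 u -> tr0 v ->
  C1_curve (flat u) (flat v) (fun t : R => flat (u + t *: (v - u))) /\
  curve_length (fun t : R => flat (u + t *: (v - u))) = norm2 (v - u).
Proof.
move=> u0 v0; pose w := v - u.
have w0 : tr0 w by apply: tr0D => //; exact: tr0N.
pose c (t : R) := flat (u + t *: w).
have Pc t : P3 R (c t) by apply: P3_flat; apply: tr0D => //; exact: tr0Z.
have e (t : R) i j : is_derive t 1 (fun s => c s i j) ((c t *m diag_mx w) i j).
  have /funext -> : forall s, c s i j = expR (u 0 i + s * w 0 i) *+ (i == j).
    by move=> s; rewrite /c flat_entry !mxE.
  have -> : (c t *m diag_mx w) i j =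
      (expR (u 0 i + t * w 0 i) * w 0 i) *+ (i == j).
    by rewrite mul_mx_diag mxE flat_entry !mxE; case: eqP => [->|_];
      rewrite ?mulr1n ?mulr0n ?mul0r.
  case: eqP => _; last by rewrite !mulr0n; exact: is_derive_cst.
  rewrite !mulr1n.
  have cst (x : R) : is_derive t 1 (fun=> x) 0 by exact: is_derive_cst.
  have lin := is_derive_add (cst (u 0 i))
    (is_derive_mul (is_derive_id t (1 : R)) (cst (w 0 i))).
  rewrite mulr0 addr0 mul1r add0r in lin.
  exact: (is_derive1_comp (f := expR) (is_derive_expR _) lin).
have d t := is_derive_mx (e t).
split.
  split.
  - by move=> t; exact: (d t).1.
  - have -> : derive1 c = fun t => c t *m diag_mx w.
      by apply/funext => t; exact: (d t).2.
    move=> t; apply: continuous_mx; apply: cts_mulmx => i j.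
      by apply: derivable_cts; exact: (@ex_derive _ _ _ _ _ _ _ (e t i j)).
    exact: cvg_cst.
  - by move=> t _; exact: Pc.
  - by rewrite scale0r addr0.
  - by rewrite scale1r addrC subrK.
rewrite /curve_length -/w (_ : (fun t => flat _) = c)//.
under eq_Rintegral => t _.
  rewrite (d t).2 (_ : Num.sqrt _ = norm2 w); last first.
    rewrite /norm2; congr Num.sqrt; rewrite /riem.
    have uc : c t \in unitmx by apply: unitmx_det1; case: (Pc t).
    rewrite !mulmxA (mulVmx uc) mul1mx -(mulmxA _ (invmx _)) (mulVmx uc) mulmx1.
    rewrite mulmx_diag /mxtrace /dot; apply: eq_bigr => i _.
    by rewrite !mxE eqxx mulr1n.
  over.
rewrite /Rintegral integral_cst//= lebesgue_measure_itv /= lte_fin ltr01.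
by rewrite oppr0 adde0 mule1.
Qed.

(** The straight line gives the upper bound, and the horospherical projection,
    which is the identity on the flat, the lower one. *)
Lemma dist_flat (R : realType) (u v : 'rV[R]_3) : tr0 u -> tr0 v ->
  dist R (flat u) (flat v) = norm2 (v - u).
Proof.
move=> u0 v0; have [c l] := line_C1 u0 v0.
apply/eqP; rewrite eq_le; apply/andP; split.
  rewrite -l; apply: inf_lbound; last by exists (fun t => flat (u + t *: (v - u))).
  by exists 0 => _ [c' _ <-]; apply: Rintegral_ge0 => t _; exact: sqrtr_ge0.
by have := dist_ge_iwasawa c; rewrite !iwasawa_flat.
Qed.

(** ** Two points lie in a common flat *)

Lemma cubic_root (R : realType) (b c d : R) :
  exists x, x ^+ 3 + b * x ^+ 2 + c * x + d = 0.
Proof.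
pose p : {poly R} := 'X^3 + b%:P * 'X^2 + c%:P * 'X + d%:P.
have pE x : p.[x] = x ^+ 3 + b * x ^+ 2 + c * x + d by rewrite /p !hornerE.
(* Beyond [M] the leading term dominates. *)
pose M := 1 + `|b| + `|c| + `|d|.
have hb := ler_norm b; have hb' := ler_norm (- b); rewrite normrN in hb'.
have hc := ler_norm c; have hc' := ler_norm (- c); rewrite normrN in hc'.
have hd := ler_norm d; have hd' := ler_norm (- d); rewrite normrN in hd'.
have b0 := normr_ge0 b; have c0 := normr_ge0 c; have d0 := normr_ge0 d.
have M1 : 1 <= M by rewrite /M; lra.
have M2 : M <= M ^+ 2 by rewrite expr2 ler_peMl//; lra.
have M0 : 0 <= M ^+ 2 by rewrite sqr_ge0.
have lb (x m : R) : 0 <= m -> m <= M ^+ 2 ->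
    - (`|x| * M ^+ 2) <= x * m <= `|x| * M ^+ 2.
  move=> m0 mM; rewrite -ler_norml normrM ler_wpM2l// ger0_norm//.
have M3 : M ^+ 3 = (1 + `|b| + `|c| + `|d|) * M ^+ 2 by rewrite exprS.
have /andP[e1 f1] := lb b _ M0 (lexx _).
have /andP[e2 f2] := lb c M (le_trans ler01 M1) M2.
have /andP[e3 f3] := lb d 1 ler01 (le_trans M1 M2).
have [||x _ /eqP] := @poly_ivt R p (- M) M.
- by lra.
- rewrite !pE (_ : (- M) ^+ 3 + b * (- M) ^+ 2 + c * - M + d =
    - (M ^+ 3 - b * M ^+ 2 + c * M - d)); last by ring.
  rewrite M3; move: (M ^+ 2) M0 e1 f1 e2 f2 e3 f3 => N N0 *.
  by apply/andP; split; lra.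
- by rewrite pE; exists x.
Qed.

(** The characteristic polynomial has odd degree, hence a real root. *)
Lemma exists_eigenvector (R : realType) (S : 'M[R]_3) :
  exists2 v : 'rV[R]_3, v != 0 & exists a, v *m S = a *: v.
Proof.
have [x hx] := cubic_root (- \tr S)
  (S i0 i0 * S i1 i1 - S i0 i1 * S i1 i0 + (S i0 i0 * S i2 i2 - S i0 i2 * S i2 i0)
   + (S i1 i1 * S i2 i2 - S i1 i2 * S i2 i1)) (- \det S).
have /eqP/det0P[v v0 hv] : \det (x%:M - S) = 0.
  rewrite -[RHS]hx /mxtrace sum3 !det3 !mxE /= !mulr1n !mulr0n; ring.
exists v => //; exists x.
by apply/eqP; rewrite -subr_eq0 -mul_mx_scalar -mulmxBr -oppr_eq0 -mulmxN opprB hv.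
Qed.

Definition rotation (R : realType) (k : 'M[R]_3) :=
  k *m k^T = 1%:M /\ \det k = 1.

Lemma rotationM (R : realType) (k l : 'M[R]_3) :
  rotation k -> rotation l -> rotation (k *m l).
Proof.
move=> [k1 kd] [l1 ld]; split; last by rewrite det_mulmx kd ld mulr1.
by rewrite trmx_mul -mulmxA (mulmxA l) l1 mul1mx.
Qed.

Lemma rotation_tr (R : realType) (k : 'M[R]_3) :
  rotation k -> k^T *m k = 1%:M.
Proof. by case=> /mulmx1C. Qed.

Lemma exists_rotation_row0 (R : realType) (v : 'rV[R]_3) : v != 0 ->
  exists k, rotation k /\ exists a, row i0 k = a *: v.
Proof.
move=> v0; pose n := norm2 v.
have n2 : n ^+ 2 = v 0 i0 ^+ 2 + v 0 i1 ^+ 2 + v 0 i2 ^+ 2.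
  by rewrite sqr_norm2 /dot sum3 -!expr2.
have nN : n != 0.
  apply: contra v0 => /eqP n0; move: n2; rewrite n0 expr0n /= => /esym/eqP.
  rewrite paddr_eq0 ?addr_ge0 ?sqr_ge0// => /andP[].
  rewrite paddr_eq0 ?sqr_ge0// !sqrf_eq0 => /andP[/eqP e0 /eqP e1] /eqP e2.
  by apply/eqP/rowP => i; ord3 i; rewrite mxE.
have [x [y [z [u [ex ey ez]]]]] : exists x y z, x ^+ 2 + y ^+ 2 + z ^+ 2 = 1 /\
    [/\ x = n^-1 * v 0 i0, y = n^-1 * v 0 i1 & z = n^-1 * v 0 i2].
  do 3 eexists; split; last by split.
  rewrite !exprMn -!mulrDr -n2 exprVn mulVf// expf_neq0//.
have [/eqP|h] := eqVneq (x ^+ 2 + y ^+ 2) 0.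
  rewrite paddr_eq0 ?sqr_ge0// !sqrf_eq0 => /andP[/eqP x0 /eqP y0].
  have z1 : z * z = 1 by move: u; rewrite x0 y0 expr0n /= !add0r expr2.
  exists (mx3 [:: [:: 0; 0; z]; [:: 1; 0; 0]; [:: 0; z; 0]]); split.
    split; last by rewrite det3 !mxE /=; move: z1; lra.
    apply/matrixP => i j; ord3 i; ord3 j; rewrite !(mxE, sum3) /= ?mulr1n;
      rewrite ?mulr0n; move: z1; lra.
  exists n^-1; apply/rowP => i; ord3 i; rewrite !mxE /=.
  - by rewrite -ex x0.
  - by rewrite -ey y0.
  - by rewrite -ez.
pose r := Num.sqrt (x ^+ 2 + y ^+ 2).
have r2 : r ^+ 2 = x ^+ 2 + y ^+ 2 by rewrite sqr_sqrtr// addr_ge0// sqr_ge0.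
have rN : r != 0 by move: h; rewrite -r2 sqrf_eq0.
have y2 : y ^+ 2 = r ^+ 2 - x ^+ 2 by rewrite r2; ring.
have z2 : z ^+ 2 = 1 - r ^+ 2 by rewrite r2 -u; ring.
(* The third row is the cross product of the first two. *)
exists (mx3 [:: [:: x; y; z]; [:: - y / r; x / r; 0];
  [:: - (x * z) / r; - (y * z) / r; r]]); split.
  split.
    by apply/matrixP => i j; ord3 i; ord3 j;
      rewrite !(mxE, sum3) /= ?mulr1n ?mulr0n; field: y2 z2.
  by rewrite det3 !mxE /=; field: y2 z2.
exists n^-1; apply/rowP => i; ord3 i; by rewrite !mxE.
Qed.

(** The condition on the unit vector [(x, y)] says that the rotation with these
    entries diagonalizes the symmetric matrix with entries [p], [q], [s]. *)
Lemma jacobi_rotation (R : realType) (p q s : R) :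
  exists x y, x ^+ 2 + y ^+ 2 = 1 /\ x * y * (s - p) + (x ^+ 2 - y ^+ 2) * q = 0.
Proof.
have [->|q0] := eqVneq q 0; first by exists 1, 0; split; ring.
pose r := Num.sqrt ((s - p) ^+ 2 + 4 * q ^+ 2).
(* [(q, y)] is an eigenvector: [y] is a root of [y^2 - (s - p) y - q^2]. *)
have [y yE] : exists y, y = (s - p + r) / 2 by eexists.
have r2 : r ^+ 2 = (s - p) ^+ 2 + 4 * q ^+ 2.
  by rewrite sqr_sqrtr// addr_ge0// ?sqr_ge0// mulr_ge0// sqr_ge0.
have y2 : y ^+ 2 = (s - p) * y + q ^+ 2.
  apply/eqP; rewrite -subr_eq0; apply/eqP.
  have -> : y ^+ 2 - ((s - p) * y + q ^+ 2) =
    (r ^+ 2 - ((s - p) ^+ 2 + 4 * q ^+ 2)) / 4 by rewrite yE; field.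
  by rewrite r2 subrr mul0r.
pose m := Num.sqrt (q ^+ 2 + y ^+ 2).
have m0 : 0 < q ^+ 2 + y ^+ 2 by rewrite ltr_wpDr ?sqr_ge0// exprn_even_gt0.
have m2 : m ^+ 2 = q ^+ 2 + y ^+ 2 by rewrite sqr_sqrtr// ltW.
have mN : m != 0 by rewrite gt_eqF// sqrtr_gt0.
exists (q / m), (y / m); split.
  by rewrite !expr_div_n -mulrDl -m2 divff// expf_neq0.
have -> : q / m * (y / m) * (s - p) + ((q / m) ^+ 2 - (y / m) ^+ 2) * q =
  q * (y * (s - p) + q ^+ 2 - y ^+ 2) / m ^+ 2 by field.
by rewrite y2; ring.
Qed.

(** A rotation that moves an eigenvector to the first axis leaves a symmetric
    block of size 2, which a further rotation diagonalizes. *)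
Lemma spectral3 (R : realType) (S : 'M[R]_3) : S^T = S ->
  exists2 k, rotation k & is_diag_mx (sl_act k S).
Proof.
move=> Ss; have [v v0 [a va]] := exists_eigenvector S.
have [k [rk [b kb]]] := exists_rotation_row0 v0.
have [kk _] := rk.
have Ts : (sl_act k S)^T = sl_act k S by rewrite /sl_act !trmx_mul trmxK Ss mulmxA.
have T0 j : sl_act k S i0 j = a *+ (i0 == j).
  have -> : sl_act k S i0 j = row i0 (sl_act k S) 0 j by rewrite [in RHS]mxE.
  rewrite /sl_act !row_mul kb -scalemxAl va scalerA mulrC -scalerA -kb -scalemxAl.
  by rewrite -row_mul kk !mxE mulr_natr.
have [T TE] : exists T, T = sl_act k S by eexists.
rewrite -TE in Ts T0.
have sy i j : T i j = T j i by rewrite -[in LHS]Ts mxE.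
have [x [y [xy1 xy0]]] := jacobi_rotation (T i1 i1) (T i1 i2) (T i2 i2).
pose l : 'M[R]_3 := mx3 [:: [:: 1; 0; 0]; [:: 0; x; y]; [:: 0; - y; x]].
have rl : rotation l.
  split; last by rewrite det3 !mxE /=; move: xy1; lra.
  apply/matrixP => i j; ord3 i; ord3 j;
    rewrite !(mxE, sum3) /= ?mulr1n ?mulr0n; move: xy1; lra.
exists (l *m k); first exact: rotationM.
rewrite sl_actM -TE; apply/is_diag_mxP => i j.
have t1 : T i0 i1 = 0 by rewrite T0.
have t2 : T i0 i2 = 0 by rewrite T0.
have t1' : T i1 i0 = 0 by rewrite sy.
have t2' : T i2 i0 = 0 by rewrite sy.
have t3 := sy i2 i1.
ord3 i; ord3 j => //= _; rewrite sl_act_entry !mxE /= ?t1 ?t2 ?t1' ?t2' ?t3;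
  move: xy0; lra.
Qed.

(** Simultaneous diagonalization of two quadratic forms: every two points lie in
    a translate of the diagonal flat. All metric statements below reduce to
    this flat. *)
Lemma common_flat (R : realType) (p q : 'M[R]_3) : P3 R p -> P3 R q ->
  exists h u, [/\ \det h = 1, tr0 u, p = sl_act h 1%:M & q = sl_act h (flat u)].
Proof.
move=> Pp Pq; have [n [un dn pE _ _]] := P3_cholesky Pp.
have PS := P3_act (det_inv1 dn) Pq.
have [k rk /is_diag_mxP kd] := spectral3 (S := sl_act (invmx n) q)
  (let: And3 s _ _ := PS in s).
have [kk dk] := rk; have kk' := rotation_tr rk.
have PD := P3_act dk PS; set D := sl_act k _ in kd PD.
pose u := \row_i ln (D i i).
have DE : D = flat u.
  apply/matrixP => i j; rewrite flat_entry; case: eqP => [->|/eqP ij].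
    by rewrite [X in expR X]mxE mulr1n lnK// posrE P3_diag_gt0.
  by rewrite kd.
have u0 : tr0 u.
  rewrite /tr0 -[LHS]expRK (big_morph _ (@expRD R) (@expR0 R)).
  have [_ _] := PD; rewrite DE det_diag => dD.
  rewrite -[RHS]ln1; congr ln; rewrite -[RHS]dD; apply: eq_bigr => i _.
  by rewrite [RHS]mxE.
exists (n *m k^T), u; split => //.
- by rewrite det_mulmx det_tr dn dk mulr1.
- by rewrite sl_actM [sl_act k^T _]/sl_act trmxK mulmx1 kk' /sl_act mulmx1.
- rewrite -DE /D -!sl_actM -(mulmxA n) kk' mulmx1 mulmxV ?sl_act1//.
  exact: unitmx_det1.
Qed.

(** * The metric geometry of the space *)

Lemma dot_sqr (R : realType) (u : 'rV[R]_3) :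
  dot u u = u 0 i0 ^+ 2 + u 0 i1 ^+ 2 + u 0 i2 ^+ 2.
Proof. by rewrite /dot sum3 -!expr2. Qed.

Lemma le_of_sqr_le (R : realType) (x y : R) : 0 <= x -> 0 <= y ->
  x ^+ 2 <= y ^+ 2 -> x <= y.
Proof. by move=> x0 y0; rewrite ler_pXn2r. Qed.

Lemma norm2D (R : realType) (u v : 'rV[R]_3) :
  norm2 (u + v) <= norm2 u + norm2 v.
Proof.
apply: le_of_sqr_le; rewrite ?addr_ge0 ?norm2_ge0//.
have cs : dot u v <= norm2 u * norm2 v.
  rewrite /norm2 -sqrtrM ?dot_ge0//; apply: le_trans (ler_norm _) _.
  by rewrite -sqrtr_sqr ler_wsqrtr// cauchy_schwarz.
rewrite sqrrD !sqr_norm2.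
have -> : dot (u + v) (u + v) = dot u u + dot u v *+ 2 + dot v v.
  by rewrite /dot !sum3 !mxE; ring.
by rewrite lerD2r lerD2l ler_wMn2r.
Qed.

Lemma norm2Z (R : realType) (a : R) (u : 'rV[R]_3) :
  norm2 (a *: u) = `|a| * norm2 u.
Proof.
rewrite /norm2 -sqrtr_sqr -sqrtrM ?sqr_ge0//; congr Num.sqrt.
by rewrite /dot !sum3 !mxE; ring.
Qed.

Lemma norm2N (R : realType) (u : 'rV[R]_3) : norm2 (- u) = norm2 u.
Proof. by rewrite -scaleN1r norm2Z normrN1 mul1r. Qed.

Lemma norm2_eq0 (R : realType) (u : 'rV[R]_3) : norm2 u = 0 -> u = 0.
Proof.
move=> n0; have := sqr_norm2 u; rewrite n0 expr0n /= dot_sqr => /esym/eqP.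
rewrite paddr_eq0 ?addr_ge0 ?sqr_ge0// => /andP[].
rewrite paddr_eq0 ?sqr_ge0// !sqrf_eq0 => /andP[/eqP e0 /eqP e1] /eqP e2.
by apply/rowP => i; ord3 i; rewrite mxE.
Qed.

Lemma dist_act_flat (R : realType) (h : 'M[R]_3) (u v : 'rV[R]_3) :
  \det h = 1 -> tr0 u -> tr0 v ->
  dist R (sl_act h (flat u)) (sl_act h (flat v)) = norm2 (v - u).
Proof. by move=> dh u0 v0; rewrite dist_act// dist_flat. Qed.

Lemma iwasawa_lipschitz (R : realType) (p q : 'M[R]_3) : P3 R p -> P3 R q ->
  norm2 (iwasawa q - iwasawa p) <= dist R p q.
Proof.
move=> Pp Pq; have [h [u [dh u0 -> ->]]] := common_flat Pp Pq.
have [c _] := line_C1 (@tr0_0 R) u0; rewrite flat0 in c.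
exact: dist_ge_iwasawa (C1_curve_act dh c).
Qed.

Lemma distC (R : realType) (p q : 'M[R]_3) : P3 R p -> P3 R q ->
  dist R p q = dist R q p.
Proof.
move=> Pp Pq; have [h [u [dh u0 -> ->]]] := common_flat Pp Pq.
by rewrite -flat0 !dist_act_flat//; [rewrite -norm2N opprB|exact: tr0_0|exact: tr0_0].
Qed.

Lemma dist_ge0 (R : realType) (p q : 'M[R]_3) : P3 R p -> P3 R q ->
  0 <= dist R p q.
Proof.
by move=> Pp Pq; apply: le_trans (iwasawa_lipschitz Pp Pq); exact: norm2_ge0.
Qed.

Lemma distxx (R : realType) (p : 'M[R]_3) : P3 R p -> dist R p p = 0.
Proof.
move=> Pp; have [n [_ dn -> _ _]] := P3_cholesky Pp.
rewrite -[n *m n^T](_ : sl_act n (flat 0) = _); last by rewrite flat0 /sl_act mulmx1.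
rewrite dist_act_flat ?subrr//; try exact: tr0_0.
by rewrite /norm2 (_ : dot _ _ = 0) ?sqrtr0// /dot big1// => i _; rewrite mxE mul0r.
Qed.

(** [p] and [q] lie in a flat, onto which the horospherical projection is a
    1-Lipschitz retraction; so the Euclidean triangle inequality suffices. *)
Lemma dist_triangle (R : realType) (p q r : 'M[R]_3) :
  P3 R p -> P3 R q -> P3 R r -> dist R p q <= dist R p r + dist R r q.
Proof.
move=> Pp Pq Pr; have [h [u [dh u0 pE qE]]] := common_flat Pp Pq.
have dh' := det_inv1 dh; rewrite -flat0 in pE.
have t0 := @tr0_0 R.
have hK v : sl_act (invmx h) (sl_act h (flat v)) = flat v by rewrite sl_actK.
have Pr' := P3_act dh' Pr.
rewrite -(dist_act p r dh') -(dist_act r q dh') pE qE !hK dist_act_flat//.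
have h1 := iwasawa_lipschitz (P3_flat t0) Pr'.
have h2 := iwasawa_lipschitz Pr' (P3_flat u0).
apply: le_trans (lerD h1 h2); rewrite !iwasawa_flat// [leRHS]addrC.
by apply: le_trans (norm2D _ _); rewrite addrA subrK.
Qed.

(** The squared distance of [x] from the point that divides the segment in the
    ratio [s] is the corresponding combination of the squared distances from
    its endpoints (Stewart). *)
Lemma euclidean_segment (R : realType) (u v x : 'rV[R]_3) (s : R) :
  0 <= s <= 1 -> norm2 (x - u) <= s * norm2 (v - u) ->
  norm2 (v - x) <= (1 - s) * norm2 (v - u) -> x = u + s *: (v - u).
Proof.
move=> /andP[s0 s1] h1 h2.
have L0 := norm2_ge0 (v - u).
have sq (a b : R) : 0 <= a -> a <= b -> a ^+ 2 <= b ^+ 2.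
  by move=> a0 ab; rewrite ler_pXn2r ?nnegrE// (le_trans a0).
have {h1} h1 := sq _ _ (norm2_ge0 _) h1.
have {h2} h2 := sq _ _ (norm2_ge0 _) h2.
rewrite !exprMn !sqr_norm2 in h1 h2.
have e : dot (x - (u + s *: (v - u))) (x - (u + s *: (v - u))) =
  (1 - s) * dot (x - u) (x - u) + s * dot (v - x) (v - x)
  - s * (1 - s) * dot (v - u) (v - u) by rewrite /dot !sum3 !mxE; ring.
apply/eqP; rewrite -subr_eq0; apply/eqP/norm2_eq0.
apply/eqP; rewrite -sqrf_eq0 sqr_norm2 eq_le dot_ge0 andbT e.
have t1 : 0 <= 1 - s by rewrite subr_ge0.
have := ler_wpM2l t1 h1; have := ler_wpM2l s0 h2; nra.
Qed.

Definition cycmx (R : realType) : 'M[R]_3 :=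
  mx3 [:: [:: 0; 1; 0]; [:: 0; 0; 1]; [:: 1; 0; 0]].

Definition cyc (R : realType) (u : 'rV[R]_3) : 'rV[R]_3 :=
  rv (u 0 i1) (u 0 i2) (u 0 i0).

Lemma det_cycmx (R : realType) : \det (cycmx R) = 1.
Proof. by rewrite det3 !mxE /=; ring. Qed.

Lemma cycmx_act (R : realType) (p : 'M[R]_3) : sl_act (cycmx R) p = mx3
  [:: [:: p i1 i1; p i1 i2; p i1 i0]; [:: p i2 i1; p i2 i2; p i2 i0];
      [:: p i0 i1; p i0 i2; p i0 i0]].
Proof.
by apply/matrixP => i j; rewrite sl_act_entry; ord3 i; ord3 j; rewrite !mxE /=; ring.
Qed.

Lemma cycmx_flat (R : realType) (u : 'rV[R]_3) :
  sl_act (cycmx R) (flat u) = flat (cyc u).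
Proof.
rewrite cycmx_act; apply/matrixP => i j; ord3 i; ord3 j;
by rewrite flat_entry !mxE /= ?flat_entry /= ?mulr1n ?mulr0n.
Qed.

Lemma tr0_cyc (R : realType) (u : 'rV[R]_3) : tr0 u -> tr0 (cyc u).
Proof. by rewrite /tr0 !sum3 !mxE /= => <-; ring. Qed.

Lemma cycB (R : realType) (u v : 'rV[R]_3) : cyc u - cyc v = cyc (u - v).
Proof. by apply/rowP => i; ord3 i; rewrite !mxE. Qed.

Lemma norm2_cyc (R : realType) (u : 'rV[R]_3) : norm2 (cyc u) = norm2 u.
Proof. by congr Num.sqrt; rewrite !dot_sqr !mxE /=; ring. Qed.

(** Geodesics are unique. The horospherical projections onto the flat for all
    three cyclic orders of the coordinates map [q] to the point of the straight
    line with the same distances, so they determine the diagonal entries and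
    the principal minors of order 2 of [q]; hence [q] is diagonal. *)
Lemma flat_segment (R : realType) (u v : 'rV[R]_3) (q : 'M[R]_3) (s : R) :
  tr0 u -> tr0 v -> P3 R q -> 0 <= s <= 1 ->
  dist R (flat u) q = s * norm2 (v - u) ->
  dist R q (flat v) = (1 - s) * norm2 (v - u) ->
  q = flat (u + s *: (v - u)).
Proof.
have key u' v' q' : tr0 u' -> tr0 v' -> P3 R q' -> 0 <= s <= 1 ->
    dist R (flat u') q' = s * norm2 (v' - u') ->
    dist R q' (flat v') = (1 - s) * norm2 (v' - u') ->
    let w := u' + s *: (v' - u') in
    q' i2 i2 = expR (w 0 i2) /\ minor2 q' = expR (w 0 i1) * expR (w 0 i2).
  move=> u0 v0 Pq s01 h1 h2 w.
  have := iwasawa_lipschitz (P3_flat u0) Pq.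
  have := iwasawa_lipschitz Pq (P3_flat v0).
  rewrite !iwasawa_flat// h1 h2 => k2 k1.
  have wE := euclidean_segment s01 k1 k2.
  have e2 := congr1 (fun x : 'rV[R]_3 => x 0 i2) wE.
  have e1 := congr1 (fun x : 'rV[R]_3 => x 0 i1) wE.
  rewrite -/w !mxE /= in e1 e2.
  have p2 := P3_22_gt0 Pq; have m0 := P3_minor2_gt0 Pq.
  rewrite -expRD; split; first by rewrite -[LHS]lnK ?posrE// e2 /w !mxE.
  rewrite -[LHS]lnK ?posrE//; congr expR.
  move: e1 e2; rewrite /w !mxE; lra.
move=> u0 v0 Pq s01 h1 h2.
have dC := det_cycmx R.
have [a1 b1] := key _ _ _ u0 v0 Pq s01 h1 h2.
have C1 : dist R (flat (cyc u)) (sl_act (cycmx R) q) = s * norm2 (cyc v - cyc u).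
  by rewrite -cycmx_flat dist_act// cycB norm2_cyc.
have C2 : dist R (sl_act (cycmx R) q) (flat (cyc v)) =
    (1 - s) * norm2 (cyc v - cyc u).
  by rewrite -cycmx_flat dist_act// cycB norm2_cyc.
have Pq1 := P3_act dC Pq.
have [a2 b2] := key _ _ _ (tr0_cyc u0) (tr0_cyc v0) Pq1 s01 C1 C2.
have [|||||a3 b3] := key (cyc (cyc u)) (cyc (cyc v))
  (sl_act (cycmx R) (sl_act (cycmx R) q)) _ _ _ s01 _ _.
- by do 2!apply: tr0_cyc.
- by do 2!apply: tr0_cyc.
- by apply: P3_act.
- by rewrite -cycmx_flat dist_act// cycB norm2_cyc.
- by rewrite -cycmx_flat dist_act// cycB norm2_cyc.
have s01' := P3_sym i1 i0 Pq; have s02 := P3_sym i2 i0 Pq.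
have s12 := P3_sym i2 i1 Pq.
rewrite /minor2 ?cycmx_act !mxE /= in a1 a2 a3 b1 b2 b3.
rewrite s12 s01' s02 in b1 b2 b3.
have z (x y z w t : R) : x = z -> y = w -> x * y - t * t = z * w -> t = 0.
  move=> -> -> h; have /eqP : t * t = 0 by move: h; lra.
  by rewrite mulf_eq0 orbb => /eqP.
have q12 := z _ _ _ _ _ a3 a1 b1.
have q02 := z _ _ _ _ _ a1 a2 b2.
have q01 := z _ _ _ _ _ a2 a3 b3.
apply/matrixP => i j; rewrite flat_entry; ord3 i; ord3 j;
by rewrite ?s01' ?s02 ?s12 ?q01 ?q02 ?q12 ?a1 ?a2 ?a3 /= ?mulr1n ?mulr0n ?mxE.
Qed.

(** Where the displacements of [g] add up along [p], [g p], [g^2 p], these points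
    are equally spaced on a geodesic, along which [Q] is the transvection from
    [p] to [g p]. As it is also the transvection from [g p] to [g^2 p], it
    commutes with [g]. *)
Lemma commuting_translation (R : realType) (g p : 'M[R]_3) :
  \det g = 1 -> P3 R p ->
  dist R p (sl_act g (sl_act g p)) = 2 * dist R p (sl_act g p) ->
  exists Q, sl_act g p = Q *m p /\ Q *m g = g *m Q.
Proof.
move=> dg Pp e; have Pq := P3_act dg Pp; have Pr := P3_act dg Pq.
have [h [u [dh u0 pE rE]]] := common_flat Pp Pr.
have dh' := det_inv1 dh; have uh := unitmx_det1 dh.
have t0 := @tr0_0 R; rewrite -flat0 in pE.
have hK v : sl_act (invmx h) (sl_act h v) = v by rewrite sl_actK.
have d1 : dist R p (sl_act g p) = 2^-1 * norm2 (u - 0).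
  by rewrite -(dist_act_flat dh t0 u0) -pE -rE e; field.
have d2 : dist R (sl_act g p) (sl_act g (sl_act g p)) = 2^-1 * norm2 (u - 0).
  by rewrite dist_act.
pose v : 'rV[R]_3 := 2^-1 *: u.
have qE : sl_act g p = sl_act h (flat v).
  have sg := @flat_segment R 0 u _ 2^-1 t0 u0 (P3_act dh' Pq).
  rewrite subr0 add0r -/v in sg; rewrite -sg.
  - by rewrite -sl_actM mulmxV// sl_act1.
  - by apply/andP; split; lra.
  - by rewrite -(hK (flat 0)) -pE dist_act// d1 subr0.
  - by rewrite -(hK (flat u)) -rE dist_act// d2 subr0; congr (_ * _); field.
pose Q := h *m flat v *m invmx h.
have QE k : Q *m sl_act h k = sl_act h (flat v *m k).
  by rewrite /Q /sl_act !mulmxA mulmxKV.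
have Q1 : sl_act g p = Q *m p by rewrite qE pE QE flat0 mulmx1.
have Q2 : sl_act g (sl_act g p) = Q *m (Q *m p).
  rewrite rE [in RHS]pE !QE flat0 mulmx1 -flatD; congr (sl_act _ (flat _)).
  by rewrite -scalerDl (_ : _ + _ = 1) ?scale1r//; field.
clearbody Q; exists Q; split=> //.
have up : p \in unitmx by apply: unitmx_det1; case: Pp.
have ug := unitmx_det1 dg.
have uQ : Q \in unitmx.
  rewrite -(mulmxK up Q) -Q1 unitmx_mul unitmx_inv up andbT.
  by apply: unitmx_det1; case: Pq.
have e1 : p *m g^T = invmx g *m Q *m p.
  by rewrite -mulmxA -Q1 /sl_act -mulmxA mulKmx.
move: Q2; rewrite {1}Q1 {1}/sl_act -(mulmxA g) -(mulmxA Q p) e1 !mulmxA.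
move=> /(congr1 (mulmxr (invmx p))) /=; rewrite !(mulmxK up).
move=> /(congr1 (mulmxr (invmx Q))) /=; rewrite !(mulmxK uQ) => e2.
by rewrite -[in LHS]e2 mulmxKV.
Qed.

(** ** The distance and the trace of [p^-1 q] *)

(** On two points of a common flat this is the sum of the exponentials of the
    coordinates of their difference. It is algebraic in the entries and bounded
    exactly where the distance is. *)
Definition trd (R : realType) (p q : 'M[R]_3) : R := \tr (invmx p *m q).

Lemma invmx_act (R : realType) (h p : 'M[R]_3) : \det h = 1 -> \det p = 1 ->
  invmx (sl_act h p) = (invmx h)^T *m invmx p *m invmx h.
Proof.
move=> dh dp; have uh := unitmx_det1 dh; have up := unitmx_det1 dp.
have uht : h^T \in unitmx by rewrite unitmx_tr.
apply: invmx_left; rewrite trmx_inv /sl_act !mulmxA.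
by rewrite mulmxK// mulmxK// mulmxV.
Qed.

Lemma trd_act (R : realType) (h p q : 'M[R]_3) : \det h = 1 -> \det p = 1 ->
  trd (sl_act h p) (sl_act h q) = trd p q.
Proof.
move=> dh dp; have uh := unitmx_det1 dh.
rewrite /trd invmx_act// mxtrace_mulC /sl_act !mulmxA.
rewrite -(mulmxA _ h^T) -trmx_mul mulVmx// trmx1 mulmx1.
by rewrite mxtrace_mulC !mulmxA mulVmx// mul1mx mxtrace_mulC.
Qed.

Lemma invmx_flat (R : realType) (u : 'rV[R]_3) : invmx (flat u) = flat (- u).
Proof. by apply: invmx_left; rewrite -flatD subrr flat0. Qed.

Lemma trd_flat (R : realType) (u v : 'rV[R]_3) :
  trd (flat u) (flat v) = \sum_i expR (v 0 i - u 0 i).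
Proof.
rewrite /trd invmx_flat -flatD /mxtrace; apply: eq_bigr => i _.
by rewrite flat_entry eqxx mulr1n !mxE addrC.
Qed.

Lemma coord_le_norm2 (R : realType) (u : 'rV[R]_3) i : u 0 i <= norm2 u.
Proof.
apply: le_trans (ler_norm _) _; rewrite -sqrtr_sqr ler_wsqrtr//.
by rewrite /dot (bigD1 i)//= expr2 lerDl sumr_ge0// => j _; rewrite -expr2 sqr_ge0.
Qed.

(** The constant 4 is not optimal; it allows a proof from [1 + y <= exp y] alone. *)
Lemma cosh_ge (R : realType) (x : R) : x ^+ 2 <= 4 * (expR x + expR (- x) - 2).
Proof.
wlog x0 : x / 0 <= x.
  move=> H; have [/H//|/ltW x0] := leP 0 x.
  by have := H (- x); rewrite oppr_ge0 opprK sqrrN (addrC (expR (- x))); apply.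
pose y := x / 2; have y0 : 0 <= y by rewrite divr_ge0.
have -> : x = y + y by rewrite /y; field.
rewrite opprD !expRD.
have e1 : 1 + y <= expR y by rewrite expR_ge1Dx.
have e2 : expR y * expR (- y) = 1 by rewrite -expRD subrr expR0.
have e3 : 0 < expR (- y) by rewrite expR_gt0.
have h : y <= expR y - expR (- y).
  have : expR (- y) * (1 + y) <= 1 by rewrite mulrC -[leRHS]e2 ler_wpM2r// ltW.
  have : 0 <= expR (- y) * y by rewrite mulr_ge0// ltW.
  lra.
have : y ^+ 2 <= (expR y - expR (- y)) ^+ 2.
  by rewrite ler_pXn2r// nnegrE// (le_trans y0).
by move: e2; lra.
Qed.

Lemma trd_le (R : realType) (p q : 'M[R]_3) : P3 R p -> P3 R q ->
  trd p q <= 3 * expR (dist R p q).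
Proof.
move=> Pp Pq; have [h [u [dh u0 -> ->]]] := common_flat Pp Pq.
have t0 := @tr0_0 R.
rewrite -flat0 dist_act_flat// trd_act ?det_flat// trd_flat subr0 sum3.
have e i : expR (u 0 i - (0 : 'rV[R]_3) 0 i) <= expR (norm2 u).
  by rewrite ler_expR mxE subr0; exact: coord_le_norm2.
have := e i0; have := e i1; have := e i2; lra.
Qed.

Lemma sqr_dist_le (R : realType) (p q : 'M[R]_3) : P3 R p -> P3 R q ->
  dist R p q ^+ 2 <= 4 * (trd p q + trd q p - 6).
Proof.
move=> Pp Pq; have [h [u [dh u0 -> ->]]] := common_flat Pp Pq.
have t0 := @tr0_0 R.
rewrite -flat0 dist_act_flat// !trd_act ?det_flat// !trd_flat subr0 sqr_norm2.
rewrite dot_sqr !sum3 !mxE !subr0 !add0r.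
have := cosh_ge (u 0 i0); have := cosh_ge (u 0 i1); have := cosh_ge (u 0 i2).
lra.
Qed.

(** The determinant being 1, the eigenvalues of [q^-1 p] are products of two
    eigenvalues of [p^-1 q]. *)
Lemma trdC_le (R : realType) (p q : 'M[R]_3) : P3 R p -> P3 R q ->
  trd q p <= trd p q ^+ 2.
Proof.
move=> Pp Pq; have [h [u [dh u0 -> ->]]] := common_flat Pp Pq.
have t0 := @tr0_0 R.
rewrite -flat0 !trd_act ?det_flat// !trd_flat !sum3 !mxE !subr0 !add0r.
move: u0; rewrite /tr0 sum3 => u0.
have -> : - u 0 i0 = u 0 i1 + u 0 i2 by move: u0; lra.
have -> : - u 0 i1 = u 0 i0 + u 0 i2 by move: u0; lra.
have -> : - u 0 i2 = u 0 i0 + u 0 i1 by move: u0; lra.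
rewrite !expRD.
have := expR_gt0 (u 0 i0); have := expR_gt0 (u 0 i1); have := expR_gt0 (u 0 i2).
nra.
Qed.

(** ** Rays *)

Definition dir (R : realType) (D : 'rV[R]_3) := tr0 D /\ norm2 D = 1.

Definition ray (R : realType) (h : 'M[R]_3) (D : 'rV[R]_3) (t : R) : 'M[R]_3 :=
  sl_act h (flat (t *: D)).

Lemma P3_ray (R : realType) (h : 'M[R]_3) (D : 'rV[R]_3) t :
  \det h = 1 -> tr0 D -> P3 R (ray h D t).
Proof. by move=> dh D0; apply: P3_act => //; apply: P3_flat; exact: tr0Z. Qed.

Lemma ray_line (R : realType) (h : 'M[R]_3) (D : 'rV[R]_3) :
  \det h = 1 -> dir D -> geodesic_line (P3 R) (dist R) (ray h D).
Proof.
move=> dh [D0 D1]; split=> [t|s t]; first exact: P3_ray.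
by rewrite (dist_act_flat dh (tr0Z s D0) (tr0Z t D0)) -scalerBl norm2Z D1 mulr1 distrC.
Qed.

Lemma ray_ray (R : realType) (h : 'M[R]_3) (D : 'rV[R]_3) :
  \det h = 1 -> dir D -> geodesic_ray (P3 R) (dist R) (ray h D).
Proof.
by move=> dh dD; have [l1 l2] := ray_line dh dD; split=> [t _|s t _ _].
Qed.

Lemma ray_actM (R : realType) (g h : 'M[R]_3) (D : 'rV[R]_3) :
  sl_act g \o ray h D = ray (g *m h) D.
Proof. by apply/funext => t; rewrite /= /ray sl_actM. Qed.

(** A matrix that intertwines [exp a] and [exp b] matches equal eigenvalues, so it
    also intertwines their powers. *)
Lemma rotation_flatZ (R : realType) (k : 'M[R]_3) (a b : 'rV[R]_3) (t : R) :
  k *m k^T = 1%:M -> flat a = sl_act k (flat b) ->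
  flat (t *: a) = sl_act k (flat (t *: b)).
Proof.
move=> kk e; have kk' := mulmx1C kk.
have com (c d : 'rV[R]_3) : flat c *m k = k *m flat d <->
    forall i j, k i j != 0 -> c 0 i = d 0 j.
  rewrite /flat mul_diag_mx mul_mx_diag; split=> [/matrixP h i j k0|h].
    have := h i j; rewrite !mxE mulrC => /(mulfI k0); exact: expR_inj.
  apply/matrixP => i j; rewrite !mxE mulrC.
  by have [->|/h ->//] := eqVneq (k i j) 0; rewrite !mul0r.
have /com h : flat a *m k = k *m flat b by rewrite e /sl_act -mulmxA kk' mulmx1.
have /com e' : forall i j, k i j != 0 -> (t *: a) 0 i = (t *: b) 0 j.
  by move=> i j /h; rewrite !mxE => ->.
by rewrite /sl_act -e' -mulmxA kk mulmx1.
Qed.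

(** A line in a flat is determined by two of its points, even where the flat
    through them is not unique. *)
Lemma ray_rigid (R : realType) (h h' : 'M[R]_3) (D D' : 'rV[R]_3) :
  \det h = 1 -> ray h D 0 = ray h' D' 0 -> ray h D 1 = ray h' D' 1 ->
  ray h D = ray h' D'.
Proof.
move=> dh e0 e1; have uh := unitmx_det1 dh.
pose k := invmx h *m h'.
have kE v : sl_act k v = sl_act (invmx h) (sl_act h' v) by rewrite sl_actM.
have kk : k *m k^T = 1%:M.
  have : sl_act k (flat 0) = flat 0.
    by move: e0; rewrite kE /ray !scale0r => <-; rewrite sl_actK.
  by rewrite flat0 /sl_act mulmx1.
have kD : flat D = sl_act k (flat D').
  by move: e1; rewrite kE /ray !scale1r => <-; rewrite sl_actK.
apply/funext => t; rewrite /ray (rotation_flatZ _ kk kD) kE -sl_actM mulmxV//.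
by rewrite sl_act1.
Qed.

(** Each initial segment lies in a flat by uniqueness of geodesics, and the flats
    for different segments give the same line by rigidity. *)
Lemma geodesic_rayP (R : realType) (c : R -> 'M[R]_3) :
  geodesic_ray (P3 R) (dist R) c ->
  exists h D, [/\ \det h = 1, dir D & forall t, 0 <= t -> c t = ray h D t].
Proof.
move=> [cP cd]; have t0 := @tr0_0 R.
have seg (T : R) : 0 < T -> exists h D, [/\ \det h = 1, dir D &
    forall t, 0 <= t -> t <= T -> c t = ray h D t].
  move=> T0; have [h [u [dh u0 e0 e1]]] := common_flat (cP 0 (lexx _)) (cP T (ltW T0)).
  rewrite -flat0 in e0.
  have TN : T != 0 by rewrite gt_eqF.
  have nu : norm2 u = T.
    have := cd 0 T (lexx _) (ltW T0).
    by rewrite e0 e1 dist_act_flat// subr0 sub0r normrN gtr0_norm.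
  exists h, (T^-1 *: u); split=> //.
    split; first exact: tr0Z.
    by rewrite norm2Z nu gtr0_norm ?invr_gt0// mulVf.
  move=> t t_ge0 tT; have dh' := det_inv1 dh.
  have hK v : sl_act (invmx h) (sl_act h v) = v by rewrite sl_actK.
  have sg := @flat_segment R 0 u _ (t / T) t0 u0 (P3_act dh' (cP t t_ge0)).
  rewrite subr0 add0r nu in sg.
  rewrite /ray scalerA -sg.
  - by rewrite -sl_actM mulmxV ?sl_act1// unitmx_det1.
  - by rewrite divr_ge0 ?(ltW T0)//= ler_pdivrMr// mul1r.
  - rewrite -(hK (flat 0)) -e0 dist_act// cd// sub0r normrN ger0_norm//.
    by rewrite divfK.
  - rewrite -(hK (flat u)) -e1 dist_act// cd//; last exact: ltW.
    by rewrite ler0_norm ?subr_le0//; field.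
(* The line through the points at times 0 and 1 is the reference. *)
have [h [D [dh dD hE]]] := seg 1 ltr01.
exists h, D; split=> // t t_ge0.
have [t1|/ltW t1] := leP t 1; first exact: hE.
have [h' [D' [dh' dD' hE']]] := seg t (lt_le_trans ltr01 t1).
rewrite hE'//; congr (_ t); apply/esym/ray_rigid => //.
  by rewrite -hE ?ler01// -hE'.
by rewrite -hE ?ler01// -hE' ?ler01.
Qed.

Lemma geodesic_lineP (R : realType) (c : R -> 'M[R]_3) :
  geodesic_line (P3 R) (dist R) c ->
  exists h D, [/\ \det h = 1, dir D & c = ray h D].
Proof.
move=> [cP cd].
have seg (T : R) : 0 <= T -> exists h D, [/\ \det h = 1, dir D &
    forall t, - T <= t -> c t = ray h D t].
  move=> T0; have [|h [D [dh dD hE]]] := @geodesic_rayP R (fun t => c (t - T)).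
    by split=> [t _|s t _ _] //; rewrite cd opprB addrA subrK.
  have D0 : tr0 (2^-1 *: (T *: D)) by do 2!apply: tr0Z; case: dD.
  exists (h *m flat (2^-1 *: (T *: D))), D; split=> //.
    by rewrite det_mulmx dh det_flat ?mulr1.
  move=> t tT; have := hE (t + T); rewrite addrK => ->; last by lra.
  rewrite /ray sl_actM sl_act_flat -scalerDl (_ : _ + _ = 1); last by field.
  by rewrite scale1r -scalerDl addrC.
have [h [D [dh dD hE]]] := seg 0 (lexx _).
exists h, D; split=> //; apply/funext => t.
have [h' [D' [dh' dD' hE']]] := seg `|t| (normr_ge0 t).
have t0 := normr_ge0 t.
rewrite hE' ?lerNnormlW//; congr (_ t); apply/esym/ray_rigid => //.
  by rewrite -hE ?oppr0// -hE' ?oppr_le0.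
by rewrite -hE ?oppr0 ?ler01// -hE'//; lra.
Qed.

(** * Points at infinity *)

(** The condition for [exp (- t D / 2) b exp (t D' / 2)] to stay bounded as [t]
    tends to +oo. *)
Definition below (R : realType) (b : 'M[R]_3) (D' D : 'rV[R]_3) :=
  forall i j, b i j != 0 -> D' 0 j <= D 0 i.

Lemma trd_ray (R : realType) (h h' : 'M[R]_3) (D D' : 'rV[R]_3) (t : R) :
  \det h = 1 -> tr0 D -> trd (ray h D t) (ray h' D' t) =
  \sum_i \sum_j (invmx h *m h') i j ^+ 2 * expR (t * (D' 0 j - D 0 i)).
Proof.
move=> dh D0; have uh := unitmx_det1 dh.
have -> : ray h' D' t = sl_act h (sl_act (invmx h *m h') (flat (t *: D'))).
  by rewrite -sl_actM mulmxA mulmxV// mul1mx.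
move: (invmx h *m h') => b.
rewrite trd_act ?det_flat//; last exact: tr0Z.
rewrite /trd invmx_flat /flat mul_diag_mx /mxtrace; apply: eq_bigr => i _.
rewrite /sl_act mul_mx_diag !mxE mulr_sumr; apply: eq_bigr => j _.
by rewrite !mxE mulrBr [in RHS]expRD; ring.
Qed.

Section asymptotic_rays.
Variables (R : realType) (h h' : 'M[R]_3) (D D' : 'rV[R]_3).
Hypotheses (dh : \det h = 1) (dh' : \det h' = 1) (D0 : tr0 D) (D0' : tr0 D').
Let b := invmx h *m h'.

(** The distance of the rays is controlled by the sum in [trd_ray], in which no
    exponential grows. *)
Lemma below_asymptotic : below b D' D ->
  asymptotic (dist R) (ray h D) (ray h' D').
Proof.
move=> bb; pose C := \sum_i \sum_j b i j ^+ 2.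
have C0 : 0 <= C by do 2!(apply: sumr_ge0 => ? _); exact: sqr_ge0.
exists (1 + 4 * (C + C ^+ 2)) => t t0.
have P := P3_ray t dh D0; have P' := P3_ray t dh' D0'.
have d0 := dist_ge0 P P'.
have T : trd (ray h D t) (ray h' D' t) <= C.
  rewrite trd_ray//; apply: ler_sum => i _; apply: ler_sum => j _; rewrite -/b.
  have [->|/bb bij] := eqVneq (b i j) 0; first by rewrite expr0n mul0r.
  rewrite ler_piMr ?sqr_ge0// expR_le1 mulr_ge0_le0// subr_le0//.
have T0 : 0 <= trd (ray h D t) (ray h' D' t).
  rewrite trd_ray//; do 2!(apply: sumr_ge0 => ? _).
  by rewrite mulr_ge0 ?sqr_ge0// expR_ge0.
have T' := trdC_le P P'.
have T2 : trd (ray h D t) (ray h' D' t) ^+ 2 <= C ^+ 2 by rewrite ler_pXn2r.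
have := sqr_dist_le P P'; nra.
Qed.

(** A single growing exponential in [trd_ray] makes the distance unbounded. *)
Lemma asymptotic_below : asymptotic (dist R) (ray h D) (ray h' D') ->
  below b D' D.
Proof.
move=> [K hK] i j bij; rewrite leNgt; apply/negP => lt.
pose e := D' 0 j - D 0 i; have e0 : 0 < e by rewrite subr_gt0.
pose M := 3 * expR K / b i j ^+ 2.
have b2 : 0 < b i j ^+ 2 by rewrite exprn_even_gt0.
have M0 : 0 <= M by rewrite divr_ge0 ?ltW// mulr_gt0// expR_gt0.
pose t := M / e; have t0 : 0 <= t by rewrite divr_ge0// ltW.
have P := P3_ray t dh D0; have P' := P3_ray t dh' D0'.
have T : trd (ray h D t) (ray h' D' t) <= 3 * expR K.
  apply: le_trans (trd_le P P') _.
  by rewrite ler_wpM2l// ler_expR hK.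
have : b i j ^+ 2 * expR (t * e) <= 3 * expR K.
  apply: le_trans T; rewrite trd_ray// -/b (bigD1 i)//= (bigD1 j)//= -/e.
  rewrite -addrA lerDl addr_ge0// ?sumr_ge0// => k _; last apply: sumr_ge0 => l _;
  by rewrite mulr_ge0 ?sqr_ge0 ?expR_ge0.
rewrite mulrC -ler_pdivlMr// -/M leNgt => /negP; apply.
have -> : t * e = M by rewrite /t divfK// gt_eqF.
by apply: lt_le_trans (expR_ge1Dx M); rewrite ltrDr.
Qed.

Lemma asymptoticP : asymptotic (dist R) (ray h D) (ray h' D') <-> below b D' D.
Proof. by split; [exact: asymptotic_below|exact: below_asymptotic]. Qed.

End asymptotic_rays.

Section asymptotic_equivalence.
Variable R : realType.
Notation d := (dist R).
Notation X := (P3 R).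
Implicit Types c : R -> 'M[R]_3.

Lemma asymptoticC c c' : geodesic_ray X d c -> geodesic_ray X d c' ->
  asymptotic d c c' -> asymptotic d c' c.
Proof.
move=> [cP _] [cP' _] [K hK]; exists K => t t0.
by rewrite distC ?hK//; [exact: cP'|exact: cP].
Qed.

Lemma asymptotic_trans c c' c'' : geodesic_ray X d c ->
  geodesic_ray X d c' -> geodesic_ray X d c'' ->
  asymptotic d c c' -> asymptotic d c' c'' -> asymptotic d c c''.
Proof.
move=> [cP _] [cP' _] [cP'' _] [K hK] [K' hK']; exists (K + K') => t t0.
have h := dist_triangle (cP t t0) (cP'' t t0) (cP' t t0).
by apply: le_trans h _; rewrite lerD ?hK ?hK'.
Qed.

Lemma asymptotic_refl c : geodesic_ray X d c -> asymptotic d c c.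
Proof. by move=> [cP _]; exists 0 => t t0; rewrite distxx//; exact: cP. Qed.

Lemma ray_class_eq c c' : geodesic_ray X d c -> geodesic_ray X d c' ->
  ray_class X d c = ray_class X d c' <-> asymptotic d c c'.
Proof.
move=> gc gc'; split=> [e|a].
  have : ray_class X d c' c' by split=> //; exact: asymptotic_refl.
  by rewrite -e => -[].
rewrite eqEsubset; split=> k [rk ak]; split=> //.
  by apply: asymptotic_trans ak => //; exact: asymptoticC.
exact: asymptotic_trans a ak.
Qed.

Lemma act_ray (g : 'M[R]_3) c : \det g = 1 ->
  geodesic_ray X d c -> geodesic_ray X d (sl_act g \o c).
Proof.
move=> dg [cP cd]; split=> [t /cP|s t s0 t0]; first exact: P3_act.
by rewrite /= dist_act// cd.
Qed.

Lemma ideal_map_class (g : 'M[R]_3) c : \det g = 1 -> geodesic_ray X d c ->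
  ideal_map X d (sl_act g) (ray_class X d c) = ray_class X d (sl_act g \o c).
Proof.
move=> dg gc; rewrite eqEsubset; split=> [k [c' [gc' [K hK]] ck]|k ck].
  suff -> : ray_class X d (sl_act g \o c) = ray_class X d (sl_act g \o c') by [].
  apply/ray_class_eq; rewrite ?act_ray//; try exact: act_ray.
  by exists K => t t0; rewrite /= dist_act// hK.
by exists c => //; split=> //; exact: asymptotic_refl.
Qed.

(** The point at infinity with direction [D] in the frame given by the columns of
    [h]. If [D] is nonincreasing it depends on the flag spanned by the columns
    only, by [ideal_point_eq]. *)
Definition ideal_point (h : 'M[R]_3) (D : 'rV[R]_3) : tits_space X d :=
  ray_class X d (ray h D).

Lemma ideal_point_eq (h h' : 'M[R]_3) (D D' : 'rV[R]_3) :
  \det h = 1 -> \det h' = 1 -> dir D -> dir D' ->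
  ideal_point h D = ideal_point h' D' <-> below (invmx h *m h') D' D.
Proof.
move=> dh dh' dD dD'; rewrite /ideal_point ray_class_eq; try exact: ray_ray.
by apply: asymptoticP => //; [case: dD|case: dD'].
Qed.

Lemma ideal_point_mem (h : 'M[R]_3) (D : 'rV[R]_3) :
  \det h = 1 -> dir D -> ideal_point h D (ray h D).
Proof.
by move=> dh dD; split; [exact: ray_ray|apply: asymptotic_refl; exact: ray_ray].
Qed.

Lemma ends_point (h : 'M[R]_3) (D : 'rV[R]_3) :
  \det h = 1 -> dir D -> ends X d X (ideal_point h D).
Proof.
move=> dh dD; exists (ray h D) => //; split; first exact: ray_ray.
by case: (ray_ray dh dD).
Qed.

Lemma class_point c : geodesic_ray X d c ->
  exists h D, [/\ \det h = 1, dir D, (forall t, 0 <= t -> c t = ray h D t)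
    & ray_class X d c = ideal_point h D].
Proof.
move=> gc; have [h [D [dh dD cE]]] := geodesic_rayP gc.
exists h, D; split=> //; apply/ray_class_eq => //; first exact: ray_ray.
have [gP _] := gc.
by exists 0 => t t0; rewrite -cE// distxx//; exact: gP.
Qed.

Lemma endsP (x : tits_space X d) : ends X d X x <->
  exists h D, [/\ \det h = 1, dir D & x = ideal_point h D].
Proof.
split=> [[c [gc _] <-]|[h [D [dh dD ->]]]]; last exact: ends_point.
by have [h [D [dh dD _ e]]] := class_point gc; exists h, D.
Qed.

Lemma ideal_map_point (g h : 'M[R]_3) (D : 'rV[R]_3) :
  \det g = 1 -> \det h = 1 -> dir D ->
  ideal_map X d (sl_act g) (ideal_point h D) = ideal_point (g *m h) D.
Proof.
by move=> dg dh dD; rewrite /ideal_point ideal_map_class//; [rewrite ray_actM|exact: ray_ray].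
Qed.

Lemma ideal_fix_point (g h : 'M[R]_3) (D : 'rV[R]_3) :
  \det g = 1 -> \det h = 1 -> dir D ->
  ideal_fix g (ideal_point h D) <-> below (invmx h *m g *m h) D D.
Proof.
move=> dg dh dD; have dgh : \det (g *m h) = 1 by rewrite det_mulmx dg dh mulr1.
rewrite /ideal_fix /fixed_ends /= ideal_map_point// -mulmxA -ideal_point_eq//.
by split=> [[]|] // ->; split=> //; exact: ends_point.
Qed.

End asymptotic_equivalence.

(** ** Exponentials of diagonal matrices *)

Lemma diag3E (R : realType) (a b c : R) : diag3 a b c = diag_mx (rv a b c).
Proof.
by apply/matrixP => i j; ord3 i; ord3 j; rewrite !mxE /= ?mulr1n ?mulr0n.
Qed.

Lemma rv_eta (R : realType) (u : 'rV[R]_3) : rv (u 0 i0) (u 0 i1) (u 0 i2) = u.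
Proof. by apply/rowP => i; ord3 i; rewrite mxE. Qed.

Lemma expmx_diag (R : realType) (u : 'rV[R]_3) : expmx (diag_mx u) = flat u.
Proof.
rewrite /expmx; apply: cvg_lim => //; apply: cvg_mx => i j.
have dX n : diag_mx u ^+ n = diag_mx (map_mx (fun x => x ^+ n) u).
  elim: n => [|n IH].
    by apply/matrixP => k l; rewrite expr0 !mxE expr0.
  rewrite exprS IH; apply/matrixP => k l.
  rewrite -[_ * _]/(diag_mx u *m _) mul_diag_mx !mxE exprS.
  by rewrite mulrnAr; case: eqP => [->|].
have e n : series (fun k => k`!%:R^-1 *: diag_mx u ^+ k) n i j =
    series (exp_coeff (u 0 i)) n *+ (i == j).
  rewrite /series /= summxE -sumrMnl; apply: eq_bigr => k _.
  rewrite dX !mxE /exp_coeff /=; case: eqP => [->|_].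
    by rewrite !mulr1n mulrC.
  by rewrite !mulr0n mulr0.
rewrite flat_entry; under eq_fun do rewrite e.
case: eqP => _; last by rewrite mulr0n; exact: cvg_cst.
exact: (is_cvg_series_exp_coeff (u 0 i)).
Qed.

Lemma a0P (R : realType) (u : 'M[R]_3) :
  a0 R u <-> exists v, tr0 v /\ u = diag_mx v.
Proof.
split=> [[a [b [c [s ->]]]]|[v [v0 ->]]].
  by exists (rv a b c); rewrite diag3E /tr0 sum3 !mxE /= s.
exists (v 0 i0), (v 0 i1), (v 0 i2).
by rewrite diag3E rv_eta; split => //; rewrite -sum3.
Qed.

Lemma F0P (R : realType) (p : 'M[R]_3) :
  F0 R p <-> exists v, tr0 v /\ p = flat v.
Proof.
split=> [[u /a0P[v [v0 ->]] <-]|[v [v0 ->]]].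
  by exists v; rewrite expmx_diag.
by exists (diag_mx v); [apply/a0P; exists v|exact: expmx_diag].
Qed.

Lemma expmx_ray (R : realType) (u : 'rV[R]_3) :
  (fun t : R => expmx (t *: diag_mx u)) = ray 1%:M u.
Proof.
apply/funext => t; rewrite /ray sl_act1 -expmx_diag; congr expmx.
by rewrite -linearZ.
Qed.

Lemma riem1_diag (R : realType) (u : 'rV[R]_3) :
  riem 1%:M (diag_mx u) (diag_mx u) = dot u u.
Proof.
rewrite /riem invmx1 mul1mx mulmx1 mulmx_diag /mxtrace; apply: eq_bigr => i _.
by rewrite !mxE eqxx mulr1n.
Qed.

Lemma norm2_eq1 (R : realType) (u : 'rV[R]_3) : norm2 u = 1 <-> dot u u = 1.
Proof.
split=> [n1|d1]; last by rewrite /norm2 d1 sqrtr1.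
by rewrite -sqr_norm2 n1 expr1n.
Qed.

(** ** The apartment at infinity of the diagonal flat *)

(** A ray in the diagonal flat is a straight line of it, and its starting point
    does not change its class. *)
Lemma A0P (R : realType) (x : tits_space (P3 R) (dist R)) :
  A0 R x <-> exists D, dir D /\ x = ideal_point 1%:M D.
Proof.
have d1 : \det (1%:M : 'M[R]_3) = 1 by exact: det1.
split=> [[c [gc cF] <-]|[D [dD ->]]]; last first.
  exists (ray 1%:M D) => //; split; first exact: ray_ray.
  move=> t _; apply/F0P; exists (t *: D).
  by rewrite /ray sl_act1; split=> //; apply: tr0Z; case: dD.
have [h [D [dh [D0 D1] cE ->]]] := class_point gc.
have /F0P[u [u0 e0]] := cF 0 (lexx _).
have /F0P[v [v0 e1]] := cF 1 ler01.
pose w := v - u; have w0 : tr0 w by apply: tr0D => //; exact: tr0N.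
have dw : dir w.
  split=> //; rewrite -dist_flat// -e0 -e1; case: gc => _ ->//.
  by rewrite sub0r normrN1.
exists w; split=> //.
pose f : 'M[R]_3 := flat (- (2^-1 *: u)).
have df : \det f = 1 by apply: det_flat; apply: tr0N; exact: tr0Z.
have fE y : sl_act f (flat y) = flat (y - u).
  rewrite sl_act_flat -opprD -scalerDl (_ : _ + _ = 1) ?scale1r; last by field.
  by rewrite addrC.
pose k := f *m h.
have kE y : sl_act k y = sl_act f (sl_act h y) by rewrite sl_actM.
have kk : k *m k^T = 1%:M.
  have : sl_act k (flat 0) = flat 0.
    rewrite kE -(scale0r D) -[sl_act h _]/(ray h D 0) -cE// e0 fE subrr.
    by rewrite scale0r.
  by rewrite flat0 /sl_act mulmx1.
have kw : flat w = sl_act k (flat D).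
  by rewrite kE -[D]scale1r -[sl_act h _]/(ray h D 1) -cE// e1 fE.
apply/ray_class_eq; try exact: ray_ray.
exists (norm2 u) => t t0; rewrite -(dist_act _ _ df).
rewrite [sl_act f (ray h D t)](_ : _ = flat (t *: w)); last first.
  by rewrite (rotation_flatZ t kk kw) kE.
rewrite /ray sl_act1 fE dist_flat.
- by rewrite addrAC subrr sub0r norm2N.
- exact: tr0Z.
- by apply: tr0D; [exact: tr0Z|exact: tr0N].
Qed.

Lemma chamber_ofP (R : realType) (P : R -> R -> R -> Prop)
    (x : tits_space (P3 R) (dist R)) :
  chamber_of P x <->
  exists D, [/\ dir D, P (D 0 i0) (D 0 i1) (D 0 i2) & x = ideal_point 1%:M D].
Proof.
have d1 : \det (1%:M : 'M[R]_3) = 1 by exact: det1.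
split=> [[/A0P[D' [dD' xE]] [u1 [u2 [u3 [[ua ur ux] Pu]]]]]|[D [dD PD ->]]].
  rewrite diag3E in ua ur ux.
  exists (rv u1 u2 u3); rewrite !mxE /=.
  have dD : dir (rv u1 u2 u3).
    have /a0P[v [v0 /matrixP e]] := ua; split.
      rewrite (_ : rv _ _ _ = v)//; apply/rowP => i.
      by have := e i i; rewrite !mxE eqxx !mulr1n.
    by apply/norm2_eq1; rewrite -riem1_diag.
  split; [exact: dD|exact: Pu|].
  rewrite expmx_ray xE in ux; have [_ a] := ux.
  by rewrite xE; apply/(ray_class_eq (ray_ray d1 dD') (ray_ray d1 dD)).
split; first by apply/A0P; exists D.
exists (D 0 i0), (D 0 i1), (D 0 i2); split=> //; rewrite diag3E rv_eta.
have [D0 D1] := dD; split.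
- by apply/a0P; exists D.
- by rewrite riem1_diag; apply/norm2_eq1.
- by rewrite expmx_ray; exact: ideal_point_mem.
Qed.

(** ** Flags *)

Definition sorted3 (R : realType) (D : 'rV[R]_3) :=
  D 0 i1 <= D 0 i0 /\ D 0 i2 <= D 0 i1.

(** The last sign makes the determinant of the transposition equal to 1. *)
Lemma ray_swap01 (R : realType) (h : 'M[R]_3) (D : 'rV[R]_3) : \det h = 1 ->
  dir D -> exists2 h', \det h' = 1 &
    dir (rv (D 0 i1) (D 0 i0) (D 0 i2)) /\
    ray h D = ray h' (rv (D 0 i1) (D 0 i0) (D 0 i2)).
Proof.
move=> dh [D0 /norm2_eq1 D1].
pose s : 'M[R]_3 := mx3 [:: [:: 0; 1; 0]; [:: 1; 0; 0]; [:: 0; 0; - 1]].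
exists (h *m s); first by rewrite det_mulmx dh det3 !mxE /=; ring.
split.
  split; first by move: D0; rewrite /tr0 !sum3 !mxE /=; lra.
  by apply/norm2_eq1; move: D1; rewrite !dot_sqr !mxE /=; lra.
apply/funext => t; rewrite /ray sl_actM; congr sl_act.
apply/matrixP => i j; rewrite sl_act_entry; ord3 i; ord3 j;
  rewrite !flat_entry !mxE /= ?mulr1n ?mulr0n; ring.
Qed.

Lemma ray_swap12 (R : realType) (h : 'M[R]_3) (D : 'rV[R]_3) : \det h = 1 ->
  dir D -> exists2 h', \det h' = 1 &
    dir (rv (D 0 i0) (D 0 i2) (D 0 i1)) /\
    ray h D = ray h' (rv (D 0 i0) (D 0 i2) (D 0 i1)).
Proof.
move=> dh [D0 /norm2_eq1 D1].
pose s : 'M[R]_3 := mx3 [:: [:: - 1; 0; 0]; [:: 0; 0; 1]; [:: 0; 1; 0]].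
exists (h *m s); first by rewrite det_mulmx dh det3 !mxE /=; ring.
split.
  split; first by move: D0; rewrite /tr0 !sum3 !mxE /=; lra.
  by apply/norm2_eq1; move: D1; rewrite !dot_sqr !mxE /=; lra.
apply/funext => t; rewrite /ray sl_actM; congr sl_act.
apply/matrixP => i j; rewrite sl_act_entry; ord3 i; ord3 j;
  rewrite !flat_entry !mxE /= ?mulr1n ?mulr0n; ring.
Qed.

Lemma ray_sorted (R : realType) (h : 'M[R]_3) (D : 'rV[R]_3) : \det h = 1 ->
  dir D -> exists h' D', [/\ \det h' = 1, dir D', sorted3 D' &
    ray h D = ray h' D'].
Proof.
have top (h1 : 'M[R]_3) (E : 'rV[R]_3) : \det h1 = 1 -> dir E ->
    exists h' D', [/\ \det h' = 1, dir D', D' 0 i1 <= D' 0 i0 &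
      ray h1 E = ray h' D' /\ D' 0 i2 = E 0 i2 ].
  move=> dh dE; have [l|/ltW l] := leP (E 0 i1) (E 0 i0); first by exists h1, E.
  have [h' dh' [dE' e]] := ray_swap01 dh dE.
  by exists h', (rv (E 0 i1) (E 0 i0) (E 0 i2)); rewrite e !mxE.
move=> dh dD.
have [h1 [D1 [dh1 dD1 s1 [-> _]]]] := top _ _ dh dD.
have [l|/ltW l] := leP (D1 0 i2) (D1 0 i1); first by exists h1, D1.
have [h2 dh2 [dD2 ->]] := ray_swap12 dh1 dD1.
have [s|/ltW s] := leP (D1 0 i2) (D1 0 i0).
  by exists h2, (rv (D1 0 i0) (D1 0 i2) (D1 0 i1)); split=> //; split; rewrite !mxE.
have [h3 dh3 [dD3 e]] := ray_swap01 dh2 dD2; rewrite !mxE /= in dD3 e.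
by exists h3, (rv (D1 0 i2) (D1 0 i0) (D1 0 i1)); split=> //; split; rewrite !mxE.
Qed.

Lemma ends_sorted (R : realType) (x : tits_space (P3 R) (dist R)) :
  ends (P3 R) (dist R) (P3 R) x ->
  exists h D, [/\ \det h = 1, dir D, sorted3 D & x = ideal_point h D].
Proof.
move=> /endsP[h [D [dh dD ->]]].
by have [h' [D' [? ? ? e]]] := ray_sorted dh dD; exists h', D'; rewrite /ideal_point e.
Qed.

(** For a nonincreasing direction, the matrices that are bounded under conjugation
    form the parabolic subgroup of the flag that the direction singles out. *)
Lemma below_sorted (R : realType) (m : 'M[R]_3) (D : 'rV[R]_3) : sorted3 D ->
  below m D D <-> (D 0 i1 < D 0 i0 -> m i1 i0 = 0 /\ m i2 i0 = 0) /\
                  (D 0 i2 < D 0 i1 -> m i2 i0 = 0 /\ m i2 i1 = 0).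
Proof.
move=> [s1 s2]; split=> [b|[b1 b2]].
  have z i j : D 0 i < D 0 j -> m i j = 0.
    move=> lt; apply/eqP; apply: contraTT lt => mij; rewrite -leNgt.
    exact: b.
  split=> lt; split; apply: z => //; lra.
move=> i j; ord3 i; ord3 j => mij //; rewrite ?(le_trans s2)// leNgt;
  apply: contraNN mij => lt; apply/eqP.
- by case: (b1 lt).
- have [/b1[_ //]|n1] := ltP (D 0 i1) (D 0 i0).
  by have [|//] := b2; lra.
- by case: (b2 lt).
Qed.

Lemma mulVmx_entry (R : realType) (h : 'M[R]_3) i j : \det h = 1 ->
  invmx h i i0 * h i0 j + invmx h i i1 * h i1 j + invmx h i i2 * h i2 j =
  (i == j)%:R.
Proof.
move=> dh; have := mulVmx (unitmx_det1 dh) => /matrixP/(_ i j).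
by rewrite !mxE sum3.
Qed.

Lemma mulmxV_entry (R : realType) (h : 'M[R]_3) i j : \det h = 1 ->
  h i i0 * invmx h i0 j + h i i1 * invmx h i1 j + h i i2 * invmx h i2 j =
  (i == j)%:R.
Proof.
move=> dh; have := mulmxV (unitmx_det1 dh) => /matrixP/(_ i j).
by rewrite !mxE sum3.
Qed.

Lemma col_mulmx (R : pzRingType) m n p (A : 'M[R]_(m, n)) (B : 'M[R]_(n, p)) i :
  col i (A *m B) = A *m col i B.
Proof. by rewrite !colE mulmxA. Qed.

(** [g] fixes a point at infinity when it preserves the line spanned by the
    first vector of the frame, if the direction singles it out, and the plane
    spanned by the first two, if the direction singles that out. *)
Lemma ideal_fix_flag (R : realType) (g h : 'M[R]_3) (D : 'rV[R]_3) :
  \det g = 1 -> \det h = 1 -> dir D -> sorted3 D ->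
  ideal_fix g (ideal_point h D) <->
  (D 0 i1 < D 0 i0 -> exists a, g *m col i0 h = a *: col i0 h) /\
  (D 0 i2 < D 0 i1 -> exists a, row i2 (invmx h) *m g = a *: row i2 (invmx h)).
Proof.
move=> dg dh dD sD; rewrite ideal_fix_point// below_sorted//.
have uh := unitmx_det1 dh.
have [m mE] : exists m, m = invmx h *m g *m h by eexists.
rewrite -mE.
have mh : h *m m = g *m h by rewrite mE !mulmxA mulmxV// mul1mx.
have hm : m *m invmx h = invmx h *m g by rewrite mE mulmxK.
have cE : m i1 i0 = 0 /\ m i2 i0 = 0 <-> exists a, g *m col i0 h = a *: col i0 h.
  split=> [[m1 m2]|[a e]].
    exists (m i0 i0); rewrite -col_mulmx -mh; apply/colP => i.
    by rewrite !mxE sum3 m1 m2 !mulr0 !addr0 mulrC.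
  have {}e : col i0 m = a *: col i0 1%:M.
    by rewrite mE -mulmxA !col_mulmx e -scalemxAr -col_mulmx mulVmx.
  have e1 := congr1 (fun M : 'cV[R]_3 => M i1 0) e.
  have e2 := congr1 (fun M : 'cV[R]_3 => M i2 0) e.
  by move: e1 e2; rewrite !mxE /= !mulr0.
have rE : m i2 i0 = 0 /\ m i2 i1 = 0 <->
    exists a, row i2 (invmx h) *m g = a *: row i2 (invmx h).
  split=> [[m1 m2]|[a e]].
    exists (m i2 i2); rewrite -row_mul -hm; apply/rowP => i.
    by rewrite !mxE sum3 m1 m2 !mul0r !add0r.
  have {}e : row i2 m = a *: row i2 1%:M.
    by rewrite mE !row_mul e -scalemxAl -row_mul mulVmx.
  have e1 := congr1 (fun M : 'rV[R]_3 => M 0 i0) e.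
  have e2 := congr1 (fun M : 'rV[R]_3 => M 0 i1) e.
  by move: e1 e2; rewrite !mxE /= !mulr0.
by rewrite cE rE.
Qed.

Definition place (R : realType) (a b : 'I_3) (D : 'rV[R]_3) : 'rV[R]_3 :=
  \row_i (if i == a then D 0 i0 else if i == b then D 0 i1 else D 0 i2).

Lemma dir_place (R : realType) (a b c : 'I_3) (D : 'rV[R]_3) :
  uniq [:: a; b; c] -> dir D -> dir (place a b D).
Proof.
move=> u [D0 /norm2_eq1 D1]; split; last apply/norm2_eq1.
  by move: D0 u; rewrite /tr0 !sum3; ord3 a; ord3 b; ord3 c; rewrite //= !mxE /=; lra.
by move: D1 u; rewrite !dot_sqr; ord3 a; ord3 b; ord3 c; rewrite //= !mxE /=; lra.
Qed.

Lemma invmx_row_coordinate (R : realType) (h : 'M[R]_3) (c : 'I_3) :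
  \det h = 1 -> (forall j, j != c -> invmx h i2 j = 0) ->
  [/\ invmx h i2 c != 0, h c i0 = 0 & h c i1 = 0].
Proof.
move=> dh hc.
have e k : invmx h i2 c * h c k = (i2 == k)%:R.
  rewrite -(mulVmx_entry i2 k dh).
  move: hc; ord3 c => hc.
  - by rewrite (hc i1)// (hc i2)// !mul0r !addr0.
  - by rewrite (hc i0)// (hc i2)// !mul0r addr0 add0r.
  - by rewrite (hc i0)// (hc i1)// !mul0r !add0r.
have n : invmx h i2 c != 0.
  by apply/eqP => z; have /eqP := e i2; rewrite z mul0r eq_sym oner_eq0.
split=> //; apply/eqP.
  by have /eqP := e i0; rewrite /= mulf_eq0 (negbTE n).
by have /eqP := e i1; rewrite /= mulf_eq0 (negbTE n).
Qed.

Lemma third_index (a c : 'I_3) : a != c -> exists b, uniq [:: a; b; c].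
Proof.
by ord3 a; ord3 c => // _; ((by exists i0) || (by exists i1) || (by exists i2)).
Qed.

(** If the line and the plane of the flag are spanned by coordinate axes, then the
    point at infinity lies in the apartment of the diagonal flat. *)
Lemma coordinate_frame (R : realType) (h : 'M[R]_3) (D : 'rV[R]_3) :
  \det h = 1 -> dir D -> sorted3 D ->
  (D 0 i1 < D 0 i0 -> exists a, forall i, i != a -> h i i0 = 0) ->
  (D 0 i2 < D 0 i1 -> exists c, forall j, j != c -> invmx h i2 j = 0) ->
  exists D', dir D' /\ ideal_point h D = ideal_point 1%:M D'.
Proof.
move=> dh dD [s1 s2] hA hC.
suff [a [b [c [u A C]]]] : exists a b c, [/\ uniq [:: a; b; c],
    D 0 i1 < D 0 i0 -> forall i, i != a -> h i i0 = 0 &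
    D 0 i2 < D 0 i1 -> h c i0 = 0 /\ h c i1 = 0].
  exists (place a b D); split; first exact: dir_place u dD.
  apply/esym/ideal_point_eq => //; rewrite ?det1//; first exact: dir_place u dD.
  rewrite invmx1 mul1mx => i j; rewrite mxE.
  have [->|ia] := eqVneq i a; first by ord3 j; lra.
  have [->|ib] := eqVneq i b.
    ord3 j => // hb; rewrite leNgt; apply: contraNN hb => lt.
    by rewrite A// (eq_sym b); move: u; rewrite /= !inE negb_or => /andP[/andP[]].
  have -> : i = c by apply/eqP; move: u ia ib; ord3 i; ord3 a; ord3 b; ord3 c.
  ord3 j => // hc; rewrite leNgt; apply: contraNN hc => lt.
    have [/C[-> //]|n] := ltP (D 0 i2) (D 0 i1).
    rewrite A//; first by lra.
    by move: u; ord3 a; ord3 b; ord3 c.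
  by have [_ ->] := C lt.
have hC' : D 0 i2 < D 0 i1 -> exists c, [/\ forall j, j != c -> invmx h i2 j = 0,
    invmx h i2 c != 0, h c i0 = 0 & h c i1 = 0].
  move=> /hC[c hc]; exists c; by have [] := invmx_row_coordinate dh hc.
have [l1|n1] := ltP (D 0 i1) (D 0 i0); have [l2|n2] := ltP (D 0 i2) (D 0 i1).
- have [a ha] := hA l1; have [c [hc c0 z0 z1]] := hC' l2.
  have ac : a != c.
    apply/eqP => e; have := mulVmx_entry i0 i0 dh.
    have z i : h i i0 = 0.
      by have [->|ia] := eqVneq i a; [rewrite e|exact: ha].
    by rewrite !z !mulr0 !addr0 /= => /eqP; rewrite eq_sym oner_eq0.
  by have [b u] := third_index ac; exists a, b, c.
- have [a ha] := hA l1.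
  have [c ac] : exists c : 'I_3, a != c.
    by ord3 a; [exists i1|exists i0|exists i0].
  have [b u] := third_index ac; exists a, b, c; split=> // lt; lra.
- have [c [hc c0 z0 z1]] := hC' l2.
  have [a ac] : exists a : 'I_3, a != c.
    by ord3 c; [exists i1|exists i0|exists i0].
  have [b u] := third_index ac; exists a, b, c; split=> // lt; lra.
- exists i0, i1, i2; split=> // lt; lra.
Qed.

Definition eigencol (R : realType) (g : 'M[R]_3) (x : 'cV[R]_3) :=
  x != 0 /\ exists a, g *m x = a *: x.

(** The kernel of an eigenrow is an invariant plane. *)
Definition eigenrow (R : realType) (g : 'M[R]_3) (y : 'rV[R]_3) :=
  y != 0 /\ exists a, y *m g = a *: y.

Lemma col_neq0 (R : realType) (h : 'M[R]_3) i : \det h = 1 -> col i h != 0.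
Proof.
move=> dh; apply/eqP => e; have := mulVmx_entry i i dh.
have z k : h k i = 0 by have := congr1 (fun M : 'cV[R]_3 => M k 0) e; rewrite !mxE.
by rewrite !z !mulr0 !addr0 eqxx => /eqP; rewrite eq_sym oner_eq0.
Qed.

Lemma row_neq0 (R : realType) (h : 'M[R]_3) i : \det h = 1 -> row i h != 0.
Proof.
move=> dh; apply/eqP => e; have := mulmxV_entry i i dh.
have z k : h i k = 0 by have := congr1 (fun M : 'rV[R]_3 => M 0 k) e; rewrite !mxE.
by rewrite !z !mul0r !addr0 eqxx => /eqP; rewrite eq_sym oner_eq0.
Qed.

Lemma ideal_fix_sorted (R : realType) (g : 'M[R]_3)
    (x : tits_space (P3 R) (dist R)) : \det g = 1 -> ideal_fix g x ->
  exists h D, [/\ \det h = 1, dir D, sorted3 D, x = ideal_point h D &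
   (D 0 i1 < D 0 i0 -> eigencol g (col i0 h)) /\
   (D 0 i2 < D 0 i1 -> eigenrow g (row i2 (invmx h)))].
Proof.
move=> dg fx; have [/ends_sorted[h [D [dh dD sD xE]]] _] := fx.
exists h, D; rewrite xE in fx; have [c r] := (ideal_fix_flag dg dh dD sD).1 fx.
split=> //; split=> lt; split; [exact: col_neq0|exact: c| |exact: r].
by apply: row_neq0; exact: det_inv1.
Qed.

(** If [g] preserves no line other than a coordinate axis and no plane other than
    a coordinate plane, then its fixed points at infinity are those of the
    diagonal flat whose direction is compatible with the entries of [g]. *)
Lemma ideal_fix_coordinate (R : realType) (g : 'M[R]_3) : \det g = 1 ->
  (forall x, eigencol g x -> exists a, forall i, i != a -> x i 0 = 0) ->
  (forall y, eigenrow g y -> exists c, forall j, j != c -> y 0 j = 0) ->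
  ideal_fix g = [set x | exists D, [/\ dir D, below g D D & x = ideal_point 1%:M D]].
Proof.
move=> dg hc hr; have d1 : \det (1%:M : 'M[R]_3) = 1 by exact: det1.
have fix1 D : dir D -> ideal_fix g (ideal_point 1%:M D) <-> below g D D.
  by move=> dD; rewrite ideal_fix_point// invmx1 mul1mx mulmx1.
rewrite eqEsubset; split=> x; last by move=> [D [dD b ->]]; apply/fix1.
move=> fx; have [h [D [dh dD sD xE [ec er]]]] := ideal_fix_sorted dg fx.
have [||D' [dD' e]] := coordinate_frame dh dD sD.
- move=> /ec/hc[a ha]; exists a => i /ha; by rewrite mxE.
- move=> /er/hr[c hc']; exists c => i /hc'; by rewrite mxE.
exists D'; split=> //; last by rewrite xE.
by apply/fix1 => //; rewrite -e -xE.
Qed.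

(** * Displacements *)

Section displacement.
Variable R : realType.
Notation d := (dist R).
Notation X := (P3 R).
Implicit Types g p q : 'M[R]_3.

Lemma displacement_eq g (L : R) :
  (forall p, X p -> L <= d p (sl_act g p)) ->
  (forall e, 0 < e -> exists2 p, X p & d p (sl_act g p) <= L + e) ->
  displacement X d (sl_act g) = L.
Proof.
move=> lb ub; apply/eqP; rewrite eq_le; apply/andP; split.
  apply/ler_addgt0Pr => e /ub[p Xp h]; apply: le_trans h.
  by apply: inf_lbound; [exists L => _ [q Xq <-]; exact: lb|exists p].
apply: lb_le_inf; last by move=> _ [p Xp <-]; exact: lb.
by have [p Xp _] := ub 1 ltr01; exists (d p (sl_act g p)), p.
Qed.

Lemma displacement_min g (L : R) q :
  (forall p, X p -> L <= d p (sl_act g p)) ->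
  X q -> d q (sl_act g q) = L -> displacement X d (sl_act g) = L.
Proof.
move=> lb Xq e; apply: displacement_eq => // r r0; exists q => //.
by rewrite e lerDl ltW.
Qed.

(** If [g^2] moves every point by at least twice the minimal displacement of [g],
    the triangle inequality is an equality along the orbit of a minimal point. *)
Lemma commuting_of_min g (L : R) p : \det g = 1 ->
  (forall p, X p -> 2 * L <= d p (sl_act g (sl_act g p))) ->
  X p -> d p (sl_act g p) = L ->
  exists Q, sl_act g p = Q *m p /\ Q *m g = g *m Q.
Proof.
move=> dg lb Xp e; apply: commuting_translation => //.
apply/eqP; rewrite eq_le e lb// andbT.
have Xg := P3_act dg Xp; have Xgg := P3_act dg Xg.
by apply: le_trans (dist_triangle Xp Xgg Xg) _; rewrite dist_act// e; lra.
Qed.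

(** A fixed point gives [Q = 1], and an axis gives the transvection along it. *)
Lemma parabolic_of_no_translation g : \det g = 1 ->
  (forall p Q, X p -> sl_act g p = Q *m p -> Q *m g = g *m Q -> False) ->
  parabolic X d (sl_act g).
Proof.
move=> dg no; split=> [[p [Xp gp]]|[c [[cX cd] [l l0 cl]]]].
  by apply: (no p 1%:M); rewrite ?mul1mx ?mulmx1.
have [Q [e1 e2]] : exists Q, sl_act g (c 0) = Q *m c 0 /\ Q *m g = g *m Q.
  apply: commuting_translation => //.
  by rewrite !cl !cd !add0r !normrN -mulr2n normrMn mulr_natl.
exact: no e1 e2.
Qed.

Lemma hyperbolic_of_line g (h : 'M[R]_3) (D : 'rV[R]_3) (l : R) :
  \det h = 1 -> dir D -> l != 0 ->
  (forall t, sl_act g (ray h D t) = ray h D (t + l)) ->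
  hyperbolic X d (sl_act g).
Proof.
by move=> dh dD l0 gl; exists (ray h D); split; [exact: ray_line|exists l].
Qed.

(** ** Triangular isometries *)

(** The translation part of a triangular isometry: it moves the horospherical
    projection by this vector. *)
Definition log2 g : 'rV[R]_3 := \row_i ln (g i i ^+ 2).

Lemma le_dist_upper g p : upper g -> \det g = 1 -> X p ->
  norm2 (log2 g) <= d p (sl_act g p).
Proof.
move=> ug dg Xp; apply: le_trans (iwasawa_lipschitz Xp (P3_act dg Xp)).
by rewrite iwasawa_act// addrC addKr.
Qed.

Lemma upperM g h : upper g -> upper h ->
  upper (g *m h) /\ forall i, (g *m h) i i = g i i * h i i.
Proof.
move=> [g10 g20 g21] [h10 h20 h21]; split.
  by split; rewrite mxE sum3 ?g10 ?g20 ?g21 ?h10 ?h20 ?h21 !(mul0r, mulr0, addr0).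
by move=> i; ord3 i; rewrite mxE sum3 ?g10 ?g20 ?g21 ?h10 ?h20 ?h21
  !(mul0r, mulr0, addr0, add0r).
Qed.

Lemma upper_diag_neq0 g i : upper g -> \det g = 1 -> g i i != 0.
Proof.
move=> ug dg; have := det_upper ug; rewrite dg => /esym e.
by apply/eqP; ord3 i => z; move/eqP: e; rewrite z !(mul0r, mulr0) eq_sym oner_eq0.
Qed.

Lemma le_dist_upper2 g p : upper g -> \det g = 1 -> X p ->
  2 * norm2 (log2 g) <= d p (sl_act g (sl_act g p)).
Proof.
move=> ug dg Xp; have [ugg e] := upperM ug ug.
have dgg : \det (g *m g) = 1 by rewrite det_mulmx dg mulr1.
have -> : 2 * norm2 (log2 g) = norm2 (log2 (g *m g)).
  have -> : log2 (g *m g) = 2 *: log2 g.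
    apply/rowP => i; rewrite [LHS]mxE e [RHS]mxE [X in _ = _ * X]mxE exprMn.
    rewrite lnM ?posrE ?exprn_even_gt0//=.
    - by ring.
    - exact: upper_diag_neq0.
    - exact: upper_diag_neq0.
  by rewrite norm2Z ger0_norm.
by rewrite -sl_actM; exact: le_dist_upper.
Qed.

Lemma tr0_log2 g : upper g -> \det g = 1 -> tr0 (log2 g).
Proof.
move=> ug dg; have := det_upper ug; rewrite dg => e.
have n i : 0 < g i i ^+ 2 by rewrite exprn_even_gt0//= upper_diag_neq0.
have n01 := mulr_gt0 (n i0) (n i1).
rewrite /tr0 sum3 !mxE -lnM ?posrE// -lnM ?posrE//.
by rewrite -!exprMn -e expr1n ln1.
Qed.

(** The constant 5 comes from [sqr_dist_le], the trace exceeding 6 by at most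
    [5 e^2] in all. *)
Lemma dist_unipotent_le (x y e : R) : `|x| <= e -> `|y| <= e -> e <= 1 ->
  d 1%:M (sl_act (mx3 [:: [:: 1; x; 0]; [:: 0; 1; y]; [:: 0; 0; 1]]) 1%:M) <=
  5 * e.
Proof.
move=> xe ye e1; set u := mx3 _.
have du : \det u = 1 by rewrite det3 !mxE /=; ring.
have Pu := P3_act du (P3_1 R).
have e0 : 0 <= e by apply: le_trans xe.
have x2 : x ^+ 2 <= e ^+ 2 by rewrite -(real_normK (num_real x)) ler_pXn2r ?nnegrE.
have y2 : y ^+ 2 <= e ^+ 2 by rewrite -(real_normK (num_real y)) ler_pXn2r ?nnegrE.
have t1 : trd 1%:M (sl_act u 1%:M) = 3 + x ^+ 2 + y ^+ 2.
  rewrite /trd invmx1 mul1mx /mxtrace sum3 !sl_act_entry !mxE /=; ring.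
have t2 : trd (sl_act u 1%:M) 1%:M = 3 + x ^+ 2 + y ^+ 2 + x ^+ 2 * y ^+ 2.
  rewrite /trd mulmx1 invmx_act ?det1// invmx1 mulmx1 invmx3//.
  by rewrite /mxtrace sum3 !mulmx_entry !mxE /=; ring.
apply: le_of_sqr_le; rewrite ?dist_ge0 ?mulr_ge0//; first exact: P3_1.
apply: le_trans (sqr_dist_le (P3_1 R) Pu) _; rewrite t1 t2.
have x0 := sqr_ge0 x; have y0 := sqr_ge0 y.
have e4 : x ^+ 2 * y ^+ 2 <= e ^+ 2.
  apply: le_trans (_ : e ^+ 2 * 1 <= _); last by rewrite mulr1.
  rewrite ler_pM//; apply: le_trans y2 _; rewrite expr_le1//.
nra.
Qed.

(** The horospherical projection gives the lower bound. Conjugation by diagonal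
    matrices makes the unipotent part of [g] tend to the identity, while its
    diagonal part moves the base point by [norm2 (log2 g)]. *)
Lemma displacement_upper g : upper g -> \det g = 1 -> g i0 i2 = 0 ->
  displacement X d (sl_act g) = norm2 (log2 g).
Proof.
move=> ug dg g02; apply: displacement_eq => [p|e e0]; first exact: le_dist_upper.
have [g10 g20 g21] := ug.
have n0 := upper_diag_neq0 i0 ug dg; have n1 := upper_diag_neq0 i1 ug dg.
have n2 := upper_diag_neq0 i2 ug dg.
pose x := g i0 i1 / g i0 i0; pose y := g i1 i2 / g i1 i1.
pose M := 1 + `|x| + `|y|.
have M0 : 0 < M by rewrite /M; have := normr_ge0 x; have := normr_ge0 y; lra.
pose r := Num.min 1 (e / 5).
have r0 : 0 < r by rewrite lt_min ltr01 divr_gt0.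
have r1 : r <= 1 by rewrite ge_min lexx.
have re : 5 * r <= e by rewrite mulrC -ler_pdivlMr// ge_min lexx orbT.
(* Conjugation by [flat D] multiplies the entries next to the diagonal by [k]. *)
pose k := r / M; have k0 : 0 < k by rewrite divr_gt0.
have kM z : `|z| <= M -> `|z * k| <= r.
  by move=> zM; rewrite normrM (gtr0_norm k0) /k mulrCA ger_pMr// ler_pdivrMr// mul1r.
pose D : 'rV[R]_3 := rv (- ln k) 0 (ln k).
have D0 : tr0 D by rewrite /tr0 sum3 !mxE /=; ring.
have df := det_flat D0; have df' := det_inv1 df.
exists (sl_act (flat D) 1%:M); first by apply: P3_act => //; exact: P3_1.
pose u : 'M[R]_3 := mx3 [:: [:: 1; x * k; 0]; [:: 0; 1; y * k]; [:: 0; 0; 1]].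
pose f : 'M[R]_3 := diag_mx (\row_i g i i).
have fdet : \det f = 1.
  by rewrite -[RHS]dg (det_upper ug) det3 !mxE /= ?mulr1n ?mulr0n; ring.
have udet : \det u = 1 by rewrite det3 !mxE /=; ring.
have mE : invmx (flat D) *m g *m flat D = f *m u.
  rewrite invmx_flat /flat mul_diag_mx mul_mx_diag /f mul_diag_mx.
  have ek : expR (ln k) = k by rewrite lnK.
  have kN : k != 0 by rewrite gt_eqF.
  apply/matrixP => i j; ord3 i; ord3 j;
    rewrite !mxE /= ?opprK ?oppr0 ?expR0 ?expRN ?ek ?g10 ?g20 ?g21 ?g02 /x /y;
    by field; rewrite ?n0 ?n1 ?kN.
have -> : d (sl_act (flat D) 1%:M) (sl_act g (sl_act (flat D) 1%:M)) =
    d 1%:M (sl_act f (sl_act u 1%:M)).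
  rewrite -(dist_act _ _ df') -[in RHS]sl_actM -mE sl_actK//.
  by rewrite -!sl_actM.
have X1 := P3_1 R; have Xf := P3_act fdet X1; have Xu := P3_act udet X1.
apply: le_trans (dist_triangle X1 (P3_act fdet Xu) Xf) _; rewrite lerD//.
  have -> : sl_act f 1%:M = flat (log2 g).
    rewrite /sl_act mulmx1 tr_diag_mx mulmx_diag; congr diag_mx.
    apply/rowP => i; rewrite !mxE -expr2 lnK// posrE exprn_even_gt0//=.
    exact: upper_diag_neq0.
  by rewrite -flat0 dist_flat ?subr0//; [exact: tr0_0|exact: tr0_log2].
rewrite dist_act//; apply: le_trans re; apply: dist_unipotent_le => //;
  apply: kM; rewrite /M; have := normr_ge0 x; have := normr_ge0 y; lra.
Qed.

End displacement.

(** * The classification *)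

Lemma eigencol_entry (R : realType) (g : 'M[R]_3) x : eigencol g x ->
  exists a, forall i, g i i0 * x i0 0 + g i i1 * x i1 0 + g i i2 * x i2 0 =
    a * x i 0.
Proof.
move=> [_ [a e]]; exists a => i.
by have := congr1 (fun M : 'cV[R]_3 => M i 0) e; rewrite !mxE sum3.
Qed.

Lemma eigenrow_entry (R : realType) (g : 'M[R]_3) y : eigenrow g y ->
  exists a, forall j, y 0 i0 * g i0 j + y 0 i1 * g i1 j + y 0 i2 * g i2 j =
    a * y 0 j.
Proof.
move=> [_ [a e]]; exists a => j.
by have := congr1 (fun M : 'rV[R]_3 => M 0 j) e; rewrite !mxE sum3.
Qed.

Lemma scale_neq (R : realType) (a b x : R) : a != b -> b * x = a * x -> x = 0.
Proof.
move=> ab /eqP; rewrite -subr_eq0 -mulrBl mulf_eq0 subr_eq0 eq_sym (negbTE ab).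
by move=> /eqP.
Qed.

(** By the shape of its third row, [Q] multiplies the third row of [p] by a
    constant, which is [a^2] since [g] multiplies [p_22] by [a^2]. But the Jordan
    block adds [a p_22] to the entry next to it. *)
Lemma parabolic_of_jordan_block (R : realType) (g : 'M[R]_3) (a : R) :
  upper g -> \det g = 1 -> g i1 i1 = a -> g i2 i2 = a -> g i1 i2 = 1 ->
  (forall Q, Q *m g = g *m Q -> Q i2 i0 = 0 /\ Q i2 i1 = 0) ->
  parabolic (P3 R) (dist R) (sl_act g).
Proof.
move=> ug dg g11 g22 g12 hQ; apply: parabolic_of_no_translation => // p Q Pp e c.
have [Q0 Q1] := hQ Q c; have [h10 h20 h21] := ug.
have p22 := P3_22_gt0 Pp.
have aN : a != 0 by rewrite -g22 upper_diag_neq0.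
have e2 := congr1 (fun M : 'M[R]_3 => M i2 i2) e.
have e1 := congr1 (fun M : 'M[R]_3 => M i2 i1) e.
move: e1 e2; rewrite !sl_act_entry !mulmx_entry h10 h20 h21 g11 g22 g12 Q0 Q1.
rewrite !(mul0r, mulr0, add0r, addr0, mulr1) => e1 e2.
have q : Q i2 i2 = a * a by apply/(mulIf (lt0r_neq0 p22)).
move/eqP: e1; rewrite q -subr_eq0 (_ : _ - _ = a * p i2 i2); last by ring.
by rewrite mulf_eq0 (negbTE aN) (gt_eqF p22).
Qed.

Lemma cube_eq1 (R : realType) (a : R) : a ^+ 3 = 1 -> a = 1.
Proof.
move=> e; have : (a - 1) * (a ^+ 2 + a + 1) = 0.
  by rewrite (_ : (a - 1) * _ = a ^+ 3 - 1); [rewrite e subrr|ring].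
move/eqP; rewrite mulf_eq0 => /orP[|/eqP h]; first by rewrite subr_eq0 => /eqP.
have := sqr_ge0 (a + 2^-1); nra.
Qed.

Lemma inv_sqr_neq (R : realType) (a : R) : a != 0 -> a != 1 -> 1 / a ^+ 2 != a.
Proof.
move=> a0; apply: contraNneq => e; apply/eqP/cube_eq1.
by rewrite exprS -[X in X * _]e div1r mulVf// expf_neq0.
Qed.

Lemma ln_sqr (R : realType) (a : R) : ln (a ^+ 2) = 2 * ln `|a|.
Proof.
have [->|a0] := eqVneq a 0; first by rewrite normr0 expr0n /= ln0// mulr0.
by rewrite -(real_normK (num_real a)) lnXn ?normr_gt0// mulr_natl.
Qed.

Lemma log2E (R : realType) (g : 'M[R]_3) :
  log2 g = rv (2 * ln `|g i0 i0|) (2 * ln `|g i1 i1|) (2 * ln `|g i2 i2|).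
Proof. by apply/rowP => i; ord3 i; rewrite !mxE /= ln_sqr. Qed.

Lemma norm2_log2 (R : realType) (g : 'M[R]_3) : norm2 (log2 g) =
  2 * Num.sqrt (ln `|g i0 i0| ^+ 2 + ln `|g i1 i1| ^+ 2 + ln `|g i2 i2| ^+ 2).
Proof.
rewrite log2E (_ : rv _ _ _ =
    2 *: rv (ln `|g i0 i0|) (ln `|g i1 i1|) (ln `|g i2 i2|)); last first.
  by apply/rowP => i; ord3 i; rewrite !mxE.
by rewrite norm2Z ger0_norm// /norm2 dot_sqr !mxE.
Qed.

Lemma norm2_log2_eq (R : realType) (g : 'M[R]_3) (a : R) : a != 0 ->
  ln `|g i0 i0| ^+ 2 + ln `|g i1 i1| ^+ 2 + ln `|g i2 i2| ^+ 2 =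
    6 * ln `|a| ^+ 2 ->
  norm2 (log2 g) = 2 * Num.sqrt 6 * `|ln `|a| |.
Proof. by move=> a0 e; rewrite norm2_log2 e sqrtrM// sqrtr_sqr mulrA. Qed.

Lemma ln_inv_sqr (R : realType) (a : R) : a != 0 ->
  ln `|1 / a ^+ 2| = - 2 * ln `|a|.
Proof.
move=> a0; rewrite div1r normfV lnV ?posrE ?normr_gt0 ?expf_neq0//.
by rewrite normrX lnXn ?normr_gt0// mulNr mulr_natl.
Qed.

(** ** Isometries with a Jordan block *)

Section regular_unipotent.
Variable R : realType.
Notation X := (P3 R).
Notation d := (dist R).

Lemma classify_regular_unipotent :
  let g := mx3 [:: [:: 1; 1; 0]; [:: 0; 1; 1]; [:: 0; 0; 1]] in
  [/\ parabolic X d (sl_act g), ideal_fix g = chamber R 1 &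
      displacement X d (sl_act g) = 0].
Proof.
move=> g; have ug : upper g by split; rewrite mxE.
have dg : \det g = 1 by rewrite (det_upper ug) !mxE /=; ring.
split.
- apply: (parabolic_of_jordan_block (a := 1)) => //; rewrite ?mxE// => Q e.
  have e1 := congr1 (fun M : 'M[R]_3 => M i2 i1) e.
  have e2 := congr1 (fun M : 'M[R]_3 => M i2 i2) e.
  by move: e1 e2; rewrite !mulmx_entry !mxE /=; split; lra.
- rewrite ideal_fix_coordinate//.
  + rewrite eqEsubset; split=> x.
      move=> [D [dD b ->]]; apply/chamber_ofP; exists D; split=> //.
      by have := b i0 i1; have := b i1 i2; rewrite !mxE /= oner_eq0 => -> // ->.
    move=> /chamber_ofP[D [dD [D1 D2] ->]]; exists D; split=> // i j.
    by ord3 i; ord3 j; rewrite mxE /= ?eqxx//; lra.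
  + move=> x /eigencol_entry[a e]; exists i0.
    have := e i0; have := e i1; have := e i2; rewrite !mxE /= => e2 e1 e0.
    have x2 : x i2 0 = 0.
      have [a1|a1] := eqVneq a 1; first by move: e1; rewrite a1; lra.
      by apply: (scale_neq a1); lra.
    have x1 : x i1 0 = 0.
      have [a1|a1] := eqVneq a 1; first by move: e0; rewrite a1; lra.
      by apply: (scale_neq a1); lra.
    by move=> i; ord3 i.
  + move=> y /eigenrow_entry[a e]; exists i2.
    have := e i0; have := e i1; have := e i2; rewrite !mxE /= => e2 e1 e0.
    have y0 : y 0 i0 = 0.
      have [a1|a1] := eqVneq a 1; first by move: e1; rewrite a1; lra.
      by apply: (scale_neq a1); lra.
    have y1 : y 0 i1 = 0.
      have [a1|a1] := eqVneq a 1; first by move: e2; rewrite a1; lra.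
      by apply: (scale_neq a1); lra.
    by move=> i; ord3 i.
- rewrite displacement_upper// ?mxE// norm2_log2 !mxE /= normr1 ln1 expr0n /=.
  by rewrite !addr0 sqrtr0 mulr0.
Qed.
End regular_unipotent.

Section real_eigenvalues.
Variable R : realType.
Notation X := (P3 R).
Notation d := (dist R).

Lemma classify_split_jordan_block (a : R) : a != 0 -> a != 1 ->
  let g := mx3 [:: [:: 1 / a ^+ 2; 0; 0]; [:: 0; a; 1]; [:: 0; 0; a]] in
  [/\ parabolic X d (sl_act g),
      ideal_fix g = chamber R 1 `|` chamber R 2 `|` chamber R 3 &
      displacement X d (sl_act g) = 2 * Num.sqrt 6 * `|ln `|a| |].
Proof.
move=> a0 a1 g; have aa := inv_sqr_neq a0 a1.
have ug : upper g by split; rewrite mxE.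
have dg : \det g = 1 by rewrite (det_upper ug) !mxE /=; field.
split.
- apply: (parabolic_of_jordan_block (a := a)) => //; rewrite ?mxE// => Q e.
  have e0 := congr1 (fun M : 'M[R]_3 => M i2 i0) e.
  have e2 := congr1 (fun M : 'M[R]_3 => M i2 i2) e.
  move: e0 e2; rewrite !mulmx_entry !mxE /= => e0 e2.
  split; last by lra.
  by apply: (scale_neq aa); lra.
- rewrite ideal_fix_coordinate//.
  + rewrite eqEsubset; split=> x.
      move=> [D [dD b ->]].
      have := b i1 i2; rewrite !mxE /= oner_eq0 => /(_ isT) b12.
      have [b01|/ltW b01] := leP (D 0 i1) (D 0 i0).
        by left; left; apply/chamber_ofP; exists D.
      have [b02|/ltW b02] := leP (D 0 i2) (D 0 i0).
        by left; right; apply/chamber_ofP; exists D.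
      by right; apply/chamber_ofP; exists D.
    by move=> [[|]|] /chamber_ofP[D [dD [D1 D2] ->]]; exists D; split=> // i j;
      ord3 i; ord3 j; rewrite mxE /= ?eqxx//; lra.
  + move=> x /eigencol_entry[l e].
    have := e i0; have := e i1; have := e i2; rewrite !mxE /= => e2 e1 e0.
    have x2 : x i2 0 = 0.
      have [la|la] := eqVneq l a; first by move: e1; rewrite la; lra.
      by apply: (scale_neq la); lra.
    have [la|la] := eqVneq l a.
      have x0 : x i0 0 = 0 by rewrite la in e0; apply: (scale_neq aa); lra.
      by exists i1 => i; ord3 i.
    have x1 : x i1 0 = 0 by apply: (scale_neq la); lra.
    by exists i0 => i; ord3 i.
  + move=> y /eigenrow_entry[l e].
    have := e i0; have := e i1; have := e i2; rewrite !mxE /= => e2 e1 e0.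
    have y1 : y 0 i1 = 0.
      have [la|la] := eqVneq l a; first by move: e2; rewrite la; lra.
      by apply: (scale_neq la); lra.
    have [la|la] := eqVneq l a.
      have y0 : y 0 i0 = 0 by rewrite la in e0; apply: (scale_neq aa); lra.
      by exists i2 => i; ord3 i.
    have y2 : y 0 i2 = 0 by apply: (scale_neq la); lra.
    by exists i0 => i; ord3 i.
- rewrite displacement_upper// ?mxE//; apply: norm2_log2_eq => //.
  by rewrite !mxE /= ln_inv_sqr//; ring.
Qed.

(** ** Diagonal isometries *)

Lemma sl_act_diag_ray (g : 'M[R]_3) : upper g -> is_diag_mx g -> \det g = 1 ->
  forall u, sl_act g (flat u) = flat (log2 g + u).
Proof.
move=> ug /is_diag_mxP g0 dg u; apply/matrixP => i j.
have gE k : expR (log2 g 0 k) = g k k ^+ 2.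
  by rewrite mxE lnK// posrE exprn_even_gt0//= upper_diag_neq0.
rewrite flat_entry [X in expR X]mxE expRD gE sl_act_entry !flat_entry.
ord3 i; ord3 j; rewrite /= ?(g0 i0 i1) ?(g0 i0 i2) ?(g0 i1 i0) ?(g0 i1 i2)
  ?(g0 i2 i0) ?(g0 i2 i1)//; ring.
Qed.

Lemma diag_upper (g : 'M[R]_3) : is_diag_mx g -> upper g.
Proof. by move=> /is_diag_mxP g0; split; exact: g0. Qed.

Lemma hyperbolic_diag (g : 'M[R]_3) : is_diag_mx g -> \det g = 1 ->
  norm2 (log2 g) != 0 -> hyperbolic X d (sl_act g).
Proof.
move=> g0 dg n0; have ug := diag_upper g0.
pose l := norm2 (log2 g); have l0 : 0 < l by rewrite lt_neqAle eq_sym n0 norm2_ge0.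
have d1 : \det (1%:M : 'M[R]_3) = 1 by exact: det1.
apply: (@hyperbolic_of_line _ g 1%:M (l^-1 *: log2 g) l) => //.
  split; first by apply: tr0Z; exact: tr0_log2.
  by rewrite norm2Z gtr0_norm ?invr_gt0// mulVf.
move=> t; rewrite /ray !sl_act1 sl_act_diag_ray//; congr flat.
by rewrite scalerDl (scalerA l) mulfV// scale1r addrC.
Qed.

Lemma displacement_diag (g : 'M[R]_3) : is_diag_mx g -> \det g = 1 ->
  displacement X d (sl_act g) = norm2 (log2 g).
Proof.
move=> g0 dg; apply: displacement_upper => //; first exact: diag_upper.
by move/is_diag_mxP : g0; exact.
Qed.

Lemma min_set_diag_commuting (g p : 'M[R]_3) : is_diag_mx g -> \det g = 1 ->
  min_set X d (sl_act g) p ->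
  exists Q, sl_act g p = Q *m p /\ Q *m g = g *m Q.
Proof.
move=> g0 dg [Xp]; rewrite displacement_diag// => e; have ug := diag_upper g0.
by apply: commuting_of_min e => // q Xq; exact: le_dist_upper2.
Qed.

Lemma classify_regular_diagonal (a b c : R) :
  a != b -> b != c -> a != c -> a * b * c = 1 ->
  let g := diag3 a b c in
  [/\ hyperbolic X d (sl_act g),
      displacement X d (sl_act g) =
        2 * Num.sqrt (ln `|a| ^+ 2 + ln `|b| ^+ 2 + ln `|c| ^+ 2),
      ideal_fix g = A0 R &
      min_set X d (sl_act g) = F0 R].
Proof.
move=> ab bc ac abc g.
have g0 : is_diag_mx g.
  by apply/is_diag_mxP => i j; ord3 i; ord3 j => //= _; rewrite mxE.
have ug := diag_upper g0.
have dg : \det g = 1 by rewrite (det_upper ug) !mxE /=.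
have neq (i j : 'I_3) : i != j -> g i i != g j j.
  by ord3 i; ord3 j => //= _; rewrite !mxE //= eq_sym.
split.
- apply: hyperbolic_diag => //; apply/eqP => /norm2_eq0 z.
  have sq i : g i i ^+ 2 = 1.
    have gi : 0 < g i i ^+ 2 by rewrite exprn_even_gt0//= upper_diag_neq0.
    have := congr1 (fun u : 'rV[R]_3 => u 0 i) z; rewrite [LHS]mxE [RHS]mxE => h.
    by rewrite -[LHS]lnK ?posrE// h expR0.
  have pm i : g i i = 1 \/ g i i = -1.
    by have /eqP := sq i; rewrite sqrf_eq1 => /orP[/eqP ->|/eqP ->]; [left|right].
  have := neq i0 i1 isT; have := neq i1 i2 isT; have := neq i0 i2 isT.
  by case: (pm i0) => ->; case: (pm i1) => ->; case: (pm i2) => ->; rewrite !eqxx.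
- by rewrite displacement_diag// norm2_log2 !mxE.
- rewrite ideal_fix_coordinate//.
  + rewrite eqEsubset; split=> x; first by move=> [D [dD _ ->]]; apply/A0P; exists D.
    move=> /A0P[D [dD ->]]; exists D; split=> // i j.
    by have [->//|ij] := eqVneq i j; move/is_diag_mxP : g0 => ->//; rewrite eqxx.
  + move=> x [x0 [l e]].
    have [k xk] : exists k, x k 0 != 0.
      apply/not_existsP => z; case/eqP: x0; apply/colP => i; rewrite mxE.
      by apply/eqP; have /negP := z i; rewrite negbK.
    have e' i : g i i * x i 0 = l * x i 0.
      have := congr1 (fun M : 'cV[R]_3 => M i 0) e; rewrite [LHS]mxE [RHS]mxE => <-.
      rewrite (bigD1 i)//= big1 ?addr0// => j ji.
      by move/is_diag_mxP : g0 => ->; rewrite ?mul0r// eq_sym.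
    have lk : l = g k k by apply/esym/(mulIf xk).
    by exists k => i ik; apply: (@scale_neq _ l (g i i)) => //; rewrite lk neq// eq_sym.
  + move=> y [y0 [l e]].
    have [k yk] : exists k, y 0 k != 0.
      apply/not_existsP => z; case/eqP: y0; apply/rowP => i; rewrite mxE.
      by apply/eqP; have /negP := z i; rewrite negbK.
    have e' i : g i i * y 0 i = l * y 0 i.
      have := congr1 (fun M : 'rV[R]_3 => M 0 i) e; rewrite [LHS]mxE [RHS]mxE => <-.
      rewrite (bigD1 i)//= big1 ?addr0 ?(mulrC (g i i))// => j ji.
      by move/is_diag_mxP : g0 => ->; rewrite ?mulr0.
    have lk : l = g k k by apply/esym/(mulIf yk).
    by exists k => i ik; apply: (@scale_neq _ l (g i i)) => //; rewrite lk neq// eq_sym.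
- rewrite eqEsubset; split=> p; last first.
    move=> /F0P[v [v0 ->]]; split; first exact: P3_flat.
    rewrite displacement_diag// sl_act_diag_ray// dist_flat ?addrK//.
    by apply: tr0D => //; exact: tr0_log2.
  move=> mp; have [Xp _] := mp.
  have [Q [e cm]] := min_set_diag_commuting g0 dg mp.
  have gz := is_diag_mxP g0.
  have Q0 i j : i != j -> Q i j = 0.
    move=> ij; apply: (@scale_neq _ (g i i) (g j j)); first exact: neq.
    have := congr1 (fun M : 'M[R]_3 => M i j) cm; rewrite [LHS]mxE [RHS]mxE.
    rewrite (bigD1 j)//= [X in _ + X]big1 ?addr0; last first.
      by move=> k kj; rewrite gz ?mulr0.
    rewrite (bigD1 i)//= [X in _ = _ + X]big1 ?addr0; last first.
      by move=> k ki; rewrite gz ?mul0r// eq_sym.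
    by rewrite mulrC.
  have gp i j : sl_act g p i j = g i i * g j j * p i j.
    rewrite sl_act_entry; ord3 i; ord3 j;
    by rewrite ?(gz i0 i1) ?(gz i0 i2) ?(gz i1 i0) ?(gz i1 i2)
      ?(gz i2 i0) ?(gz i2 i1)// !(mul0r, mulr0, add0r, addr0).
  have Qp i j : (Q *m p) i j = Q i i * p i j.
    rewrite mxE (bigD1 i)//= big1 ?addr0// => k ki.
    by rewrite Q0 ?mul0r// eq_sym.
  have Qi i : Q i i = g i i * g i i.
    have := congr1 (fun M : 'M[R]_3 => M i i) e; rewrite gp Qp.
    by move/(mulIf (lt0r_neq0 (P3_diag_gt0 i Xp))).
  have p0 i j : i != j -> p i j = 0.
    move=> ij; have := congr1 (fun M : 'M[R]_3 => M i j) e; rewrite gp Qp Qi.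
    have gi := upper_diag_neq0 i ug dg.
    rewrite -!mulrA => /(mulfI gi); apply: scale_neq; exact: neq.
  have pE : p = flat (\row_i ln (p i i)).
    apply/matrixP => i j; rewrite flat_entry; have [->|/p0 ->//] := eqVneq i j.
    by rewrite [X in expR X]mxE lnK// posrE P3_diag_gt0.
  apply/F0P; eexists; split; last exact: pE.
  have [_ _ dp] := Xp; rewrite /tr0 -[LHS]expRK (big_morph _ (@expRD R) (@expR0 R)).
  rewrite -[RHS]ln1; congr ln; rewrite -[RHS]dp [in RHS]pE det_diag.
  by apply: eq_bigr => i _; rewrite [RHS]mxE.
Qed.

Lemma classify_identity : let g := 1%:M : 'M[R]_3 in
  [/\ forall p, X p -> sl_act g p = p, elliptic X (sl_act g),
      fix_set X (sl_act g) = X & ideal_fix g = ideal_boundary R].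
Proof.
move=> g; have gE p : sl_act g p = p by exact: sl_act1.
split=> //.
- by exists 1%:M; split; [exact: P3_1|exact: gE].
- by rewrite eqEsubset; split=> p; [case|].
rewrite eqEsubset; split=> x; first by case.
move=> ex; have /endsP[h [D [dh dD ->]]] := ex.
by apply/ideal_fix_point => //; rewrite ?det1// mulmx1 mulVmx ?unitmx_det1// => i j;
  rewrite !mxE; have [->//|] := eqVneq i j; rewrite ?eqxx.
Qed.

End real_eigenvalues.

(** ** The singular geodesic and its parallels *)

Definition w2v (R : realType) : 'rV[R]_3 :=
  rv (Num.sqrt 6)^-1 (Num.sqrt 6)^-1 (- 2 * (Num.sqrt 6)^-1).

Section singular.
Variable R : realType.
Notation X := (P3 R).
Notation d := (dist R).
Notation w := (w2v R).

Lemma sqrt6_gt0 : 0 < Num.sqrt 6 :> R.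
Proof. by rewrite sqrtr_gt0. Qed.

Lemma sqrt6_sqr : Num.sqrt 6 ^+ 2 = 6 :> R.
Proof. by rewrite sqr_sqrtr. Qed.

Lemma dir_w2v : dir w.
Proof.
split; first by rewrite /tr0 sum3 !mxE /=; ring.
by apply/norm2_eq1; rewrite dot_sqr !mxE /= exprMn !exprVn sqrt6_sqr; field.
Qed.

Lemma gamma0E t : gamma0 R t = ray 1%:M w t.
Proof.
rewrite -expmx_ray /gamma0; congr (expmx (_ *: _)).
rewrite /w2 diag3E; apply/matrixP => i j; ord3 i; ord3 j;
by rewrite !mxE /= ?mulr1n ?mulr0n ?mulr0 ?mulr1// mulrC.
Qed.

Lemma gamma0_flat t : gamma0 R t = flat (t *: w).
Proof. by rewrite gamma0E /ray sl_act1. Qed.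

(** Matrices that preserve the plane of the first two axes and the third axis;
    they commute with the transvections along [gamma0 R]. *)
Definition block (h : 'M[R]_3) :=
  [/\ h i0 i2 = 0, h i1 i2 = 0, h i2 i0 = 0 & h i2 i1 = 0].

Lemma block_flat h t : block h -> h *m flat (t *: w) = flat (t *: w) *m h.
Proof.
move=> [h02 h12 h20 h21]; rewrite /flat mul_mx_diag mul_diag_mx.
apply/matrixP => i j; ord3 i; ord3 j; rewrite !mxE /= ?h02 ?h12 ?h20 ?h21; ring.
Qed.

Lemma block_frame p : X p -> p i0 i2 = 0 -> p i1 i2 = 0 ->
  exists h, [/\ \det h = 1, block h & p = sl_act h 1%:M].
Proof.
move=> Xp p02 p12; have [n [[n10 n20 n21] dn pE _ /(_ p02 p12)[n02 n12]]] :=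
  P3_cholesky Xp.
by exists n; split=> //; rewrite /sl_act mulmx1.
Qed.

(** A line parallel to [gamma0 R] is asymptotic to it in both directions, so its
    frame commutes with the transvections along [gamma0 R]. Conversely those
    transvections move [gamma0 R] and its image under such a frame alike. *)
Lemma parallel_gamma0P p :
  parallel_set X d (gamma0 R) p <-> [/\ X p, p i0 i2 = 0 & p i1 i2 = 0].
Proof.
have [w0 w1] := dir_w2v.
have d1 : \det (1%:M : 'M[R]_3) = 1 by exact: det1.
split=> [[c [gc [K hK]] [s _ <-]]|[Xp p02 p12]].
  have [h [D [dh [D0 D1] cE]]] := geodesic_lineP gc; rewrite cE in hK *.
  have Xr t := P3_ray t dh D0.
  have b1 : below h D w.
    have := @asymptotic_below _ 1%:M h w D d1 dh w0 D0.
    rewrite invmx1 mul1mx; apply.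
    by exists K => t _; rewrite -gamma0E distC// gamma0E; exact: P3_ray.
  have b2 : below h (- D) (- w).
    have := @asymptotic_below _ 1%:M h (- w) (- D) d1 dh (tr0N w0) (tr0N D0).
    rewrite invmx1 mul1mx; apply.
    have e (k : 'M[R]_3) (E : 'rV[R]_3) t : ray k (- E) t = ray k E (- t).
      by rewrite /ray scalerN scaleNr.
    by exists K => t _; rewrite !e -gamma0E distC// gamma0E; exact: P3_ray.
  have eqD i j : h i j != 0 -> D 0 j = w 0 i.
    by move=> hij; have := b1 i j hij; have := b2 i j hij; rewrite !mxE; lra.
  have s0 := sqrt6_gt0; have si : 0 < (Num.sqrt 6)^-1 :> R by rewrite invr_gt0.
  have z i j : (i == i2) = false -> h i j * h i2 j = 0.
    move=> ii; have [->|hi] := eqVneq (h i j) 0; first by rewrite mul0r.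
    have [->|h2] := eqVneq (h i2 j) 0; first by rewrite mulr0.
    have := eqD _ _ hi; rewrite (eqD _ _ h2).
    by move: ii; ord3 i => //= _; rewrite !mxE /=; lra.
  split; first exact: Xr.
    by rewrite /ray sl_act_entry !flat_entry /= !mulr1n !mulr0n !mulr0 !z// !mul0r !addr0.
  by rewrite /ray sl_act_entry !flat_entry /= !mulr1n !mulr0n !mulr0 !z// !mul0r !addr0.
have [h [dh bh ->]] := block_frame Xp p02 p12.
exists (ray h w); last by exists 0 => //; rewrite /ray scale0r flat0.
split; first exact: ray_line dir_w2v.
exists (d (sl_act h 1%:M) 1%:M) => t; rewrite gamma0_flat /ray.
have t0 : tr0 (t *: w) by exact: tr0Z.
pose f : 'M[R]_3 := flat (2^-1 *: (t *: w)).
have df : \det f = 1 by apply: det_flat; exact: tr0Z.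
have fE : flat (t *: w) = sl_act f 1%:M by rewrite /sl_act mulmx1 -flat_sqrt.
have hf : h *m f = f *m h by rewrite /f scalerA; exact: block_flat.
by rewrite fE -sl_actM hf sl_actM dist_act.
Qed.

(** ** Rotations times a dilation *)

(** The determinant of the linear system is [b^2 + k^2]. *)
Lemma rot_eq0 (b k x y : R) : b != 0 -> b * y = k * x -> b * x = - (k * y) ->
  x = 0 /\ y = 0.
Proof.
move=> b0 e1 e2.
have n : b ^+ 2 + k ^+ 2 != 0.
  by rewrite paddr_eq0 ?sqr_ge0// negb_and sqrf_eq0 b0.
have x0 : x = 0.
  have : (b ^+ 2 + k ^+ 2) * x = 0.
    by rewrite mulrDl !expr2 -!mulrA -e1 e2; ring.
  by move/eqP; rewrite mulf_eq0 (negbTE n) => /eqP.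
split=> //; move/eqP: e1; rewrite x0 mulr0 mulf_eq0 (negbTE b0) => /eqP //.
Qed.

Lemma ideal_point1_inj (D D' : 'rV[R]_3) : dir D -> dir D' ->
  ideal_point 1%:M D = ideal_point 1%:M D' -> D = D'.
Proof.
have d1 : \det (1%:M : 'M[R]_3) = 1 by exact: det1.
have le (E E' : 'rV[R]_3) : dir E -> dir E' -> ideal_point 1%:M E = ideal_point 1%:M E' ->
    forall i, E' 0 i <= E 0 i.
  move=> dE dE' /(ideal_point_eq d1 d1 dE dE'); rewrite invmx1 mul1mx => b i.
  by apply: b; rewrite mxE eqxx oner_eq0.
move=> dD dD' e; apply/rowP => i; apply/eqP; rewrite eq_le.
by rewrite (le _ _ dD' dD (esym e)) (le _ _ dD dD' e).
Qed.

Lemma chamber_of_capP (P Q : R -> R -> R -> Prop) (x : tits_space X d) :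
  (chamber_of P `&` chamber_of Q) x <-> exists D, [/\ dir D,
    P (D 0 i0) (D 0 i1) (D 0 i2), Q (D 0 i0) (D 0 i1) (D 0 i2) & x = ideal_point 1%:M D].
Proof.
split=> [[/chamber_ofP[D [dD PD ->]] /chamber_ofP[D' [dD' QD e]]]|].
  exists D; split; [exact: dD|exact: PD| |by []].
  by rewrite (ideal_point1_inj dD dD' e); exact: QD.
by move=> [D [dD PD QD ->]]; split; apply/chamber_ofP; exists D.
Qed.

(** The third coordinate of a vector with sum 0 is at most [sqrt (2 / 3)] times its
    norm. *)
Lemma le_dist_row2 (p q : 'M[R]_3) : X p -> X q ->
  Num.sqrt (3 / 2) * `|ln (q i2 i2) - ln (p i2 i2)| <= d p q.
Proof.
move=> Xp Xq; apply: le_trans (iwasawa_lipschitz Xp Xq).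
rewrite -sqrtr_sqr -sqrtrM ?divr_ge0// ler_wsqrtr//.
rewrite dot_sqr !mxE /=.
move: (ln (minor2 q)) (ln (minor2 p)) (ln (q i2 i2)) (ln (p i2 i2)) => a b x y.
rewrite -subr_ge0 (_ : _ - _ = 2^-1 * (2 * (a - b) - (x - y)) ^+ 2); last by field.
by rewrite mulr_ge0 ?sqr_ge0// invr_ge0.
Qed.

End singular.

Section semisimple_cases.
Variable R : realType.
Notation X := (P3 R).
Notation d := (dist R).
Notation w := (w2v R).

Definition rotmx (a b : R) : 'M[R]_3 :=
  mx3 [:: [:: a; b; 0]; [:: - b; a; 0]; [:: 0; 0; 1 / (a ^+ 2 + b ^+ 2)]].

Variables a b : R.
Hypotheses (r0 : a ^+ 2 + b ^+ 2 != 0) (b0 : b != 0).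
Let g := rotmx a b.
Let r := a ^+ 2 + b ^+ 2.

Lemma det_rotmx : \det g = 1.
Proof. by rewrite det3 !mxE /=; field. Qed.

Lemma rotmx_norm_gt0 : 0 < r.
Proof. by rewrite lt_neqAle eq_sym r0 addr_ge0 ?sqr_ge0. Qed.

Lemma rotmx_gamma0 (t : R) :
  sl_act g (gamma0 R t) = gamma0 R (t + Num.sqrt 6 * ln r).
Proof.
have rp := rotmx_norm_gt0; have s0 := sqrt6_gt0 R.
rewrite !gamma0_flat scalerDl /flat.
have e1 : expR (Num.sqrt 6 * ln r * (Num.sqrt 6)^-1) = r.
  by rewrite mulrAC mulfV ?gt_eqF// mul1r lnK.
have e2 : expR (Num.sqrt 6 * ln r * (- 2 * (Num.sqrt 6)^-1)) = (r ^+ 2)^-1.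
  rewrite (_ : _ * _ = - (ln r *+ 2)); last by rewrite -mulr_natl; field; rewrite gt_eqF.
  by rewrite expRN -lnXn// lnK// posrE exprn_gt0.
apply/matrixP => i j; rewrite sl_act_entry; ord3 i; ord3 j;
  rewrite !mxE /= ?expRD ?e1 ?e2 ?mulr1n ?mulr0n /r; by field.
Qed.

(** This is the algebra behind both the set of fixed points and the set of minimal
    displacement. Commuting with [g] makes [Q] a rotation with dilation on the
    first two axes; symmetry of [Q p] makes it a dilation, and then [p] is
    invariant under a rotation of the plane that is not a multiple of the
    identity. *)
Lemma rotmx_commuting (p Q : 'M[R]_3) : X p -> sl_act g p = Q *m p ->
  Q *m g = g *m Q -> range (gamma0 R) p.
Proof.
move=> Xp e c.
have s01 := P3_sym i1 i0 Xp; have s02 := P3_sym i2 i0 Xp.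
have s12 := P3_sym i2 i1 Xp.
have p0 := P3_diag_gt0 i0 Xp; have p1 := P3_diag_gt0 i1 Xp.
have p2 := P3_diag_gt0 i2 Xp.
pose z := 1 / (a ^+ 2 + b ^+ 2).
have C i j := congr1 (fun M : 'M[R]_3 => M i j) c.
have E i j := congr1 (fun M : 'M[R]_3 => M i j) e.
have [Q20 Q21] : Q i2 i0 = 0 /\ Q i2 i1 = 0.
  have := C i2 i0; have := C i2 i1; rewrite !mulmx_entry !mxE /= -/z => h1 h0.
  apply: (@rot_eq0 _ b (a - z)) => //; lra.
have [Q02 Q12] : Q i0 i2 = 0 /\ Q i1 i2 = 0.
  have := C i0 i2; have := C i1 i2; rewrite !mulmx_entry !mxE /= -/z => h1 h0.
  apply: (@rot_eq0 _ b (z - a)) => //; lra.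
have Q10 : Q i1 i0 = - Q i0 i1.
  have := C i0 i0; rewrite !mulmx_entry !mxE /= Q02 Q20 => h.
  by apply: (mulfI b0); lra.
have Q11 : Q i1 i1 = Q i0 i0.
  have := C i0 i1; rewrite !mulmx_entry !mxE /= Q02 Q21 => h.
  by apply: (mulfI b0); lra.
have zN : z != 0 by rewrite mulf_neq0 ?invr_eq0 ?oner_eq0.
have Q22 : Q i2 i2 = z * z.
  have := E i2 i2; rewrite sl_act_entry mulmx_entry !mxE /= Q20 Q21 -/z => h.
  by apply: (mulIf (lt0r_neq0 p2)); lra.
have [p02 p12] : p i0 i2 = 0 /\ p i1 i2 = 0.
  have := E i2 i0; have := E i2 i1.
  rewrite !sl_act_entry !mulmx_entry !mxE /= Q20 Q21 Q22 s02 s12 -/z => h1 h0.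
  by apply: (@rot_eq0 _ b (z - a)) => //; apply: (mulfI zN); lra.
have := E i0 i0; have := E i1 i1; have := E i0 i1; have := E i1 i0.
rewrite !sl_act_entry !mulmx_entry !mxE /= Q02 Q12 Q10 Q11 s01 p02 p12.
set x := Q i0 i0; set y := Q i0 i1 => h10 h01 h11 h00.
have pp : 0 < p i0 i0 + p i1 i1 by rewrite addr_gt0.
have y0 : y = 0 by apply: (mulIf (lt0r_neq0 pp)); lra.
rewrite y0 in h10 h01 h11 h00.
have x0 : x = r by apply: (mulIf (lt0r_neq0 pp)); rewrite /r; lra.
rewrite x0 /r in h10 h01 h11 h00.
have k1 : 2 * a * p i0 i1 + b * (p i1 i1 - p i0 i0) = 0.
  by apply: (mulfI b0); lra.
have k2 : a * (p i1 i1 - p i0 i0) - 2 * b * p i0 i1 = 0.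
  by apply: (mulfI b0); lra.
have u0 : p i1 i1 - p i0 i0 = 0.
  apply: (mulfI r0); rewrite mulr0.
  rewrite (_ : _ * _ = b * (2 * a * p i0 i1 + b * (p i1 i1 - p i0 i0)) +
    a * (a * (p i1 i1 - p i0 i0) - 2 * b * p i0 i1)); last by ring.
  by rewrite k1 k2 !mulr0 addr0.
have v0 : p i0 i1 = 0.
  apply: (mulfI r0); rewrite mulr0.
  rewrite (_ : _ * _ = 2^-1 * (a * (2 * a * p i0 i1 + b * (p i1 i1 - p i0 i0)) -
    b * (a * (p i1 i1 - p i0 i0) - 2 * b * p i0 i1))); last by field.
  by rewrite k1 k2 !mulr0 subr0 mulr0.
have p11 : p i1 i1 = p i0 i0 by apply/eqP; rewrite -subr_eq0 u0.
have dp : \det p = 1 by case: Xp.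
have p22 : p i2 i2 = (p i0 i0 ^+ 2)^-1.
  apply: (mulIf (lt0r_neq0 (exprn_gt0 2 p0))).
  rewrite mulVf ?expf_neq0 ?gt_eqF//.
  by rewrite -dp det3 s01 s02 s12 p02 p12 v0 p11; ring.
have s0 := sqrt6_gt0 R.
exists (Num.sqrt 6 * ln (p i0 i0)) => //.
have e1 : expR (Num.sqrt 6 * ln (p i0 i0) * (Num.sqrt 6)^-1) = p i0 i0.
  by rewrite mulrAC mulfV ?gt_eqF// mul1r lnK.
have e2 : expR (Num.sqrt 6 * ln (p i0 i0) * (- 2 * (Num.sqrt 6)^-1)) =
    (p i0 i0 ^+ 2)^-1.
  rewrite (_ : _ * _ = - (ln (p i0 i0) *+ 2)); last first.
    by rewrite -mulr_natl; field; rewrite gt_eqF.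
  by rewrite expRN -lnXn// lnK// posrE exprn_gt0.
rewrite gamma0_flat; apply/matrixP => i j; rewrite flat_entry.
ord3 i; ord3 j; rewrite ?s01 ?s02 ?s12 ?p02 ?p12 ?v0 ?p11 ?p22 !mxE /= ?mulr1n ?mulr0n//.
Qed.

(** [g] does not preserve a full flag, but it multiplies the last diagonal entry
    by a constant, and a single coordinate of the horospherical projection is
    enough. *)
Lemma le_dist_rotmx (p : 'M[R]_3) : X p ->
  Num.sqrt 6 * `|ln r| <= d p (sl_act g p) /\
  2 * (Num.sqrt 6 * `|ln r|) <= d p (sl_act g (sl_act g p)).
Proof.
move=> Xp; have Xg := P3_act det_rotmx Xp; have Xgg := P3_act det_rotmx Xg.
have rp := rotmx_norm_gt0.
have step q : X q -> ln (sl_act g q i2 i2) = ln (q i2 i2) - 2 * ln r.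
  move=> /(P3_diag_gt0 i2) q0.
  rewrite sl_act_entry !mxE /= !(mul0r, mulr0, add0r) -/r div1r -expr2.
  rewrite lnM ?posrE ?exprn_gt0 ?invr_gt0// lnXn ?invr_gt0// lnV ?posrE//.
  by rewrite -mulr_natl; ring.
have s : Num.sqrt 6 = Num.sqrt (3 / 2) * 2 :> R.
  rewrite (_ : 6 = 3 / 2 * 2 ^+ 2); last by field.
  by rewrite sqrtrM ?divr_ge0// sqrtr_sqr ger0_norm.
have n2 : `|2| = 2 :> R by rewrite ger0_norm.
have n4 : `|4| = 4 :> R by rewrite ger0_norm.
split.
  apply: le_trans (le_dist_row2 Xp Xg); rewrite step// addrAC subrr sub0r.
  by rewrite normrN normrM n2 s mulrA.
apply: le_trans (le_dist_row2 Xp Xgg); rewrite !step//.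
rewrite (_ : _ - _ - _ - _ = - (4 * ln r)); last by ring.
rewrite normrN normrM n4 s le_eqVlt; apply/orP; left; apply/eqP; ring.
Qed.

Lemma dist_rotmx_gamma0 (t : R) :
  d (gamma0 R t) (sl_act g (gamma0 R t)) = Num.sqrt 6 * `|ln r|.
Proof.
rewrite rotmx_gamma0 !gamma0E; have [_ ->] := ray_line (@det1 _ 3) (dir_w2v R).
by rewrite opprD addrA subrr sub0r normrN normrM ger0_norm ?sqrtr_ge0.
Qed.

Lemma X_gamma0 (t : R) : X (gamma0 R t).
Proof. by rewrite gamma0E; apply: P3_ray; [exact: det1|case: (dir_w2v R)]. Qed.

Lemma ideal_fix_rotmx : ideal_fix g = vtx R 2 `|` vtx R 5.
Proof.
rewrite ideal_fix_coordinate ?det_rotmx//.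
- rewrite eqEsubset; split=> x.
    move=> [D [dD bD ->]].
    have b01 : D 0 i1 <= D 0 i0 by apply: bD; rewrite mxE.
    have b10 : D 0 i0 <= D 0 i1 by apply: bD; rewrite mxE /= oppr_eq0.
    have [l|/ltW l] := leP (D 0 i2) (D 0 i0); [left|right];
      by apply/chamber_of_capP; exists D; split=> //; split; lra.
  move=> [] /chamber_of_capP[D [dD [h1 h2] [h3 h4] ->]]; exists D; split=> // i j;
    by ord3 i; ord3 j; rewrite mxE /= ?eqxx//; lra.
- move=> x /eigencol_entry[l e].
  have := e i0; have := e i1; have := e i2; rewrite !mxE /= => e2 e1 e0.
  have [x0 x1] : x i0 0 = 0 /\ x i1 0 = 0.
    by apply: (@rot_eq0 _ b (l - a)) => //; lra.
  by exists i2 => i; ord3 i.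
- move=> y /eigenrow_entry[l e].
  have := e i0; have := e i1; have := e i2; rewrite !mxE /= => e2 e1 e0.
  have [y1 y0] : y 0 i1 = 0 /\ y 0 i0 = 0.
    by apply: (@rot_eq0 _ b (l - a)) => //; lra.
  by exists i2 => i; ord3 i.
Qed.

Lemma displacement_rotmx : displacement X d (sl_act g) = Num.sqrt 6 * `|ln r|.
Proof.
apply: (displacement_min (q := gamma0 R 0)); last exact: dist_rotmx_gamma0.
  by move=> p /le_dist_rotmx[].
exact: X_gamma0.
Qed.

Lemma hyperbolic_rotmx : r != 1 -> hyperbolic X d (sl_act g).
Proof.
move=> r1; apply: (@hyperbolic_of_line _ g 1%:M w (Num.sqrt 6 * ln r)).
- exact: det1.
- exact: dir_w2v.
- apply: mulf_neq0; first by rewrite gt_eqF// sqrt6_gt0.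
  by rewrite ln_eq0// rotmx_norm_gt0.
- by move=> t; rewrite -!gamma0E rotmx_gamma0.
Qed.

Lemma elliptic_rotmx : r = 1 ->
  elliptic X (sl_act g) /\ fix_set X (sl_act g) = range (gamma0 R).
Proof.
move=> r1.
have fE : fix_set X (sl_act g) = range (gamma0 R).
  rewrite eqEsubset; split=> p.
    by move=> [Xp gp]; apply: (@rotmx_commuting p 1%:M); rewrite ?mul1mx ?mulmx1.
  move=> [t _ <-]; split; first exact: X_gamma0.
  by rewrite rotmx_gamma0 r1 ln1 mulr0 addr0.
by split=> //; rewrite /elliptic fE; exists (gamma0 R 0), 0.
Qed.

Lemma min_set_rotmx : min_set X d (sl_act g) = range (gamma0 R).
Proof.
rewrite eqEsubset; split=> p; last first.
  move=> [t _ <-]; split; first exact: X_gamma0.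
  by rewrite displacement_rotmx dist_rotmx_gamma0.
move=> [Xp]; rewrite displacement_rotmx => e.
have [|Q [e1 e2]] := @commuting_of_min _ g _ p det_rotmx _ Xp e.
  by move=> q /le_dist_rotmx[].
exact: rotmx_commuting e2.
Qed.

Lemma classify_rotation_dilation : [/\ semi_simple X d (sl_act g),
  ideal_fix g = vtx R 2 `|` vtx R 5,
  (r = 1 ->
   elliptic X (sl_act g) /\ fix_set X (sl_act g) = range (gamma0 R)) &
  (r != 1 -> [/\ hyperbolic X d (sl_act g),
     displacement X d (sl_act g) = Num.sqrt 6 * `|ln r| &
     min_set X d (sl_act g) = range (gamma0 R)])].
Proof.
split.
- have [/elliptic_rotmx[]|/hyperbolic_rotmx] := eqVneq r 1; [by left|by right].
- exact: ideal_fix_rotmx.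
- exact: elliptic_rotmx.
- move=> r1; split; [exact: hyperbolic_rotmx|exact: displacement_rotmx|].
  exact: min_set_rotmx.
Qed.

End semisimple_cases.

(** ** Singular diagonal isometries *)

Section singular_diagonal.
Variable R : realType.
Notation X := (P3 R).
Notation d := (dist R).
Variable a : R.
Hypotheses (a0 : a != 0) (a1 : a != 1).
Let g : 'M[R]_3 := diag3 a a (1 / a ^+ 2).

Lemma diag_singular : is_diag_mx g.
Proof. by apply/is_diag_mxP => i j; ord3 i; ord3 j => //= _; rewrite mxE. Qed.

Lemma det_singular : \det g = 1.
Proof. by rewrite (det_upper (diag_upper diag_singular)) !mxE /=; field. Qed.

Lemma norm2_log2_singular : norm2 (log2 g) = 2 * Num.sqrt 6 * `|ln `|a| |.
Proof. by apply: norm2_log2_eq => //; rewrite !mxE /= ln_inv_sqr//; ring. Qed.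

Lemma block_comm_singular (h : 'M[R]_3) : block h -> h *m g = g *m h.
Proof.
move=> [h02 h12 h20 h21]; apply/matrixP => i j; rewrite !mulmx_entry.
by ord3 i; ord3 j; rewrite !mxE /= ?h02 ?h12 ?h20 ?h21; ring.
Qed.

Lemma dist_parallel_singular (p : 'M[R]_3) : parallel_set X d (gamma0 R) p ->
  d p (sl_act g p) = norm2 (log2 g).
Proof.
move=> /parallel_gamma0P[Xp p02 p12].
have [h [dh bh ->]] := block_frame Xp p02 p12.
rewrite -sl_actM -block_comm_singular// sl_actM dist_act// -flat0.
rewrite (sl_act_diag_ray (diag_upper diag_singular) diag_singular det_singular).
rewrite addr0 dist_flat ?subr0//.
  exact: tr0_0.
exact: tr0_log2 (diag_upper diag_singular) det_singular.
Qed.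

Lemma min_set_singular : min_set X d (sl_act g) = parallel_set X d (gamma0 R).
Proof.
rewrite eqEsubset; split=> p; last first.
  move=> Pp; split; first by case/parallel_gamma0P: Pp.
  by rewrite dist_parallel_singular// displacement_diag ?diag_singular ?det_singular.
move=> mp; have [Q [e c]] := min_set_diag_commuting diag_singular det_singular mp.
have [Xp _] := mp; have p2 := P3_diag_gt0 i2 Xp.
apply/parallel_gamma0P.
have aa := inv_sqr_neq a0 a1; set z := 1 / a ^+ 2 in aa.
have zN : z != 0 by rewrite mulf_neq0 ?oner_eq0// invr_eq0 expf_neq0.
have C i j := congr1 (fun M : 'M[R]_3 => M i j) c.
have E i j := congr1 (fun M : 'M[R]_3 => M i j) e.
have Q20 : Q i2 i0 = 0.
  by have := C i2 i0; rewrite !mulmx_entry !mxE /= -/z => h; apply: (scale_neq aa); lra.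
have Q21 : Q i2 i1 = 0.
  by have := C i2 i1; rewrite !mulmx_entry !mxE /= -/z => h; apply: (scale_neq aa); lra.
have Q22 : Q i2 i2 = z * z.
  have := E i2 i2; rewrite sl_act_entry mulmx_entry !mxE /= Q20 Q21 -/z => h.
  by apply: (mulIf (lt0r_neq0 p2)); lra.
split=> //; rewrite (P3_sym _ _ Xp); apply: (scale_neq aa); apply: (mulfI zN).
  by have := E i2 i0; rewrite !sl_act_entry !mulmx_entry !mxE /= Q20 Q21 Q22 -/z; lra.
by have := E i2 i1; rewrite !sl_act_entry !mulmx_entry !mxE /= Q20 Q21 Q22 -/z; lra.
Qed.

Lemma eigencol_singular (x : 'cV[R]_3) : eigencol g x ->
  x i2 0 = 0 \/ x i0 0 = 0 /\ x i1 0 = 0.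
Proof.
move=> /eigencol_entry[l e].
have := e i0; have := e i1; have := e i2; rewrite !mxE /= => e2 e1 e0.
have aa := inv_sqr_neq a0 a1; set z := 1 / a ^+ 2 in aa e2.
have [la|la] := eqVneq l a.
  by left; rewrite la in e2; apply: (@scale_neq _ a z); rewrite 1?eq_sym//; lra.
by right; split; apply: (scale_neq la); lra.
Qed.

Lemma eigenrow_singular (y : 'rV[R]_3) : eigenrow g y ->
  y 0 i2 = 0 \/ y 0 i0 = 0 /\ y 0 i1 = 0.
Proof.
move=> /eigenrow_entry[l e].
have := e i0; have := e i1; have := e i2; rewrite !mxE /= => e2 e1 e0.
have aa := inv_sqr_neq a0 a1; set z := 1 / a ^+ 2 in aa e2.
have [la|la] := eqVneq l a.
  by left; rewrite la in e2; apply: (@scale_neq _ a z); rewrite 1?eq_sym//; lra.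
by right; split; apply: (scale_neq la); lra.
Qed.

Lemma plane_rotation (u v : R) : ~~ ((u == 0) && (v == 0)) ->
  exists s t n : R, [/\ s ^+ 2 + t ^+ 2 = 1, n != 0, u = n * s & v = n * t].
Proof.
move=> uv; pose n := Num.sqrt (u ^+ 2 + v ^+ 2).
have n2 : n ^+ 2 = u ^+ 2 + v ^+ 2 by rewrite sqr_sqrtr// addr_ge0// sqr_ge0.
have nN : n != 0.
  by rewrite -sqrf_eq0 n2 paddr_eq0 ?sqr_ge0// !sqrf_eq0.
exists (u / n), (v / n), n; split=> //; try by rewrite mulrC divfK.
by rewrite !expr_div_n -mulrDl -n2 divff// expf_neq0.
Qed.

(** A rotation of the plane of the first two axes commutes with [g] and brings an
    invariant flag to coordinate position. Thus every fixed point at infinity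
    lies in the apartment of a flat that contains [gamma0 R]. *)
Lemma rotated_frame (h : 'M[R]_3) (D : 'rV[R]_3) :
  \det h = 1 -> dir D -> sorted3 D ->
  (D 0 i1 < D 0 i0 -> eigencol g (col i0 h)) ->
  (D 0 i2 < D 0 i1 -> eigenrow g (row i2 (invmx h))) ->
  exists k D', [/\ \det k = 1, block k, dir D' & ideal_point h D = ideal_point k D'].
Proof.
move=> dh dD sD ec er.
pose rot s t : 'M[R]_3 := mx3 [:: [:: s; - t; 0]; [:: t; s; 0]; [:: 0; 0; 1]].
have drot s t : s ^+ 2 + t ^+ 2 = 1 -> \det (rot s t) = 1.
  by rewrite det3 !mxE /=; lra.
suff [s [t [st hA hC]]] : exists s t, [/\ s ^+ 2 + t ^+ 2 = 1,
    D 0 i1 < D 0 i0 -> exists l, forall i, i != l -> (invmx (rot s t) *m h) i i0 = 0 &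
    D 0 i2 < D 0 i1 -> exists l, forall j, j != l -> (invmx h *m rot s t) i2 j = 0].
  have dr := drot _ _ st; have ur := unitmx_det1 dr; have uh := unitmx_det1 dh.
  have dk : \det (invmx (rot s t) *m h) = 1 by rewrite det_mulmx det_inv1// dh mulr1.
  have ik : invmx (invmx (rot s t) *m h) = invmx h *m rot s t.
    by apply: invmx_left; rewrite -mulmxA mulKVmx// mulVmx.
  have [|D' [dD' e]] := coordinate_frame dk dD sD hA; first by rewrite ik.
  exists (rot s t), D'; split=> //; first by split; rewrite mxE.
  have -> : h = rot s t *m (invmx (rot s t) *m h) by rewrite mulKVmx.
  by rewrite -ideal_map_point// e ideal_map_point ?det1// mulmx1.
have inv s t : s ^+ 2 + t ^+ 2 = 1 -> invmx (rot s t) = rot s (- t).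
  move=> st; apply: invmx_left; apply/matrixP => i j; rewrite mulmx_entry.
  by ord3 i; ord3 j; rewrite !mxE /= ?mulr1n ?mulr0n; lra.
have {}ec : D 0 i1 < D 0 i0 -> h i2 i0 = 0 \/ h i0 i0 = 0 /\ h i1 i0 = 0.
  by move=> /ec/eigencol_singular; rewrite !mxE.
have {}er : D 0 i2 < D 0 i1 -> invmx h i2 i2 = 0 \/ invmx h i2 i0 = 0 /\ invmx h i2 i1 = 0.
  by move=> /er/eigenrow_singular; rewrite !mxE.
have orth : invmx h i2 i0 * h i0 i0 + invmx h i2 i1 * h i1 i0 +
    invmx h i2 i2 * h i2 i0 = 0 by rewrite mulVmx_entry.
have hcol : h i2 i0 = 0 -> ~~ ((h i0 i0 == 0) && (h i1 i0 == 0)).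
  move=> z; apply/negP => /andP[/eqP e0 /eqP e1].
  have := mulVmx_entry i0 i0 dh; rewrite z e0 e1 !mulr0 !addr0 /= => /eqP.
  by rewrite eq_sym oner_eq0.
have hrow : invmx h i2 i2 = 0 -> ~~ ((invmx h i2 i0 == 0) && (invmx h i2 i1 == 0)).
  move=> z; apply/negP => /andP[/eqP e0 /eqP e1].
  have := mulVmx_entry i2 i2 dh; rewrite z e0 e1 !mul0r !addr0 /= => /eqP.
  by rewrite eq_sym oner_eq0.
(* The rotation is dictated by the line if it lies in the plane of the first
   two axes, and otherwise by the plane. *)
have [/andP[l1 /eqP z]|noC] := boolP ((D 0 i1 < D 0 i0) && (h i2 i0 == 0)).
  have [s [t [n [st nN e0 e1]]]] := plane_rotation (hcol z).
  exists s, t; split=> // [_|/er B].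
    exists i0 => i; rewrite inv// mulmx_entry; ord3 i => // _;
      rewrite !mxE /= z ?e0 ?e1; ring.
  case: B => [y2|[y0 y1]].
    exists i1 => j; rewrite mulmx_entry; ord3 j => // _; rewrite !mxE /= y2.
      apply: (mulfI nN); move: orth; rewrite z e0 e1; lra.
    ring.
  by exists i2 => j; rewrite mulmx_entry; ord3 j => // _; rewrite !mxE /= y0 y1; ring.
have {noC}ec : D 0 i1 < D 0 i0 -> h i0 i0 = 0 /\ h i1 i0 = 0.
  by move=> l1; have [z|//] := ec l1; move: noC; rewrite l1 z eqxx.
have cA s t : s ^+ 2 + t ^+ 2 = 1 -> D 0 i1 < D 0 i0 ->
    exists l, forall i, i != l -> (invmx (rot s t) *m h) i i0 = 0.
  move=> st /ec[x0 x1]; exists i2 => i; rewrite inv// mulmx_entry.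
  by ord3 i => // _; rewrite !mxE /= x0 x1; ring.
have s1 : 1 ^+ 2 + 0 ^+ 2 = 1 :> R by ring.
have [/andP[l2 /eqP z]|noR] := boolP ((D 0 i2 < D 0 i1) && (invmx h i2 i2 == 0)).
  have [s [t [n [st nN e0 e1]]]] := plane_rotation (hrow z).
  exists s, t; split=> // [|_]; first exact: cA.
  exists i0 => j; rewrite mulmx_entry; ord3 j => // _; rewrite !mxE /= z ?e0 ?e1; ring.
exists 1, 0; split=> //; first exact: cA.
move=> l2; have [z|[y0 y1]] := er l2; first by move: noR; rewrite l2 z eqxx.
by exists i2 => j; rewrite mulmx_entry; ord3 j => // _; rewrite !mxE /= y0 y1; ring.
Qed.

(** For one inclusion, a ray in the parallel set is moved by a constant distance,
    which makes its image asymptotic to it. *)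
Lemma ideal_fix_singular : ideal_fix g = ends X d (parallel_set X d (gamma0 R)).
Proof.
rewrite eqEsubset; split=> x.
  move=> fx; have [h [D [dh dD sD -> [ec er]]]] := ideal_fix_sorted det_singular fx.
  have [k [D' [dk bk dD' ->]]] := rotated_frame dh dD sD ec er.
  exists (ray k D') => //; split; first exact: ray_ray.
  move=> t _; apply/parallel_gamma0P.
  have [k02 k12 k20 k21] := bk.
  split; first by apply: P3_ray => //; case: dD'.
    by rewrite /ray sl_act_entry !flat_entry /= !mulr1n !mulr0n k02 k20 k21; ring.
  by rewrite /ray sl_act_entry !flat_entry /= !mulr1n !mulr0n k12 k20 k21; ring.
move=> [c [gc cP] <-]; have [h [D [dh dD cE e]]] := class_point gc.
have dgh : \det (g *m h) = 1 by rewrite det_mulmx det_singular dh mulr1.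
rewrite e; split; first exact: ends_point.
rewrite ideal_map_point ?det_singular//; apply/ray_class_eq; try exact: ray_ray.
exists (norm2 (log2 g)) => t t0; rewrite -ray_actM /= -cE//.
by rewrite distC ?dist_parallel_singular//; [exact: cP|apply: P3_act; [exact: det_singular|]|];
  case: gc => gP _; exact: gP.
Qed.

Lemma classify_singular_diagonal :
  [/\ (a != -1 -> hyperbolic X d (sl_act g)) /\ (a = -1 -> elliptic X (sl_act g)),
      displacement X d (sl_act g) = 2 * Num.sqrt 6 * `|ln `|a| |,
      ideal_fix g = ends X d (parallel_set X d (gamma0 R)) &
      min_set X d (sl_act g) = parallel_set X d (gamma0 R)].
Proof.
split; [split|by rewrite displacement_diag ?diag_singular ?det_singular ?norm2_log2_singular|
  exact: ideal_fix_singular|exact: min_set_singular].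
- move=> aN1; apply: hyperbolic_diag; [exact: diag_singular|exact: det_singular|].
  rewrite norm2_log2_singular; apply: mulf_neq0.
    by rewrite mulf_neq0// gt_eqF// sqrt6_gt0.
  rewrite normr_eq0 ln_eq0 ?normr_gt0//.
  by rewrite eqr_norml ler01 andbT negb_or a1 aN1.
- move=> am; exists 1%:M; split; first exact: P3_1.
  apply/matrixP => i j; rewrite sl_act_entry; ord3 i; ord3 j;
    by rewrite !mxE /= am ?mulr1n ?mulr0n; field.
Qed.

End singular_diagonal.

(** ** The edges at infinity *)

Section edges.
Variable R : realType.
Notation X := (P3 R).
Notation d := (dist R).

Definition edge_of (h : 'M[R]_3) : set (tits_space X d) :=
  [set ideal_point h D | D in [set D | dir D /\ sorted3 D]].

Lemma chamber1P (x : tits_space X d) :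
  chamber R 1 x <-> exists D, [/\ dir D, sorted3 D & x = ideal_point 1%:M D].
Proof. exact: chamber_ofP. Qed.

Lemma edge_image (h : 'M[R]_3) : \det h = 1 ->
  ideal_map X d (sl_act h) @` chamber R 1 = edge_of h.
Proof.
move=> dh; rewrite eqEsubset; split=> [_ [x /chamber1P[D [dD sD ->]] <-]|_ [D [dD sD] <-]].
  by exists D => //; rewrite ideal_map_point ?det1// mulmx1.
exists (ideal_point 1%:M D); first by apply/chamber1P; exists D.
by rewrite ideal_map_point ?det1// mulmx1.
Qed.

Lemma edgeP (E : set (tits_space X d)) :
  edge E <-> exists2 h, \det h = 1 & E = edge_of h.
Proof. by split=> -[h dh ->]; exists h; rewrite ?edge_image. Qed.

Lemma vertexP (x : tits_space X d) : vertex x <-> exists h D,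
  [/\ \det h = 1, dir D, sorted3 D, D 0 i0 = D 0 i1 \/ D 0 i1 = D 0 i2 &
    x = ideal_point h D].
Proof.
split=> [[h dh [y]]|[h [D [dh dD [s1 s2] e xE]]]].
  move=> y12 <-; suff [D [dD sD e ->]] : exists D, [/\ dir D, sorted3 D,
      D 0 i0 = D 0 i1 \/ D 0 i1 = D 0 i2 & y = ideal_point 1%:M D].
    by exists h, D; split=> //; rewrite ideal_map_point ?det1// mulmx1.
  case: y12 => /chamber_of_capP[D [dD [h1 h2] [h3 h4] yE]]; exists D; split=> //.
  - by right; apply/eqP; rewrite eq_le; apply/andP; split; lra.
  - by left; apply/eqP; rewrite eq_le; apply/andP; split; lra.
exists h => //; exists (ideal_point 1%:M D); last by rewrite ideal_map_point ?det1// mulmx1.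
by case: e => e; [right|left]; apply/chamber_of_capP; exists D; split=> //;
  split; lra.
Qed.

(** The direction of a point at infinity does not depend on the frame, since an
    invertible matrix of size 3 has no zero block of size 1 x 3, 2 x 2 or 3 x 1. *)
Lemma ideal_point_sorted_inj (h h' : 'M[R]_3) (D D' : 'rV[R]_3) : \det h = 1 ->
  \det h' = 1 -> dir D -> dir D' -> sorted3 D -> sorted3 D' ->
  ideal_point h D = ideal_point h' D' -> D = D'.
Proof.
have le (k k' : 'M[R]_3) (E E' : 'rV[R]_3) : \det k = 1 -> \det k' = 1 ->
    dir E -> dir E' -> sorted3 E -> sorted3 E' ->
    ideal_point k E = ideal_point k' E' -> forall i, E' 0 i <= E 0 i.
  move=> dk dk' dE dE' [s1 s2] [s1' s2'] /(ideal_point_eq dk dk' dE dE').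
  set b := invmx k *m k' => bE.
  have db : \det b = 1 by rewrite det_mulmx det_inv1// dk' mulr1.
  have z i j : E 0 i < E' 0 j -> b i j = 0.
    by move=> lt; apply/eqP; apply: contraTT lt => /bE; rewrite -leNgt.
  have not0 : \det b = 0 -> False.
    by move=> e; move/eqP: db; rewrite e eq_sym oner_eq0.
  move=> i; rewrite leNgt; apply/negP; ord3 i => lt; apply: not0; rewrite det3.
  - by rewrite (z i0 i0)// (z i1 i0)// ?(z i2 i0)//; [ring|lra|lra].
  - by rewrite (z i1 i0)// ?(z i1 i1)// ?(z i2 i0)// ?(z i2 i1)//; [ring|lra..].
  - by rewrite (z i2 i0)// ?(z i2 i1)// ?(z i2 i2)//; [ring|lra..].
move=> dh dh' dD dD' sD sD' e; apply/rowP => i; apply/eqP; rewrite eq_le.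
by rewrite (le _ _ _ _ dh' dh dD' dD sD' sD (esym e)) (le _ _ _ _ dh dh' dD dD' sD sD' e).
Qed.

Lemma dir_nonconst (D : 'rV[R]_3) : dir D -> sorted3 D ->
  D 0 i1 < D 0 i0 \/ D 0 i2 < D 0 i1.
Proof.
move=> [D0 /norm2_eq1 D1] [s1 s2].
have [l|n1] := ltP (D 0 i1) (D 0 i0); first by left.
have [l|n2] := ltP (D 0 i2) (D 0 i1); first by right.
exfalso; move: D0 D1; rewrite /tr0 sum3 dot_sqr => D0.
have z0 : D 0 i0 = 0 by lra.
have z1 : D 0 i1 = 0 by lra.
have z2 : D 0 i2 = 0 by lra.
rewrite z0 z1 z2 expr0n /= !addr0 => /eqP.
by rewrite eq_sym oner_eq0.
Qed.

Definition w1v : 'rV[R]_3 :=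
  rv (2 * (Num.sqrt 6)^-1) (- (Num.sqrt 6)^-1) (- (Num.sqrt 6)^-1).

Lemma dir_w1v : dir w1v.
Proof.
split; first by rewrite /tr0 sum3 !mxE /=; ring.
by apply/norm2_eq1; rewrite dot_sqr !mxE /= exprMn !sqrrN !exprVn sqrt6_sqr; field.
Qed.

(** The flag of [h] has the line or the plane of the flag of [c_2], which are the
    second axis and the plane of the first two axes. *)
Definition meets_c2 (h : 'M[R]_3) :=
  h i0 i0 = 0 /\ h i2 i0 = 0 \/ h i2 i0 = 0 /\ h i2 i1 = 0.

(** The vertices of [c_2] are the line and the plane of its flag, and a vertex of
    an edge of each type is determined by its direction. *)
Lemma incident_c2P (E : set (tits_space X d)) :
  incident_edges (chamber R 2) E <->
  exists h, [/\ \det h = 1, meets_c2 h & E = edge_of h].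
Proof.
have d1 : \det (1%:M : 'M[R]_3) = 1 by exact: det1.
have s0 : 0 < (Num.sqrt 6)^-1 :> R by rewrite invr_gt0 sqrt6_gt0.
split=> [[/edgeP[h dh ->] [x /vertexP[k [V [dk dV sV Vv xV]]]
    [/chamber_ofP[C [dC [C1 C2] xC]] [D [dD sD] xD]]]]|[h [dh hm ->]]].
  exists h; split=> //.
  have DV : D = V by apply: (ideal_point_sorted_inj dh dk) => //; rewrite xD.
  have [k' dk' [dC' eC']] := ray_swap01 d1 dC.
  have DC : D = rv (C 0 i1) (C 0 i0) (C 0 i2).
    apply: (ideal_point_sorted_inj dh dk') => //; first by split; rewrite !mxE.
    by rewrite xD xC /ideal_point eC'.
  have hC : below h D C.
    have /(ideal_point_eq d1 dh dC dD) : ideal_point 1%:M C = ideal_point h D.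
      by rewrite -xC xD.
    by rewrite invmx1 mul1mx.
  have D0 : D 0 i0 = C 0 i1 by rewrite DC mxE.
  have D1 : D 0 i1 = C 0 i0 by rewrite DC mxE.
  have D2 : D 0 i2 = C 0 i2 by rewrite DC mxE.
  have z i j : C 0 i < D 0 j -> h i j = 0.
    by move=> lt; apply/eqP; apply: contraTT lt => /hC; rewrite -leNgt.
  have nc := dir_nonconst dD sD; move: sD => [sD1 sD2].
  rewrite -DV in Vv.
  case: Vv => e; [right|left]; split; apply: z; case: nc; lra.
split; first by apply/edgeP; exists h.
case: hm => [[z0 z1]|[z0 z1]].
  have dw := dir_w1v; have sw : sorted3 w1v by split; rewrite !mxE /=; lra.
  exists (ideal_point h w1v).
    by apply/vertexP; exists h, w1v; split=> //; right; rewrite !mxE.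
  split; last by exists w1v.
  apply/chamber_ofP.
  have [_ _ [dC _]] := ray_swap01 d1 dw; rewrite !mxE /= in dC.
  eexists; split; first exact: dC; first by rewrite !mxE /=; lra.
  apply/esym/(ideal_point_eq d1 dh dC dw); rewrite invmx1 mul1mx => i j.
  by ord3 i; ord3 j; rewrite ?z0 ?z1 ?eqxx// !mxE /=; lra.
have dw := dir_w2v R; have sw : sorted3 (w2v R) by split; rewrite !mxE /=; lra.
exists (ideal_point h (w2v R)).
  by apply/vertexP; exists h, (w2v R); split=> //; left; rewrite !mxE.
split; last by exists (w2v R).
apply/chamber_ofP; exists (w2v R); split=> //; first by rewrite !mxE /=; lra.
apply/esym/(ideal_point_eq d1 dh dw dw); rewrite invmx1 mul1mx => i j.
by ord3 i; ord3 j; rewrite ?z0 ?z1 ?eqxx// !mxE /=; lra.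
Qed.

End edges.

(** ** The fixed points at infinity of a transvection *)

Section transvection.
Variable R : realType.
Notation X := (P3 R).
Notation d := (dist R).

Definition transvection : 'M[R]_3 :=
  mx3 [:: [:: 1; 0; 0]; [:: 0; 1; 1]; [:: 0; 0; 1]].
Notation g := transvection.

Lemma upper_transvection : upper g.
Proof. by split; rewrite mxE. Qed.

Lemma det_transvection : \det g = 1.
Proof. by rewrite (det_upper upper_transvection) !mxE /=; ring. Qed.

Lemma parabolic_transvection : parabolic X d (sl_act g).
Proof.
apply: (parabolic_of_jordan_block (a := 1)); rewrite ?mxE//; first exact: upper_transvection.
  exact: det_transvection.
move=> Q e; have C i j := congr1 (fun M : 'M[R]_3 => M i j) e.
have := C i1 i0; have := C i2 i2; rewrite !mulmx_entry !mxE /=; split; lra.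
Qed.

Lemma displacement_transvection : displacement X d (sl_act g) = 0.
Proof.
rewrite displacement_upper;
  [|exact: upper_transvection|exact: det_transvection|by rewrite mxE].
by rewrite norm2_log2 !mxE /= normr1 ln1 expr0n /= !addr0 sqrtr0 mulr0.
Qed.

Lemma edge_of_fixed (h : 'M[R]_3) : \det h = 1 -> meets_c2 h ->
  edge_of h `<=` ideal_fix g.
Proof.
move=> dh hm _ [D [dD sD] <-]; apply/ideal_fix_flag => //.
  exact: det_transvection.
have e k : h i2 i0 * invmx h i0 k + h i2 i1 * invmx h i1 k +
    h i2 i2 * invmx h i2 k = (i2 == k)%:R by exact: mulmxV_entry.
have e' : invmx h i2 i0 * h i0 i0 + invmx h i2 i1 * h i1 i0 +
    invmx h i2 i2 * h i2 i0 = 0 by rewrite mulVmx_entry.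
have [x2 y1] : h i2 i0 = 0 /\ invmx h i2 i1 = 0.
  case: hm => -[z0 z1]; split=> //.
    have n : h i1 i0 != 0.
      apply/eqP => z; have := mulVmx_entry i0 i0 dh; rewrite z0 z1 z !mulr0 !addr0.
      by move/eqP; rewrite eq_sym oner_eq0.
    by apply: (mulIf n); move: e'; rewrite z0 z1; lra.
  have n : h i2 i2 != 0.
    apply/eqP => z; have := e i2; rewrite z0 z1 z !mul0r !addr0.
    by move/eqP; rewrite eq_sym oner_eq0.
  by apply: (mulfI n); have := e i1; rewrite z0 z1 /=; lra.
split=> _; exists 1; rewrite scale1r.
  apply/colP => i; rewrite mulmx_entry; ord3 i; rewrite !mxE /= ?x2; ring.
apply/rowP => j; rewrite mulmx_entry; ord3 j; rewrite !mxE /= ?y1; ring.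
Qed.

(** Where the direction singles out a line only or a plane only, the other part of
    the flag can be chosen so as to make it meet [c_2]. *)
Lemma fixed_in_edge (x : tits_space X d) : ideal_fix g x ->
  exists h, [/\ \det h = 1, meets_c2 h & edge_of h x].
Proof.
move=> fx.
have [h [D [dh dD sD -> [ec er]]]] := ideal_fix_sorted det_transvection fx.
have {}ec : D 0 i1 < D 0 i0 -> h i2 i0 = 0.
  move=> /ec/eigencol_entry[l e].
  have := e i1; have := e i2; rewrite !mxE /= => e2 e1.
  have [l1|l1] := eqVneq l 1; first by move: e1; rewrite l1; lra.
  by apply: (scale_neq l1); lra.
have {}er : D 0 i2 < D 0 i1 -> invmx h i2 i1 = 0.
  move=> /er/eigenrow_entry[l e].
  have := e i1; have := e i2; rewrite !mxE /= => e2 e1.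
  have [l1|l1] := eqVneq l 1; first by move: e2; rewrite l1; lra.
  by apply: (scale_neq l1); lra.
have orth : invmx h i2 i0 * h i0 i0 + invmx h i2 i1 * h i1 i0 +
    invmx h i2 i2 * h i2 i0 = 0 by rewrite mulVmx_entry.
have nc := dir_nonconst dD sD.
have [l1|n1] := ltP (D 0 i1) (D 0 i0); have [l2|n2] := ltP (D 0 i2) (D 0 i1).
- exists h; split=> //; last by exists D.
  have x2 := ec l1; have y1 := er l2.
  have /eqP : invmx h i2 i0 * h i0 i0 = 0 by move: orth; rewrite x2 y1; lra.
  rewrite mulf_eq0 => /orP[/eqP y0|/eqP x0]; [right|by left].
  have [|_ z0 z1] := @invmx_row_coordinate _ h i2 dh; last by [].
  by move=> j; ord3 j.
- have x2 := ec l1.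
  have uv : ~~ ((h i0 i0 == 0) && (h i1 i0 == 0)).
    apply/negP => /andP[/eqP e0 /eqP e1].
    have := mulVmx_entry i0 i0 dh; rewrite x2 e0 e1 !mulr0 !addr0 /= => /eqP.
    by rewrite eq_sym oner_eq0.
  have [s [t [n [st nN e0 e1]]]] := plane_rotation uv.
  pose k : 'M[R]_3 := mx3 [:: [:: s; - t; 0]; [:: t; s; 0]; [:: 0; 0; 1]].
  have dk : \det k = 1 by rewrite det3 !mxE /=; move: st; lra.
  have ik : invmx k = k^T.
    apply: invmx_left; apply/matrixP => i j; rewrite mulmx_entry.
    by move: st; ord3 i; ord3 j; rewrite !mxE /= ?mulr1n ?mulr0n; lra.
  exists k; split=> //; first by right; rewrite !mxE.
  exists D => //; apply/(ideal_point_eq dk dh dD dD); apply/below_sorted => //.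
  split=> lt; last by lra.
  by rewrite !mulmx_entry ik !mxE /= e0 e1 x2; split; ring.
- have y1 := er l2.
  have uv : ~~ ((invmx h i2 i0 == 0) && (invmx h i2 i2 == 0)).
    apply/negP => /andP[/eqP e0 /eqP e1].
    have := mulVmx_entry i2 i2 dh; rewrite y1 e0 e1 !mul0r !addr0 /= => /eqP.
    by rewrite eq_sym oner_eq0.
  have [s [t [n [st nN e0 e1]]]] := plane_rotation uv.
  pose k : 'M[R]_3 := mx3 [:: [:: 0; t; - s]; [:: 1; 0; 0]; [:: 0; - s; - t]].
  have dk : \det k = 1 by rewrite det3 !mxE /=; move: st; lra.
  exists k; split=> //; first by left; rewrite !mxE.
  exists D => //; apply/esym/(ideal_point_eq dh dk dD dD); apply/below_sorted => //.
  split=> lt; first by lra.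
  by rewrite !mulmx_entry !mxE /= e0 e1 y1; split; ring.
- by exfalso; case: nc; lra.
Qed.

Lemma ideal_fix_transvection :
  ideal_fix g = \bigcup_(E in incident_edges (chamber R 2)) E.
Proof.
rewrite eqEsubset; split=> x.
  move=> /fixed_in_edge[h [dh hm hx]]; exists (edge_of h) => //.
  by apply/incident_c2P; exists h.
by move=> [E /incident_c2P[h [dh hm ->]]]; exact: edge_of_fixed.
Qed.

(** Their first columns span infinitely many lines in the plane of the flag of
    [c_2]. *)
Definition shear (x : R) : 'M[R]_3 :=
  mx3 [:: [:: 1; 0; 0]; [:: x; 1; 0]; [:: 0; 0; 1]].

Lemma det_shear x : \det (shear x) = 1.
Proof. by rewrite det3 !mxE /=; ring. Qed.

Lemma shear_meets_c2 x : meets_c2 (shear x).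
Proof. by right; rewrite !mxE. Qed.

Lemma ideal_point_shear_inj (x y : R) (D : 'rV[R]_3) : dir D -> D 0 i1 < D 0 i0 ->
  ideal_point (shear x) D = ideal_point (shear y) D -> x = y.
Proof.
move=> dD lt /(ideal_point_eq (det_shear x) (det_shear y) dD dD) b.
have ix : invmx (shear x) = shear (- x).
  apply: invmx_left; apply/matrixP => i j; rewrite mulmx_entry.
  by ord3 i; ord3 j; rewrite !mxE /= ?mulr1n ?mulr0n; ring.
apply/eqP; rewrite -subr_eq0 -oppr_eq0 opprB; apply/eqP.
apply/eqP; apply: contraTT lt => xy; rewrite -leNgt; apply: b.
rewrite mulmx_entry ix !mxE /=.
by rewrite mul1r mulr1 mul0r addr0 addrC.
Qed.

Lemma uncountable_edges :
  ~ countable [set E : set (tits_space X d) | edge E /\ E `<=` ideal_fix g].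
Proof.
move=> /countable_injP[f fi].
have ge x : edge (edge_of (shear x)) /\ edge_of (shear x) `<=` ideal_fix g.
  split; first by apply/edgeP; exists (shear x) => //; exact: det_shear.
  by apply: edge_of_fixed; [exact: det_shear|exact: shear_meets_c2].
have s0 : 0 < (Num.sqrt 6)^-1 :> R by rewrite invr_gt0 sqrt6_gt0.
have sw : sorted3 (w1v R) by split; rewrite !mxE /=; lra.
have ei x y : edge_of (shear x) = edge_of (shear y) -> x = y.
  move=> e; have : edge_of (shear x) (ideal_point (shear x) (w1v R)).
    by exists (w1v R) => //; split=> //; exact: dir_w1v.
  rewrite e => -[D [dD sD] De].
  have DE : D = w1v R.
    by apply: (ideal_point_sorted_inj (det_shear y) (det_shear x)) => //; exact: dir_w1v.
  rewrite DE in De; apply: (ideal_point_shear_inj (dir_w1v R)); last by rewrite De.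
  by rewrite !mxE /=; lra.
have cR : countable [set: R].
  apply/countable_injP; exists (fun x => f (edge_of (shear x))) => x y _ _ e.
  by apply: ei; apply: fi e; rewrite inE; exact: ge.
have := countable_lebesgue_measure0
  (sub_countable (subset_card_le (@subsetT _ `[0%R, 1%R]%classic)) cR).
by rewrite lebesgue_measure_itv /= lte_fin ltr01 oppr0 adde0 => /eqP; rewrite onee_eq0.
Qed.

End transvection.

(** ** Angles and the Tits topology *)

Section angles.
Variable R : realType.
Notation X := (P3 R).
Notation d := (dist R).

(** Adding lower rows to higher ones, as multiplication by an upper unitriangular
    matrix does, one reaches a matrix whose rows have their leading entries in
    distinct columns. This is the Bruhat decomposition. *)
Lemma echelon (b : 'M[R]_3) : \det b = 1 -> exists u p0 p1 p2,
  [/\ upper u, \det u = 1, uniq [:: p0; p1; p2] &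
    forall i j, (u *m b) i j != 0 -> (nth i0 [:: p0; p1; p2] i <= j)%N].
Proof.
have lead (m : 'M[R]_3) i : \det m = 1 -> exists p, m i p != 0 /\
    forall j, m i j != 0 -> (p <= j)%N.
  move=> dm; have rn := row_neq0 i dm.
  have [z0|n0] := eqVneq (m i i0) 0; last by exists i0.
  have [z1|n1] := eqVneq (m i i1) 0.
    have [z2|n2] := eqVneq (m i i2) 0.
      by exfalso; case/eqP: rn; apply/rowP => j; rewrite !mxE; ord3 j.
    by exists i2; split=> // j; ord3 j; rewrite ?z0 ?z1 ?eqxx.
  by exists i1; split=> // j; ord3 j; rewrite ?z0 ?eqxx.
move=> db; have [p2 [n2 l2]] := lead b i2 db.
pose u1 : 'M[R]_3 := mx3 [:: [:: 1; 0; - (b i0 p2 / b i2 p2)];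
  [:: 0; 1; - (b i1 p2 / b i2 p2)]; [:: 0; 0; 1]].
have [b1 b1E] : exists b1, b1 = u1 *m b by eexists.
have d1 : \det b1 = 1 by rewrite b1E det_mulmx db mulr1 det3 !mxE /=; ring.
have r2 j : b1 i2 j = b i2 j by rewrite b1E mulmx_entry !mxE /=; ring.
have z12 : b1 i1 p2 = 0 by rewrite b1E mulmx_entry !mxE /=; field.
have z02 : b1 i0 p2 = 0 by rewrite b1E mulmx_entry !mxE /=; field.
have [p1 [n1 l1]] := lead b1 i1 d1.
pose u2 : 'M[R]_3 := mx3 [:: [:: 1; - (b1 i0 p1 / b1 i1 p1); 0];
  [:: 0; 1; 0]; [:: 0; 0; 1]].
have [b2 b2E] : exists b2, b2 = u2 *m b1 by eexists.
have d2 : \det b2 = 1 by rewrite b2E det_mulmx d1 mulr1 det3 !mxE /=; ring.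
have r2' j : b2 i2 j = b1 i2 j by rewrite b2E mulmx_entry !mxE /=; ring.
have r1 j : b2 i1 j = b1 i1 j by rewrite b2E mulmx_entry !mxE /=; ring.
have z01 : b2 i0 p1 = 0 by rewrite b2E mulmx_entry !mxE /=; field.
have z02' : b2 i0 p2 = 0 by rewrite b2E mulmx_entry !mxE /= z12 z02; ring.
have [p0 [n0 l0]] := lead b2 i0 d2.
have uu1 : upper u1 by split; rewrite mxE.
have uu2 : upper u2 by split; rewrite mxE.
have [uu _] := upperM uu2 uu1.
exists (u2 *m u1), p0, p1, p2; split=> //.
- by rewrite (det_upper uu) !mulmx_entry !mxE /=; ring.
- rewrite /= !inE negb_or andbT; apply/andP; split; [apply/andP; split|].
  + by apply: contraNneq n0 => ->; rewrite z01.
  + by apply: contraNneq n0 => ->; rewrite z02'.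
  + by apply: contraNneq n1 => ->; rewrite z12.
- move=> i j; rewrite -mulmxA -b1E -b2E; ord3 i => /=.
  + exact: l0.
  + by rewrite r1; exact: l1.
  + by rewrite r2' r2; exact: l2.
Qed.

Lemma sorted3_le (D : 'rV[R]_3) (i j : 'I_3) : sorted3 D -> (i <= j)%N ->
  D 0 j <= D 0 i.
Proof. by move=> [s1 s2]; ord3 i; ord3 j => //= _; lra. Qed.

Definition permute (D : 'rV[R]_3) (p : 'I_3 * 'I_3 * 'I_3) : 'rV[R]_3 :=
  rv (D 0 p.1.1) (D 0 p.1.2) (D 0 p.2).

Lemma dir_permute (D : 'rV[R]_3) (p0 p1 p2 : 'I_3) :
  uniq [:: p0; p1; p2] -> dir D -> dir (permute D (p0, p1, p2)).
Proof.
move=> u [D0 /norm2_eq1 D1]; split; last apply/norm2_eq1.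
  by move: D0 u; rewrite /tr0 !sum3; ord3 p0; ord3 p1; ord3 p2; rewrite //= !mxE /=; lra.
by move: D1 u; rewrite !dot_sqr; ord3 p0; ord3 p1; ord3 p2; rewrite //= !mxE /=; lra.
Qed.

(** The rows of the echelon form tell how the second flag is positioned in a frame
    adapted to the first. *)
Lemma common_apartment (h h' : 'M[R]_3) (D M : 'rV[R]_3) :
  \det h = 1 -> \det h' = 1 -> dir D -> dir M -> sorted3 D -> sorted3 M ->
  exists k p, [/\ \det k = 1, dir (permute M p), ideal_point h D = ideal_point k D &
    ideal_point h' M = ideal_point k (permute M p)].
Proof.
move=> dh dh' dD dM sD sM.
have db : \det (invmx h *m h') = 1 by rewrite det_mulmx det_inv1// dh' mulr1.
have [u [p0 [p1 [p2 [uu du up hp]]]]] := echelon db.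
have du' := det_inv1 du.
have dk : \det (h *m invmx u) = 1 by rewrite det_mulmx dh du' mulr1.
have ik : invmx (h *m invmx u) = u *m invmx h.
  apply: invmx_left; rewrite !mulmxA mulmxKV ?unitmx_det1//.
  by rewrite mulmxV// unitmx_det1.
have dP := dir_permute up dM.
exists (h *m invmx u), (p0, p1, p2); split=> //.
  apply/esym/(ideal_point_eq dk dh dD dD); rewrite ik mulmxKV ?unitmx_det1// => i j.
  have [u10 u20 u21] := uu; move=> nz; apply: (sorted3_le sD); move: nz.
  by ord3 i; ord3 j => //; rewrite ?u10 ?u20 ?u21 eqxx.
apply/esym/(ideal_point_eq dk dh' dP dM); rewrite ik -mulmxA => i j /hp.
by move=> /(sorted3_le sM); rewrite /permute mxE; ord3 i.
Qed.

(** By the triangle inequality, the argument of [acos] is between -1 and 1. *)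
Lemma comparison_angle_bound (c c' : R -> 'M[R]_3) (s t : R) :
  geodesic_ray X d c -> geodesic_ray X d c' -> c 0 = c' 0 -> 0 < s -> 0 < t ->
  0 <= comparison_angle d c c' s t <= pi.
Proof.
move=> [cX cd] [cX' cd'] e s0 t0; have sl := ltW s0; have tl := ltW t0.
have Xs := cX s sl; have Xt := cX' t tl; have X0 := cX 0 (lexx _).
have e1 : d (c 0) (c s) = s by rewrite cd// sub0r normrN gtr0_norm.
have e2 : d (c 0) (c' t) = t by rewrite e cd'// sub0r normrN gtr0_norm.
have h1 := dist_triangle Xs Xt X0.
have h2 := dist_triangle X0 Xs Xt.
have h3 := dist_triangle X0 Xt Xs.
rewrite (distC Xs X0) e1 e2 in h1.
rewrite (distC Xt Xs) e1 e2 in h2; rewrite e1 e2 in h3.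
have q0 := dist_ge0 Xs Xt.
have st : 0 < 2 * s * t by rewrite !mulr_gt0.
have b : -1 <= (s ^+ 2 + t ^+ 2 - d (c s) (c' t) ^+ 2) / (2 * s * t) <= 1.
  move: (d (c s) (c' t)) h1 h2 h3 q0 => q h1 h2 h3 q0.
  rewrite ler_pdivlMr// ler_pdivrMr//; apply/andP; split; nra.
by rewrite /comparison_angle acos_ge0// acos_lepi.
Qed.

Lemma ray_angle_le_pi (c c' : R -> 'M[R]_3) :
  geodesic_ray X d c -> geodesic_ray X d c' -> c 0 = c' 0 ->
  ray_angle d c c' <= pi.
Proof.
move=> gc gc' e.
have b (x : R) : 0 < x -> [set comparison_angle d c c' st.1 st.2 | st in
    [set st : R * R | 0 < st.1 < x /\ 0 < st.2 < x]] !=set0 /\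
    ubound [set comparison_angle d c c' st.1 st.2 | st in
    [set st : R * R | 0 < st.1 < x /\ 0 < st.2 < x]] pi.
  move=> x0; have x2 : 0 < x / 2 < x by apply/andP; split; lra.
  split; first by exists (comparison_angle d c c' (x / 2) (x / 2)), (x / 2, x / 2).
  move=> _ [[s t] [/andP[s0 _] /andP[t0 _]] <-] /=.
  by have /andP[] := comparison_angle_bound gc gc' e s0 t0.
apply: (@le_trans _ _ (sup [set comparison_angle d c c' st.1 st.2 | st in
    [set st : R * R | 0 < st.1 < 1 /\ 0 < st.2 < 1]])); last first.
  by have [? ?] := b 1 ltr01; apply: ge_sup.
apply: inf_lbound; last by exists 1 => //=.
exists 0 => _ [x /= x0 <-]; have [[y yA] ub] := b x x0.
apply: le_trans (_ : y <= _); last by apply: sup_ubound => //; exists pi.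
move: yA => [[s t] [/andP[s0 _] /andP[t0 _]] <-] /=.
by have /andP[] := comparison_angle_bound gc gc' e s0 t0.
Qed.

(** In a flat the comparison angles are all equal to the Euclidean angle. *)
Lemma ray_angle_flat (k : 'M[R]_3) (D D' : 'rV[R]_3) : \det k = 1 ->
  dir D -> dir D' -> ray_angle d (ray k D) (ray k D') = acos (dot D D').
Proof.
move=> dk [D0 D1] [D0' D1'].
have ca (s t : R) : 0 < s -> 0 < t ->
    comparison_angle d (ray k D) (ray k D') s t = acos (dot D D').
  move=> s0 t0; rewrite /comparison_angle; congr acos.
  rewrite (dist_act_flat dk (tr0Z s D0) (tr0Z t D0')) sqr_norm2.
  have -> : dot (t *: D' - s *: D) (t *: D' - s *: D) =
    t ^+ 2 * dot D' D' + s ^+ 2 * dot D D - 2 * s * t * dot D D'.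
    by rewrite /dot !sum3 !mxE; ring.
  rewrite (norm2_eq1 D).1// (norm2_eq1 D').1//; field.
  by rewrite !gt_eqF.
rewrite /ray_angle -[RHS]inf1; congr inf; rewrite eqEsubset.
have S (x : R) : 0 < x -> sup [set comparison_angle d (ray k D) (ray k D') st.1 st.2 |
    st in [set st : R * R | 0 < st.1 < x /\ 0 < st.2 < x]] = acos (dot D D').
  move=> x0; have x2 : 0 < x / 2 < x by apply/andP; split; lra.
  rewrite -[RHS]sup1; congr sup; rewrite eqEsubset; split=> [y|y ->].
    by move=> [[s t] [/andP[s0 _] /andP[t0 _]] <-] /=; rewrite ca.
  by exists (x / 2, x / 2) => //=; rewrite ca//; case/andP: x2.
split=> [y [x x0 <-]|y ->]; first exact: S.
by exists 1; [exact: ltr01|exact: S].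
Qed.

Lemma ideal_angle_ge (k : 'M[R]_3) (D D' : 'rV[R]_3) : \det k = 1 ->
  dir D -> dir D' -> acos (dot D D') <= ideal_angle d (ideal_point k D) (ideal_point k D').
Proof.
move=> dk dD dD'; apply: sup_ubound.
  exists pi => _ [[c c'] [/= [gc _] [gc' _] e] <-]; exact: ray_angle_le_pi.
exists (ray k D, ray k D'); last exact: ray_angle_flat.
by split=> /=; [exact: ideal_point_mem|exact: ideal_point_mem|rewrite /ray !scale0r].
Qed.

(** The length of a path is at least the angle between its endpoints, by the
    partition with a single interval. *)
Lemma tits_ge_angle (x y : set (R -> 'M[R]_3)) :
  ((ideal_angle d x y)%:E <= tits X d x y)%E.
Proof.
apply: le_ereal_inf_tmp => _ [c [_ _ c0 c1] <-].
apply: ereal_sup_ubound; exists [:: 1]; first by split=> //=; rewrite ltr01.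
by rewrite big_ord_recl big_ord0 addr0 /= c0 c1.
Qed.

End angles.

Section noncompact.
Variable R : realType.
Notation X := (P3 R).
Notation d := (dist R).

Definition midv : 'rV[R]_3 := rv (Num.sqrt 2)^-1 0 (- (Num.sqrt 2)^-1).

Lemma sqrt2_gt0 : 0 < Num.sqrt 2 :> R.
Proof. by rewrite sqrtr_gt0. Qed.

Lemma dir_midv : dir midv.
Proof.
split; first by rewrite /tr0 sum3 !mxE /=; ring.
by apply/norm2_eq1; rewrite dot_sqr !mxE /= sqrrN exprVn sqr_sqrtr//; field.
Qed.

Lemma sorted3_midv : sorted3 midv.
Proof.
have : 0 < (Num.sqrt 2)^-1 :> R by rewrite invr_gt0 sqrt2_gt0.
by split; rewrite !mxE /=; lra.
Qed.

Definition midpoint (n : nat) : tits_space X d := ideal_point (shear n%:R) midv.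

Lemma midpoint_inj : injective midpoint.
Proof.
have s0 : 0 < (Num.sqrt 2)^-1 :> R by rewrite invr_gt0 sqrt2_gt0.
move=> m n /ideal_point_shear_inj-/(_ dir_midv) e.
by apply/eqP; rewrite -(eqr_nat R); apply/eqP/e; rewrite !mxE.
Qed.

Lemma ideal_fix_midpoint n : ideal_fix (transvection R) (midpoint n).
Proof.
apply: (edge_of_fixed (det_shear _) (shear_meets_c2 _)).
by exists midv => //; split; [exact: dir_midv|exact: sorted3_midv].
Qed.

Lemma dot_dir_bound (D D' : 'rV[R]_3) : dir D -> dir D' -> D <> D' ->
  -1 <= dot D D' < 1.
Proof.
move=> [_ /norm2_eq1 D1] [_ /norm2_eq1 D1'] ne.
have dB : dot (D - D') (D - D') = 2 - 2 * dot D D'.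
  have -> : dot (D - D') (D - D') = dot D D + dot D' D' - 2 * dot D D'.
    by rewrite /dot !sum3 !mxE; ring.
  by rewrite D1 D1'; ring.
have dA : dot (D + D') (D + D') = 2 + 2 * dot D D'.
  have -> : dot (D + D') (D + D') = dot D D + dot D' D' + 2 * dot D D'.
    by rewrite /dot !sum3 !mxE; ring.
  by rewrite D1 D1'; ring.
have := dot_ge0 (D + D'); rewrite dA => h; apply/andP; split; first by lra.
have : 0 < dot (D - D') (D - D').
  rewrite lt_neqAle dot_ge0 andbT eq_sym; apply/eqP => z; apply: ne.
  by apply/eqP; rewrite -subr_eq0; apply/eqP/norm2_eq0; rewrite /norm2 z sqrtr0.
by rewrite dB; lra.
Qed.

(** In a common apartment, the angle between [y] and a midpoint takes one of
    finitely many values, which depend on the direction of [y] only. *)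
Lemma midpoint_separated (y : tits_space X d) : exists2 e : R, 0 < e &
  forall n, midpoint n <> y -> (e%:E <= tits X d y (midpoint n))%E.
Proof.
have [ye|ny] := pselect (ends X d X y); last first.
  exists 1 => // n _; apply: le_ereal_inf_tmp => _ [c [cX _ c0 _] <-].
  by exfalso; apply: ny; rewrite -c0; apply: cX; rewrite lexx ler01.
have [h [D [dh dD sD yE]]] := ends_sorted ye.
pose A p := acos (dot D (permute midv p)).
exists (\big[Num.min/1]_(p | 0 < A p) A p); first by apply: lt_bigmin.
move=> n ny; apply: (le_trans _ (tits_ge_angle y (midpoint n))); rewrite lee_fin.
have [k [p [dk dP e1 e2]]] :=
  common_apartment dh (det_shear n%:R) dD dir_midv sD sorted3_midv.
have Ap : 0 < A p.
  apply/acos_gt0/dot_dir_bound => // e; apply: ny.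
  exact: (etrans e2 (etrans (congr1 (ideal_point k) (esym e)) (esym (etrans yE e1)))).
apply: le_trans (bigmin_le_cond _ _ Ap) _.
by rewrite yE e1 /midpoint e2; exact: ideal_angle_ge.
Qed.

(** The midpoints of infinitely many edges of [X_g(oo)] have no cluster point, as
    they are uniformly separated from each given point. *)
Lemma noncompact_ideal_fix : ~ compact (ideal_fix (transvection R)).
Proof.
move=> K; have Fa : (midpoint @ \oo) (ideal_fix (transvection R)).
  by exists 0%N => // n _; exact: ideal_fix_midpoint.
have [x [_ xc]] := K (midpoint @ \oo) _ Fa.
(* At most one of the midpoints is equal to [x]; [V] omits all others. *)
pose V : set (tits_space X d) := [set y | forall n, midpoint n <> x -> y <> midpoint n].
have Vo : open V.
  move=> y yV; have [e e0 he] := midpoint_separated y; exists e => //.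
  move=> z yz n nx zn; rewrite zn in yz.
  have := he n (fun e => yV n nx (esym e)).
  by rewrite leNgt yz.
have Vx : V x by move=> n nx xn; exact: nx.
have nV : nbhs x V by apply: open_nbhs_nbhs; split.
have Fs : (midpoint @ \oo) [set z | exists2 n, z = midpoint n & midpoint n <> x].
  have [[n0 n0x]|no] := pselect (exists n, midpoint n = x); last first.
    by exists 0%N => // n _; exists n => // nx; apply: no; exists n.
  exists n0.+1 => // n /= n0n; exists n => //; rewrite -n0x => /midpoint_inj e.
  by rewrite e ltnn in n0n.
have [z [[n zn nx] /(_ n nx)]] := xc _ _ Fs nV.
exact.
Qed.

End noncompact.

Lemma classify_transvection (R : realType) :
  let g := mx3 [:: [:: 1; 0; 0]; [:: 0; 1; 1]; [:: 0; 0; 1]] in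
  [/\ parabolic (P3 R) (dist R) (sl_act g),
      ideal_fix g = \bigcup_(E in incident_edges (chamber R 2)) E,
      ~ compact (ideal_fix g),
      ~ countable [set E | edge E /\ E `<=` ideal_fix g] &
      displacement (P3 R) (dist R) (sl_act g) = 0].
Proof.
split.
- exact: parabolic_transvection.
- exact: ideal_fix_transvection.
- exact: noncompact_ideal_fix.
- exact: uncountable_edges.
- exact: displacement_transvection.
Qed.

Theorem theorem6p1 (R : realType) :
  let X := P3 R in
  let d := dist R in
  (* (1) *)
  (let g := mx3 [:: [:: 1; 0; 0]; [:: 0; 1; 1]; [:: 0; 0; 1]] in
   [/\ parabolic X d (sl_act g),
       ideal_fix g = \bigcup_(E in incident_edges (chamber R 2)) E,
       ~ compact (ideal_fix g),
       ~ countable [set E | edge E /\ E `<=` ideal_fix g] &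
       displacement X d (sl_act g) = 0]) /\
  (* (2) *)
  (forall a : R, a != 0 -> a != 1 ->
   let g := mx3 [:: [:: 1 / a ^+ 2; 0; 0]; [:: 0; a; 1]; [:: 0; 0; a]] in
   [/\ parabolic X d (sl_act g),
       ideal_fix g = chamber R 1 `|` chamber R 2 `|` chamber R 3 &
       displacement X d (sl_act g) = 2 * Num.sqrt 6 * `|ln `|a| |]) /\
  (* (3) *)
  (let g := mx3 [:: [:: 1; 1; 0]; [:: 0; 1; 1]; [:: 0; 0; 1]] in
   [/\ parabolic X d (sl_act g),
       ideal_fix g = chamber R 1 &
       displacement X d (sl_act g) = 0]) /\
  (* (4) *)
  (forall a b : R, a ^+ 2 + b ^+ 2 != 0 -> b != 0 ->
   let g := mx3 [:: [:: a; b; 0]; [:: - b; a; 0];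
                    [:: 0; 0; 1 / (a ^+ 2 + b ^+ 2)]] in
   [/\ semi_simple X d (sl_act g),
       ideal_fix g = vtx R 2 `|` vtx R 5,
       (a ^+ 2 + b ^+ 2 = 1 ->
        elliptic X (sl_act g) /\ fix_set X (sl_act g) = range (gamma0 R)) &
       (a ^+ 2 + b ^+ 2 != 1 ->
        [/\ hyperbolic X d (sl_act g),
            displacement X d (sl_act g) =
              Num.sqrt 6 * `|ln (a ^+ 2 + b ^+ 2)| &
            min_set X d (sl_act g) = range (gamma0 R)])]) /\
  (* (5) *)
  (forall a b c : R, a != b -> b != c -> a != c -> a * b * c = 1 ->
   let g := diag3 a b c in
   [/\ hyperbolic X d (sl_act g),
       displacement X d (sl_act g) =
         2 * Num.sqrt (ln `|a| ^+ 2 + ln `|b| ^+ 2 + ln `|c| ^+ 2),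
       ideal_fix g = A0 R &
       min_set X d (sl_act g) = F0 R]) /\
  (* (6) *)
  (forall a : R, a != 0 -> a != 1 ->
   let g := diag3 a a (1 / a ^+ 2) in
   [/\ (a != -1 -> hyperbolic X d (sl_act g)) /\ (a = -1 -> elliptic X (sl_act g)),
       displacement X d (sl_act g) = 2 * Num.sqrt 6 * `|ln `|a| |,
       ideal_fix g = ends X d (parallel_set X d (gamma0 R)) &
       min_set X d (sl_act g) = parallel_set X d (gamma0 R)]) /\
  (* (7) *)
  (let g := 1%:M : 'M[R]_3 in
   [/\ forall p, X p -> sl_act g p = p,
       elliptic X (sl_act g),
       fix_set X (sl_act g) = X &
       ideal_fix g = ideal_boundary R]).
Proof.
move=> X d; split; first exact: classify_transvection.
split; first exact: classify_split_jordan_block.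
split; first exact: classify_regular_unipotent.
split; first exact: classify_rotation_dilation.
split; first exact: classify_regular_diagonal.
split; first exact: classify_singular_diagonal.
exact: classify_identity.
Qed.
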